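(* Let $H$ be a finite dimensional Hopf algebra over $\mathbb{C}$ acting inner-faithfully on the first Weyl algebra $A_1(\mathbb{C})=\mathbb{C}\langle u,v\rangle/(vu-uv-1)$ such that the action preserves the standard filtration. Then $H=\mathbb{C}G$ where $G$ is a finite subgroup of $SL_2(\mathbb{C})$ which is conjugate to one of the following special subgroups: (1) a cyclic group of order $n$; (2) a binary dihedral group of order $4n$; (3) a binary tetrahedral group of order $24$; (4) a binary octahedral group of order $48$; or (5) a binary icosahedral group of order $120$.
   Context: $H$ acts on an algebra $R$ if $R$ is a left $H$-module algebra. The standard filtration of $A_1(\mathbb{C})$ is $F_n=(\mathbb{C}1+\mathbb{C}u+\mathbb{C}v)^n$; the action preserves it if $\mathbb{C}1+\mathbb{C}u+\mathbb{C}v$ (hence every $F_n$) is an $H$-submodule. A left $H$-module $M$ is inner-faithful if $IM\neq0$ for every nonzero Hopf ideal $I$ of $H$; the action is inner-faithful if the $H$-module $R$ is. *)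

(* Defs.v *)
From HB Require Import structures.
From mathcomp Require Import all_boot all_order all_algebra all_fingroup all_field.
From mathcomp Require Import finmap.
From mathcomp Require Import boolp reals.
From mathcomp Require Import complex monalg.

Set Implicit Arguments.
Unset Strict Implicit.
Unset Printing Implicit Defensive.

Import Order.TTheory GRing.Theory Num.Theory.
Local Open Scope ring_scope.
Local Open Scope quotient_scope.

Section Tensor.
Import VectorInternalTheory.
Variable K : fieldType.

(* U (x) V is realised as the coefficient matrices on the family of pure
   tensors of the coordinate bases of U and V; [tlift_tens] and [tens_ext] give
   its universal property. *)
Definition tensor (U V : vectType K) : predArgType := 'M[K]_(dim U, dim V).

HB.instance Definition _ (U V : vectType K) :=
  Vector.copy (tensor U V) 'M[K]_(dim U, dim V).

Definition tens (U V : vectType K) (u : U) (v : V) : tensor U V :=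
  (v2r u)^T *m v2r v.

(* The map U (x) V -> W induced by a bilinear map F : U x V -> W *)
Definition tlift (U V : vectType K) (W : lmodType K) (F : U -> V -> W)
    (t : tensor U V) : W :=
  \sum_(i < dim U) \sum_(j < dim V)
     t i j *: F (r2v (delta_mx 0 i)) (r2v (delta_mx 0 j)).

Lemma vec_coord (U : vectType K) (u : U) :
  u = \sum_(i < dim U) v2r u 0 i *: r2v (delta_mx 0 i).
Proof.
apply: (can_inj (@v2rK _ U)); rewrite linear_sum {1}(row_sum_delta (v2r u)).
by apply: eq_bigr => i _; rewrite linearZ /= r2vK.
Qed.

Lemma tlift_is_linear (U V : vectType K) (W : lmodType K) (F : U -> V -> W) :
  linear (tlift F).
Proof.
move=> a s t; rewrite /tlift scaler_sumr -big_split; apply: eq_bigr => i _ /=.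
rewrite scaler_sumr -big_split; apply: eq_bigr => j _ /=.
by rewrite !mxE scalerDl scalerA.
Qed.

HB.instance Definition _ (U V : vectType K) (W : lmodType K) (F : U -> V -> W) :=
  GRing.isLinear.Build K (tensor U V) W *:%R (tlift F) (tlift_is_linear F).

Lemma tlift_tens (U V : vectType K) (W : lmodType K) (F : U -> V -> W) u v :
  (forall y, linear (F^~ y)) -> (forall x, linear (F x)) ->
  tlift F (tens u v) = F u v.
Proof.
move=> Fl Fr.
have Fs1 y n (c : 'I_n -> K) (x : 'I_n -> U) :
    F (\sum_i c i *: x i) y = \sum_i c i *: F (x i) y.
  pose g : {linear U -> W} :=
    HB.pack (F^~ y) (GRing.isLinear.Build K U W *:%R (F^~ y) (Fl y)).
  by rewrite -[LHS]/(g _) linear_sum; apply: eq_bigr => i _; rewrite linearZ.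
have Fs2 x n (c : 'I_n -> K) (y : 'I_n -> V) :
    F x (\sum_i c i *: y i) = \sum_i c i *: F x (y i).
  pose g : {linear V -> W} :=
    HB.pack (F x) (GRing.isLinear.Build K V W *:%R (F x) (Fr x)).
  by rewrite -[LHS]/(g _) linear_sum; apply: eq_bigr => i _; rewrite linearZ.
rewrite {2}(vec_coord u) Fs1 /tlift; apply: eq_bigr => i _.
rewrite {2}(vec_coord v) Fs2 scaler_sumr; apply: eq_bigr => j _.
by rewrite scalerA !mxE big_ord1 !mxE.
Qed.

Lemma tens_linearl (U V : vectType K) (v : V) : linear (fun u : U => tens u v).
Proof. by move=> a x y; rewrite /tens !linearP mulmxDl scalemxAl. Qed.

Lemma tens_linearr (U V : vectType K) (u : U) : linear (@tens U V u).
Proof. by move=> a x y; rewrite /tens !linearP. Qed.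

Lemma tlift_id (U V : vectType K) (t : tensor U V) : tlift (@tens U V) t = t.
Proof.
rewrite /tlift [RHS]matrix_sum_delta; apply: eq_bigr => i _.
apply: eq_bigr => j _; congr (_ *: _); rewrite /tens !r2vK.
by rewrite trmx_delta mul_delta_mx.
Qed.

Lemma tens_ext (U V : vectType K) (W : lmodType K) (f g : {linear tensor U V -> W}) :
  (forall u v, f (tens u v) = g (tens u v)) -> f =1 g.
Proof.
move=> fg t; rewrite -(tlift_id t) !linear_sum; apply: eq_bigr => i _.
by rewrite !linear_sum; apply: eq_bigr => j _; rewrite !linearZ /= fg.
Qed.

(* The subspace U (x) V of T1 (x) T2 *)
Definition tensv (T1 T2 : vectType K) (U : {vspace T1}) (V : {vspace T2}) :
  {vspace tensor T1 T2} := <<[seq tens u v | u <- vbasis U, v <- vbasis V]>>%VS.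

End Tensor.

(* [tlift (fun h1 h2 => E) (comul h)] is the Sweedler sum of E over (h). *)
HB.mixin Record isHopf (K : fieldType) H of Falgebra K H := {
  comul : {linear H -> tensor H H};
  counit : {linear H -> K^o};
  antipode : {linear H -> H};
  comulA : forall h : H,
    tlift (fun h1 h2 =>
      tlift (fun h11 h12 => tens (tens h11 h12) h2) (comul h1)) (comul h) =
    tlift (fun h1 h2 =>
      tlift (fun h21 h22 => tens (tens h1 h21) h22) (comul h2)) (comul h);
  counitl : forall h : H, tlift (fun h1 h2 => counit h1 *: h2) (comul h) = h;
  counitr : forall h : H, tlift (fun h1 h2 => counit h2 *: h1) (comul h) = h;
  comul1 : comul 1 = tens 1 1;
  comulM : forall h k : H, comul (h * k) =
    tlift (fun h1 h2 =>
      tlift (fun k1 k2 => tens (h1 * k1) (h2 * k2)) (comul k)) (comul h);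
  counit1 : counit 1 = 1;
  counitM : forall h k : H, counit (h * k) = counit h * counit k;
  antipodel : forall h : H,
    tlift (fun h1 h2 => antipode h1 * h2) (comul h) = (counit h : K)%:A;
  antipoder : forall h : H,
    tlift (fun h1 h2 => h1 * antipode h2) (comul h) = (counit h : K)%:A
}.

#[short(type="hopfAlgType")]
HB.structure Definition HopfAlgebra (K : fieldType) :=
  { H of isHopf K H & Falgebra K H }.

Definition hopf_isomorphic (K : fieldType) (H1 H2 : hopfAlgType K) : Prop :=
  exists f : {lrmorphism H1 -> H2}, [/\ bijective f,
    forall h, comul (f h) = tlift (fun h1 h2 => tens (f h1) (f h2)) (comul h),
    forall h, counit (f h) = counit h
  & forall h, antipode (f h) = f (antipode h)].

Definition hopf_ideal (K : fieldType) (H : hopfAlgType K) (I : {vspace H}) : Prop :=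
  [/\ forall h x, x \in I -> h * x \in I /\ x * h \in I,
      forall x, x \in I -> comul x \in (tensv I fullv + tensv fullv I)%VS,
      forall x, x \in I -> counit x = 0
    & forall x, x \in I -> antipode x \in I].

Record module_algebra (K : fieldType) (H : hopfAlgType K) (A : algType K)
    (act : H -> A -> A) : Prop := ModuleAlgebra {
  act_linearl : forall a, linear (act^~ a);
  act_linearr : forall h, linear (act h);
  act1 : forall a, act 1 a = a;
  actM : forall h k a, act (h * k) a = act h (act k a);
  act_mul : forall h a b,
    act h (a * b) = tlift (fun h1 h2 => act h1 a * act h2 b) (comul h);
  act_one : forall h, act h 1 = (counit h : K)%:A
}.

Definition inner_faithful (K : fieldType) (H : hopfAlgType K) (M : lmodType K)
    (act : H -> M -> M) : Prop :=
  forall I : {vspace H}, hopf_ideal I -> I != 0%VS ->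
    exists h m, h \in I /\ act h m != 0.

Local Notation repr := generic_quotient.repr.

Section Weyl.
Variable K : fieldType.

Definition free_alg2 := {malg K[{fmonom 'I_2}]}.
HB.instance Definition _ := GRing.Lalgebra.on free_alg2.

Definition free_u : free_alg2 := << fmu (0 : 'I_2) >>.
Definition free_v : free_alg2 := << fmu (1 : 'I_2) >>.
Definition weyl_rel : free_alg2 := free_v * free_u - free_u * free_v - 1.

Definition weyl_ideal (f : free_alg2) : Prop :=
  exists s : seq (free_alg2 * free_alg2),
    f = \sum_(p <- s) p.1 * weyl_rel * p.2.

Lemma weyl_ideal0 : weyl_ideal 0.
Proof. by exists [::]; rewrite big_nil. Qed.

Lemma weyl_idealD f g : weyl_ideal f -> weyl_ideal g -> weyl_ideal (f + g).
Proof. by case=> s -> [t ->]; exists (s ++ t); rewrite big_cat. Qed.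

Lemma weyl_idealMl f g : weyl_ideal g -> weyl_ideal (f * g).
Proof.
case=> s ->; exists [seq (f * p.1, p.2) | p <- s].
by rewrite big_map mulr_sumr; apply: eq_bigr => p _; rewrite !mulrA.
Qed.

Lemma weyl_idealMr f g : weyl_ideal f -> weyl_ideal (f * g).
Proof.
case=> s ->; exists [seq (p.1, p.2 * g) | p <- s].
by rewrite big_map mulr_suml; apply: eq_bigr => p _; rewrite !mulrA.
Qed.

Lemma weyl_idealN f : weyl_ideal f -> weyl_ideal (- f).
Proof. by rewrite -mulN1r; apply: weyl_idealMl. Qed.

Definition weyl_eqv (f g : free_alg2) : bool := `[< weyl_ideal (f - g) >].

Lemma weyl_eqv_is_equiv : equiv_class_of weyl_eqv.
Proof.
split=> [f|f g|g f h].
- by apply/asboolP; rewrite subrr; apply: weyl_ideal0.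
- by apply/asboolP/asboolP => /weyl_idealN; rewrite opprB.
- move=> /asboolP fg /asboolP gh; apply/asboolP.
  by rewrite -(subrK g f) -addrA; apply: weyl_idealD.
Qed.

Canonical weyl_equiv := EquivRelPack weyl_eqv_is_equiv.

Definition weyl := {eq_quot weyl_equiv}.
HB.instance Definition _ := Choice.on weyl.
HB.instance Definition _ := EqQuotient.on weyl.

Let weylP f g : weyl_ideal (f - g) -> \pi_weyl f = \pi_weyl g.
Proof. by move=> fg; apply/eqmodP/asboolP. Qed.

Let weyl_repr f : weyl_ideal (repr (\pi_weyl f) - f).
Proof.
apply/asboolP; rewrite -[X in is_true X]/(weyl_equiv _ _).
by apply/eqmodP; rewrite reprK.
Qed.

Definition weyl_add (x y : weyl) : weyl := \pi_weyl (repr x + repr y).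
Definition weyl_opp (x : weyl) : weyl := \pi_weyl (- repr x).
Definition weyl_mul (x y : weyl) : weyl := \pi_weyl (repr x * repr y).
Definition weyl_scale (c : K) (x : weyl) : weyl := \pi_weyl (c *: repr x).

Let piD f g : weyl_add (\pi_weyl f) (\pi_weyl g) = \pi_weyl (f + g).
Proof.
by apply: weylP; rewrite opprD addrACA; apply: weyl_idealD; apply: weyl_repr.
Qed.

Let piN f : weyl_opp (\pi_weyl f) = \pi_weyl (- f).
Proof. by apply: weylP; rewrite -opprD; apply/weyl_idealN/weyl_repr. Qed.

Let piM f g : weyl_mul (\pi_weyl f) (\pi_weyl g) = \pi_weyl (f * g).
Proof.
apply: weylP; set f' := repr _; set g' := repr _.
have -> : f' * g' - f * g = (f' - f) * g' + f * (g' - g).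
  by rewrite mulrBl mulrBr addrA subrK.
by apply: weyl_idealD; [apply: weyl_idealMr|apply: weyl_idealMl]; apply: weyl_repr.
Qed.

Let piZ c f : weyl_scale c (\pi_weyl f) = \pi_weyl (c *: f).
Proof.
apply: weylP; rewrite -scalerBr -mul_malgC.
by apply/weyl_idealMl/weyl_repr.
Qed.

Let weylW (P : weyl -> Prop) : (forall f, P (\pi_weyl f)) -> forall x, P x.
Proof. by move=> Pf x; rewrite -(reprK x). Qed.

Fact weyl_addA : associative weyl_add.
Proof. by do 3!elim/weylW=> ?; rewrite !piD addrA. Qed.
Fact weyl_addC : commutative weyl_add.
Proof. by do 2!elim/weylW=> ?; rewrite !piD addrC. Qed.
Fact weyl_add0 : left_id (\pi_weyl 0) weyl_add.
Proof. by elim/weylW=> f; rewrite piD add0r. Qed.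
Fact weyl_addN : left_inverse (\pi_weyl 0) weyl_opp weyl_add.
Proof. by elim/weylW=> f; rewrite piN piD addNr. Qed.

HB.instance Definition _ :=
  GRing.isZmodule.Build weyl weyl_addA weyl_addC weyl_add0 weyl_addN.

(* K[x], with u acting by multiplication by x and v by d/dx, shows that the
   relation does not collapse the quotient. *)
Definition weyl_letter (i : 'I_2) (p : {poly K}) : {poly K} :=
  if i == 0 then 'X * p else p^`().
Definition weyl_word (w : {fmonom 'I_2}) (p : {poly K}) : {poly K} :=
  foldr weyl_letter p w.
Definition weyl_poly (f : free_alg2) (p : {poly K}) : {poly K} :=
  \sum_(w <- msupp f) f@_w *: weyl_word w p.

Let weyl_word_linear w : linear (weyl_word w).
Proof.
case: w => w a p q; rewrite /weyl_word /=; elim: w => //= i w ->.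
by rewrite /weyl_letter; case: ifP => _; [rewrite mulrDr scalerAr|rewrite linearP].
Qed.

Let weyl_polyEw (d : {fset {fmonom 'I_2}}) f p : (msupp f `<=` d)%fset ->
  weyl_poly f p = \sum_(w <- d) f@_w *: weyl_word w p.
Proof.
move=> le; rewrite /weyl_poly (big_fset_incl _ le) //= => w _ /mcoeff_outdom ->.
by rewrite scale0r.
Qed.

Let weyl_polyD f g p : weyl_poly (f + g) p = weyl_poly f p + weyl_poly g p.
Proof.
rewrite (weyl_polyEw p (msuppD_le f g)).
rewrite (weyl_polyEw p (fsubsetUl (msupp f) (msupp g))).
rewrite (weyl_polyEw p (fsubsetUr (msupp f) (msupp g))) -big_split /=.
by apply: eq_bigr => w _; rewrite mcoeffD scalerDl.
Qed.

Let weyl_polyU c w p : weyl_poly << c *g w >> p = c *: weyl_word w p.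
Proof. by rewrite (weyl_polyEw p msuppU_le) big_seq_fset1 mcoeffUU. Qed.

Let weyl_poly0 p : weyl_poly 0 p = 0.
Proof. by rewrite /weyl_poly msupp0 big_seq_fset0. Qed.

Let weyl_poly_sum (I : Type) (s : seq I) (F : I -> free_alg2) p :
  weyl_poly (\sum_(i <- s) F i) p = \sum_(i <- s) weyl_poly (F i) p.
Proof. exact: (big_morph (weyl_poly^~ p) (fun f g => weyl_polyD f g p)). Qed.

Let weyl_polyM f g p : weyl_poly (f * g) p = weyl_poly f (weyl_poly g p).
Proof.
rewrite malgME weyl_poly_sum [RHS]/weyl_poly; apply: eq_bigr => w _.
pose h : {linear {poly K} -> {poly K}} := HB.pack (weyl_word w)
  (GRing.isLinear.Build K _ _ *:%R (weyl_word w) (weyl_word_linear w)).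
rewrite weyl_poly_sum -[weyl_word w _]/(h _) linear_sum scaler_sumr.
apply: eq_bigr => x _.
by rewrite weyl_polyU linearZ scalerA /= /weyl_word fmM foldr_cat.
Qed.

Let weyl_polyN f p : weyl_poly (- f) p = - weyl_poly f p.
Proof. by apply/eqP; rewrite -addr_eq0 -weyl_polyD addNr weyl_poly0. Qed.

Let weyl_poly1 p : weyl_poly 1 p = p.
Proof. by rewrite weyl_polyU scale1r /weyl_word fm1. Qed.

Let weyl_poly_rel p : weyl_poly weyl_rel p = 0.
Proof.
rewrite !weyl_polyD !weyl_polyN !weyl_polyM weyl_poly1 !weyl_polyU !scale1r.
rewrite /weyl_word !fmU /= /weyl_letter /= derivM derivX mul1r.
by rewrite addrK subrr.
Qed.

Lemma weyl_ideal_proper : ~ weyl_ideal 1.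
Proof.
case=> s /(congr1 (weyl_poly^~ 1)); rewrite weyl_poly1 weyl_poly_sum big1 => [|q _].
  by move/eqP; rewrite oner_eq0.
rewrite !weyl_polyM weyl_poly_rel.
rewrite /weyl_poly big1 // => w _; have := weyl_word_linear w (-1) 0 0.
by rewrite scaler0 addr0 scaleN1r addNr => ->; rewrite scaler0.
Qed.

Let piA f g : \pi_weyl f + \pi_weyl g = \pi_weyl (f + g) := piD f g.

Fact weyl_mulA : associative weyl_mul.
Proof. by do 3!elim/weylW=> ?; rewrite !piM mulrA. Qed.
Fact weyl_mul1l : left_id (\pi_weyl 1) weyl_mul.
Proof. by elim/weylW=> f; rewrite piM mul1r. Qed.
Fact weyl_mul1r : right_id (\pi_weyl 1) weyl_mul.
Proof. by elim/weylW=> f; rewrite piM mulr1. Qed.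
Fact weyl_mulDl : left_distributive weyl_mul +%R.
Proof. by do 3!elim/weylW=> ?; rewrite !(piA, piM) mulrDl. Qed.
Fact weyl_mulDr : right_distributive weyl_mul +%R.
Proof. by do 3!elim/weylW=> ?; rewrite !(piA, piM) mulrDr. Qed.
Fact weyl_1neq0 : \pi_weyl 1 != 0 :> weyl.
Proof.
apply/eqP => /eqmodP/asboolP; rewrite subr0.
exact: weyl_ideal_proper.
Qed.

HB.instance Definition _ := GRing.Zmodule_isNzRing.Build weyl
  weyl_mulA weyl_mul1l weyl_mul1r weyl_mulDl weyl_mulDr weyl_1neq0.

Fact weyl_scaleA a b x : weyl_scale a (weyl_scale b x) = weyl_scale (a * b) x.
Proof. by elim/weylW: x => f; rewrite !piZ scalerA. Qed.
Fact weyl_scale1 : left_id 1 weyl_scale.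
Proof. by elim/weylW=> f; rewrite piZ scale1r. Qed.
Fact weyl_scaleDr : right_distributive weyl_scale +%R.
Proof. by move=> a; do 2!elim/weylW=> ?; rewrite !(piA, piZ) scalerDr. Qed.
Fact weyl_scaleDl x : {morph weyl_scale^~ x : a b / a + b}.
Proof. by elim/weylW: x => f a b /=; rewrite !(piA, piZ) scalerDl. Qed.

HB.instance Definition _ := GRing.Zmodule_isLmodule.Build K weyl
  weyl_scaleA weyl_scale1 weyl_scaleDr weyl_scaleDl.

Fact weyl_scaleAl (a : K) (x y : weyl) : a *: (x * y) = (a *: x) * y.
Proof.
elim/weylW: x => f; elim/weylW: y => g.
rewrite -![_ * _]/(weyl_mul _ _) -![_ *: _]/(weyl_scale _ _).
by rewrite piM !piZ piM scalerAl.
Qed.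

HB.instance Definition _ := GRing.Lmodule_isLalgebra.Build K weyl weyl_scaleAl.

Let free_scaleAr (a : K) (f g : free_alg2) : a *: (f * g) = f * (a *: g).
Proof.
have comm_aC : a%:MP * f = f * a%:MP.
  rewrite !malgM_def fgmulUg fgmulgU; apply: eq_bigr => w _.
  by rewrite mulrC mul1m mulm1.
by rewrite -!mul_malgC !mulrA comm_aC.
Qed.

Fact weyl_scaleAr (a : K) (x y : weyl) : a *: (x * y) = x * (a *: y).
Proof.
elim/weylW: x => f; elim/weylW: y => g.
rewrite -![_ * _]/(weyl_mul _ _) -![_ *: _]/(weyl_scale _ _).
by rewrite piM !piZ piM free_scaleAr.
Qed.

HB.instance Definition _ := GRing.Lalgebra_isAlgebra.Build K weyl weyl_scaleAr.

Definition weyl_u : weyl := \pi_weyl free_u.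
Definition weyl_v : weyl := \pi_weyl free_v.

Lemma weyl_relation : weyl_v * weyl_u - weyl_u * weyl_v = 1.
Proof.
rewrite [_ * _]piM [weyl_u * _]piM [- _]piN [_ + _]piD; apply: weylP.
by exists [:: (1, 1)]; rewrite big_seq1 mul1r mulr1.
Qed.

(* F_1 = K 1 + K u + K v, which generates the standard filtration F_n = F_1 ^ n *)
Definition weyl_F1 (a : weyl) : Prop :=
  exists c : K * K * K, a = c.1.1%:A + c.1.2 *: weyl_u + c.2 *: weyl_v.

Definition preserves_std_filtration (H : hopfAlgType K) (act : H -> weyl -> weyl) :
  Prop := forall h a, weyl_F1 a -> weyl_F1 (act h a).

End Weyl.

Section GroupAlgebra.
Variables (K : fieldType) (gT : finGroupType).

Definition grpalg : predArgType := {ffun gT -> K^o}.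
HB.instance Definition _ := Vector.copy grpalg {ffun gT -> K^o}.

Definition grp_elt (g : gT) : grpalg := [ffun x => (x == g)%:R].

(* Convolution: the bilinear extension of the product of gT *)
Definition grpalg_mul (f1 f2 : grpalg) : grpalg :=
  [ffun z => \sum_(x : gT) f1 x * f2 (x^-1 * z)%g].

Fact grpalg_mulA : associative grpalg_mul.
Proof.
move=> f1 f2 f3; apply/ffunP=> z; rewrite !ffunE.
under eq_bigr do rewrite ffunE mulr_sumr.
under [RHS]eq_bigr do rewrite ffunE mulr_suml.
rewrite [RHS]exchange_big /=; apply: eq_bigr => x _.
rewrite [RHS](reindex_inj (mulgI x)) /=; apply: eq_bigr => y _.
by rewrite mulKg mulrA invMg mulgA.
Qed.

Fact grpalg_mul1l : left_id (grp_elt 1) grpalg_mul.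
Proof.
move=> f; apply/ffunP=> z; rewrite ffunE (bigD1 1%g) //= ffunE eqxx mul1r.
rewrite invg1 mul1g big1 ?addr0 // => x /negPf x1.
by rewrite ffunE x1 mul0r.
Qed.

Fact grpalg_mul1r : right_id (grp_elt 1) grpalg_mul.
Proof.
move=> f; apply/ffunP=> z; rewrite ffunE (bigD1 z) //= ffunE mulVg eqxx mulr1.
rewrite big1 ?addr0 // => x /negPf xz.
by rewrite ffunE -eq_invg_mul invgK xz mulr0.
Qed.

Fact grpalg_mulDl : left_distributive grpalg_mul +%R.
Proof.
move=> f1 f2 f3; apply/ffunP=> z; rewrite !ffunE -big_split /=.
by apply: eq_bigr => x _; rewrite !ffunE mulrDl.
Qed.

Fact grpalg_mulDr : right_distributive grpalg_mul +%R.
Proof.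
move=> f1 f2 f3; apply/ffunP=> z; rewrite !ffunE -big_split /=.
by apply: eq_bigr => x _; rewrite !ffunE mulrDr.
Qed.

Fact grpalg_1neq0 : grp_elt 1 != 0.
Proof. by apply/eqP=> /ffunP/(_ 1%g)/eqP; rewrite !ffunE eqxx oner_eq0. Qed.

HB.instance Definition _ := GRing.Zmodule_isNzRing.Build grpalg
  grpalg_mulA grpalg_mul1l grpalg_mul1r grpalg_mulDl grpalg_mulDr grpalg_1neq0.

Fact grpalg_scaleAl (a : K) (f1 f2 : grpalg) : a *: (f1 * f2) = (a *: f1) * f2.
Proof.
apply/ffunP=> z; rewrite !ffunE scaler_sumr; apply: eq_bigr => x _.
by rewrite !ffunE scalerAl.
Qed.

HB.instance Definition _ := GRing.Lmodule_isLalgebra.Build K grpalg grpalg_scaleAl.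

Fact grpalg_scaleAr (a : K) (f1 f2 : grpalg) : a *: (f1 * f2) = f1 * (a *: f2).
Proof.
apply/ffunP=> z; rewrite !ffunE scaler_sumr; apply: eq_bigr => x _.
by rewrite !ffunE scalerAr.
Qed.

HB.instance Definition _ := GRing.Lalgebra_isAlgebra.Build K grpalg grpalg_scaleAr.
HB.instance Definition _ := Algebra_isFalgebra.Build K grpalg.

Lemma grpalgE (f : grpalg) : f = \sum_g f g *: grp_elt g.
Proof.
apply/ffunP=> x; rewrite sum_ffunE (bigD1 x) //= !ffunE eqxx.
rewrite [_ *: _]mulr1 big1 ?addr0 // => g /negPf gx.
by rewrite !ffunE eq_sym gx [_ *: _]mulr0.
Qed.

Lemma grp_eltM g h : grp_elt g * grp_elt h = grp_elt (g * h).
Proof.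
apply/ffunP=> z; rewrite !ffunE (bigD1 g) //= !ffunE eqxx mul1r.
rewrite big1 ?addr0 => [|x /negPf xg]; last by rewrite ffunE xg mul0r.
by rewrite -(inj_eq (mulgI g)) mulKVg.
Qed.

Definition grpalg_comul (f : grpalg) : tensor grpalg grpalg :=
  \sum_g f g *: tens (grp_elt g) (grp_elt g).
Definition grpalg_counit (f : grpalg) : K^o := \sum_g f g.
Definition grpalg_antipode (f : grpalg) : grpalg := \sum_g f g *: grp_elt g^-1.

Fact grpalg_comul_is_linear : linear grpalg_comul.
Proof.
move=> a f1 f2; rewrite /grpalg_comul scaler_sumr -big_split; apply: eq_bigr => g _.
by rewrite !ffunE scalerDl scalerA.
Qed.
HB.instance Definition _ :=
  GRing.isLinear.Build K grpalg _ *:%R grpalg_comul grpalg_comul_is_linear.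

Fact grpalg_counit_is_linear : linear grpalg_counit.
Proof.
move=> a f1 f2; rewrite /grpalg_counit scaler_sumr -big_split; apply: eq_bigr => g _.
by rewrite !ffunE.
Qed.
HB.instance Definition _ :=
  GRing.isLinear.Build K grpalg K^o *:%R grpalg_counit grpalg_counit_is_linear.

Fact grpalg_antipode_is_linear : linear grpalg_antipode.
Proof.
move=> a f1 f2; rewrite /grpalg_antipode scaler_sumr -big_split.
by apply: eq_bigr => g _; rewrite !ffunE scalerDl scalerA.
Qed.
HB.instance Definition _ :=
  GRing.isLinear.Build K grpalg grpalg *:%R grpalg_antipode grpalg_antipode_is_linear.

Let elt_sum (W : lmodType K) (F : gT -> W) g :
  \sum_h grp_elt g h *: F h = F g.
Proof.
rewrite (bigD1 g) //= ffunE eqxx scale1r big1 ?addr0 // => h /negPf hg.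
by rewrite ffunE hg scale0r.
Qed.

Lemma grpalg_comul_elt g : grpalg_comul (grp_elt g) = tens (grp_elt g) (grp_elt g).
Proof. exact: elt_sum. Qed.
Lemma grpalg_counit_elt g : grpalg_counit (grp_elt g) = 1.
Proof.
rewrite -[RHS](elt_sum (fun=> 1 : K^o) g).
by apply: eq_bigr => h _; rewrite [_ *: _]mulr1.
Qed.
Lemma grpalg_antipode_elt g : grpalg_antipode (grp_elt g) = grp_elt g^-1.
Proof. exact: elt_sum. Qed.

Let elt_ext (W : lmodType K) (f1 f2 : grpalg -> W) : linear f1 -> linear f2 ->
  (forall g, f1 (grp_elt g) = f2 (grp_elt g)) -> f1 =1 f2.
Proof.
move=> l1 l2 e f; rewrite (grpalgE f).
pose h1 : {linear grpalg -> W} := HB.pack f1 (GRing.isLinear.Build K _ _ *:%R f1 l1).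
pose h2 : {linear grpalg -> W} := HB.pack f2 (GRing.isLinear.Build K _ _ *:%R f2 l2).
rewrite -[LHS]/(h1 _) -[RHS]/(h2 _) !linear_sum; apply: eq_bigr => g _.
by rewrite !linearZ /= e.
Qed.

Let lift_comul (W : lmodType K) (F : grpalg -> grpalg -> W) :
  linear (fun f => tlift F (grpalg_comul f)).
Proof. by move=> a f1 f2; rewrite !linearP. Qed.

Let tlift_linear_param (W : lmodType K) (F : grpalg -> grpalg -> grpalg -> W) t :
  (forall x y, linear (fun a => F a x y)) -> linear (fun a => tlift (F a) t).
Proof.
move=> lF a f1 f2; rewrite /tlift scaler_sumr -big_split; apply: eq_bigr => i _ /=.
rewrite scaler_sumr -big_split; apply: eq_bigr => j _ /=.
by rewrite lF scalerDr !scalerA mulrC.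
Qed.

Let tens_l := @tens_linearl K.
Let tens_r := @tens_linearr K.

Fact grpalg_comulA f :
  tlift (fun h1 h2 =>
    tlift (fun h11 h12 => tens (tens h11 h12) h2) (grpalg_comul h1)) (grpalg_comul f) =
  tlift (fun h1 h2 =>
    tlift (fun h21 h22 => tens (tens h1 h21) h22) (grpalg_comul h2)) (grpalg_comul f).
Proof.
move: f; apply: elt_ext; [exact: lift_comul|exact: lift_comul|move=> g].
rewrite grpalg_comul_elt !tlift_tens.
- rewrite grpalg_comul_elt !tlift_tens // => x a y z.
  + by rewrite tens_r tens_l.
  + exact: tens_r.
  + by rewrite tens_l tens_l.
  + by rewrite tens_r tens_l.
- by move=> y; apply: tlift_linear_param => x z a u w; rewrite !tens_l.
- by move=> x; apply: lift_comul.
- by move=> y; apply: lift_comul.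
- by move=> x; apply: tlift_linear_param => u w a y z; rewrite tens_r.
Qed.

Fact grpalg_counitl f : tlift (fun h1 h2 => grpalg_counit h1 *: h2) (grpalg_comul f) = f.
Proof.
move: f; apply: elt_ext; [exact: lift_comul|by []|move=> g].
rewrite grpalg_comul_elt tlift_tens ?grpalg_counit_elt ?scale1r // => y a u w.
  by rewrite linearP scalerDl scalerA.
by rewrite scalerDr !scalerA mulrC.
Qed.

Fact grpalg_counitr f : tlift (fun h1 h2 => grpalg_counit h2 *: h1) (grpalg_comul f) = f.
Proof.
move: f; apply: elt_ext; [exact: lift_comul|by []|move=> g].
rewrite grpalg_comul_elt tlift_tens ?grpalg_counit_elt ?scale1r // => y a u w.
  by rewrite scalerDr !scalerA mulrC.
by rewrite linearP scalerDl scalerA.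
Qed.

Fact grpalg_comul1 : grpalg_comul 1 = tens 1 1.
Proof. exact: grpalg_comul_elt. Qed.

Let mul_linl (f2 : grpalg) : linear (fun f1 : grpalg => f1 * f2).
Proof. by move=> a u w; rewrite mulrDl scalerAl. Qed.
Let mul_linr (f1 : grpalg) : linear (fun f2 : grpalg => f1 * f2).
Proof. by move=> a u w; rewrite mulrDr scalerAr. Qed.

Fact grpalg_comulM f1 f2 : grpalg_comul (f1 * f2) =
  tlift (fun h1 h2 => tlift (fun k1 k2 => tens (h1 * k1) (h2 * k2))
    (grpalg_comul f2)) (grpalg_comul f1).
Proof.
move: f1; apply: elt_ext => [a u w||g]; [|exact: lift_comul|].
  by rewrite mul_linl linearP.
rewrite grpalg_comul_elt tlift_tens; first last.
- move=> x; apply: tlift_linear_param => u w a y z.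
  by rewrite mul_linl tens_r.
- move=> y; apply: tlift_linear_param => u w a x z.
  by rewrite mul_linl tens_l.
move: f2; apply: elt_ext => [a u w||h]; [|exact: lift_comul|].
  by rewrite mul_linr linearP.
rewrite grpalg_comul_elt tlift_tens => [|y a u w|x a u w].
- by rewrite grp_eltM grpalg_comul_elt.
- by rewrite mul_linr tens_l.
- by rewrite mul_linr tens_r.
Qed.

Fact grpalg_counit1 : grpalg_counit 1 = 1.
Proof. exact: grpalg_counit_elt. Qed.

Fact grpalg_counitM f1 f2 :
  grpalg_counit (f1 * f2) = grpalg_counit f1 * grpalg_counit f2.
Proof.
move: f1; apply: elt_ext => [a u w|a u w|g].
- by rewrite mul_linl linearP.
- by rewrite linearP mulrDl scalerAl.
rewrite grpalg_counit_elt mul1r.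
move: f2; apply: elt_ext => [a u w|a u w|h].
- by rewrite mul_linr linearP.
- by rewrite linearP.
by rewrite grp_eltM !grpalg_counit_elt.
Qed.

Let counitA_linear : linear (fun f : grpalg => (grpalg_counit f : K)%:A : grpalg).
Proof. by move=> a u w; rewrite linearP scalerDl scalerA. Qed.

Fact grpalg_antipodel f :
  tlift (fun h1 h2 => grpalg_antipode h1 * h2) (grpalg_comul f) =
  (grpalg_counit f : K)%:A.
Proof.
move: f; apply: elt_ext; [exact: lift_comul|exact: counitA_linear|move=> g].
rewrite grpalg_comul_elt tlift_tens => [|y a u w|x a u w].
- by rewrite grpalg_antipode_elt grp_eltM mulVg grpalg_counit_elt scale1r.
- by rewrite linearP mul_linl.
- exact: mul_linr.
Qed.

Fact grpalg_antipoder f :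
  tlift (fun h1 h2 => h1 * grpalg_antipode h2) (grpalg_comul f) =
  (grpalg_counit f : K)%:A.
Proof.
move: f; apply: elt_ext; [exact: lift_comul|exact: counitA_linear|move=> g].
rewrite grpalg_comul_elt tlift_tens => [|y a u w|x a u w].
- by rewrite grpalg_antipode_elt grp_eltM mulgV grpalg_counit_elt scale1r.
- exact: mul_linl.
- by rewrite linearP mul_linr.
Qed.

HB.instance Definition _ := isHopf.Build K grpalg
  grpalg_comulA grpalg_counitl grpalg_counitr grpalg_comul1 grpalg_comulM
  grpalg_counit1 grpalg_counitM grpalg_antipodel grpalg_antipoder.

End GroupAlgebra.

Record finSL2 (K : fieldType) := FinSL2 {
  finSL2_set :> {fset 'M[K]_2};
  finSL2_det : forall A, A \in finSL2_set -> \det A = 1;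
  finSL2_1 : 1%:M \in finSL2_set;
  finSL2_M : forall A B, A \in finSL2_set -> B \in finSL2_set ->
    A *m B \in finSL2_set;
  finSL2_V : forall A, A \in finSL2_set -> invmx A \in finSL2_set
}.

Section FinSL2Group.
Variables (K : fieldType) (G : finSL2 K).

Definition finSL2_elt : predArgType := finSL2_set G.
HB.instance Definition _ := Finite.on finSL2_elt.

Definition finSL2_mul (x y : finSL2_elt) : finSL2_elt :=
  [` finSL2_M (valP x) (valP y)]%fset.
Definition finSL2_one : finSL2_elt := [` finSL2_1 G]%fset.
Definition finSL2_inv (x : finSL2_elt) : finSL2_elt :=
  [` finSL2_V (valP x)]%fset.

Fact finSL2_mulA : associative finSL2_mul.
Proof. by move=> x y z; apply/val_inj; rewrite /= mulmxA. Qed.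
Fact finSL2_mul1 : left_id finSL2_one finSL2_mul.
Proof. by move=> x; apply/val_inj; rewrite /= mul1mx. Qed.
Fact finSL2_mulV : left_inverse finSL2_one finSL2_inv finSL2_mul.
Proof.
move=> x; apply/val_inj; rewrite /= mulVmx //.
by rewrite unitmxE (finSL2_det (valP x)) unitr1.
Qed.

HB.instance Definition _ :=
  Finite_isGroup.Build finSL2_elt finSL2_mulA finSL2_mul1 finSL2_mulV.

End FinSL2Group.

Inductive generated (K : fieldType) (S : seq 'M[K]_2) : 'M[K]_2 -> Prop :=
| Generated1 : generated S 1%:M
| GeneratedM A B : A \in S -> generated S B -> generated S (A *m B)
| GeneratedV A B : A \in S -> generated S B -> generated S (invmx A *m B).

Definition conjugate_SL2 (K : fieldType) (G : finSL2 K) (S : 'M[K]_2 -> Prop) : Prop :=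
  exists2 P : 'M[K]_2, \det P = 1
    & forall A, A \in finSL2_set G <-> S (P *m A *m invmx P).

Section Special.
Variable R : realType.
Local Notation C := R[i].
Local Notation sqrt := Num.sqrt.

(* The matrix of the quaternion a + b i + c j + d k under H -> M_2(C) *)
Definition quat (a b c d : R) : 'M[C]_2 :=
  \matrix_(i < 2, j < 2)
    (if i == 0 then if j == 0 then Complex a b else Complex c d
     else if j == 0 then Complex (- c) d else Complex a (- b)).

Definition diagSL2 (z : C) : 'M[C]_2 :=
  \matrix_(i < 2, j < 2) (if i == j then if i == 0 then z else z^-1 else 0).

Definition cyclic_SL2 (z : C) := generated [:: diagSL2 z].

Definition binary_dihedral (z : C) := generated [:: diagSL2 z; quat 0 0 1 0].

(* The units of the Hurwitz quaternions *)
Definition binary_tetrahedral :=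
  generated [:: quat 0 1 0 0; quat 0 0 1 0; quat 2^-1 2^-1 2^-1 2^-1].

Definition binary_octahedral :=
  generated [:: quat 2^-1 2^-1 2^-1 2^-1; quat (sqrt 2)^-1 (sqrt 2)^-1 0 0].

Definition golden : R := (1 + sqrt 5) / 2.

(* The unit icosians *)
Definition binary_icosahedral :=
  generated [:: quat 2^-1 2^-1 2^-1 2^-1; quat (golden / 2) (golden^-1 / 2) 2^-1 0].

(* z runs over the primitive n-th, resp. 2n-th, roots of unity; the subgroup
   does not depend on the choice of z. *)
Definition is_cyclic_SL2 (n : nat) (G : finSL2 C) : Prop :=
  exists z : C, [/\ n.-primitive_root z, conjugate_SL2 G (cyclic_SL2 z)
    & #|` finSL2_set G| = n].

Definition is_binary_dihedral (n : nat) (G : finSL2 C) : Prop :=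
  exists z : C, [/\ (2 * n).-primitive_root z, conjugate_SL2 G (binary_dihedral z)
    & #|` finSL2_set G| = (4 * n)%N].

Definition is_binary_tetrahedral (G : finSL2 C) : Prop :=
  conjugate_SL2 G binary_tetrahedral /\ #|` finSL2_set G| = 24.

Definition is_binary_octahedral (G : finSL2 C) : Prop :=
  conjugate_SL2 G binary_octahedral /\ #|` finSL2_set G| = 48.

Definition is_binary_icosahedral (G : finSL2 C) : Prop :=
  conjugate_SL2 G binary_icosahedral /\ #|` finSL2_set G| = 120.

End Special.

(* Main.v *)
(* The coefficients of the coaction u |-> u (x) a + v (x) c + 1 (x) p,
   v |-> u (x) b + v (x) d + 1 (x) q of the dual Hopf algebra H^* satisfy the relations
   imposed by v u - u v = 1. Then D = a d - b c is grouplike and differs from 1 by a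
   commutator, so it acts on H^* with the trace of the identity; having finite order, it
   is 1. This makes a, b, c, d commute pairwise. A commutative sub-bialgebra stable under
   the antipode is reduced: by the trace form, whose radical is stable under translations.
   Hence a, b, c, d are simultaneously diagonalisable, and a finiteness argument on
   unipotent points shows that p, q commute with them and with each other. Inner
   faithfulness means that the six coefficients generate H^*, so H^* is commutative and
   reduced, and H is the group algebra of its grouplike elements. On this finite group
   (p, q) is a coboundary, so that g |-> (a b; c d)(g) is a faithful representation in SL_2.

   A finite subgroup of SL_2 acts on the finite set of poles, the traceless square roots Q
   of 1 which commute with some noncentral element. Every noncentral element fixes exactly
   two poles, and counting orbits leaves at most three of them, with the classical orders
   of stabilisers. In the polyhedral cases a Sylow 2-subgroup is binary dihedral by the
   same classification, so the group contains the quaternions i and j up to conjugation.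
   The coordinates of every element are then halves of traces, which belong to a short
   list of real numbers; this determines an element of trace 1 or of trace the golden ratio
   up to conjugation, and the orders of the subgroup generated by it are compared. *)
From HB Require Import structures.
Require Import Defs.
From mathcomp Require Import all_boot all_order all_algebra all_fingroup all_solvable all_field.
From mathcomp Require Import finmap.
From mathcomp Require Import boolp reals.
From mathcomp Require Import complex monalg.
From mathcomp Require Import ring lra zify.

Set Implicit Arguments.
Unset Strict Implicit.
Unset Printing Implicit Defensive.

Import Order.TTheory GRing.Theory Num.Theory.
Local Open Scope ring_scope.

(** Before the end of the algebraic part there is no group to argue with, so group arguments are
    imitated in [dual H]: a character of a subalgebra is evaluation at an element of H (a [point]),
    and points are multiplied, and inverted by the antipode. This makes p and q accessible. For
    points x, y with matrices M(x), M(y) of determinant 1, det (M(x) - M(y)) = 2 - tr (M(x)^-1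
    M(y)), so a singular difference yields a unipotent point, whose matrix is 1; hence distinct
    joint eigenvalues have invertible differences, and the linear relations on p and q force their
    commutators with a, b, c, d to vanish. In the classification no invariant Hermitian form is
    constructed. A pole Q amounts to an ordered pair of distinct lines, and -Q replaces the
    antipode. The orders of the stabilisers alone do not give a conjugacy class, whence the detour
    through Sylow subgroups: once i and j lie in the group, the traces of g, g i, g j, g k determine
    g, and their being real makes the complex matrix g a quaternion. *)

Section Matrix2.
Variable R : comNzRingType.
Implicit Types A B : 'M[R]_2.

Lemma det_mx2 A : \det A = A 0 0 * A 1 1 - A 0 1 * A 1 0.
Proof.
rewrite (expand_det_row _ 0) !big_ord_recl big_ord0 addr0 /cofactor !det_mx11 !mxE /=.
rewrite expr0 mul1r expr1 mulN1r mulrN; congr (_ * A _ _ - A _ _ * A _ _);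
  exact: val_inj.
Qed.

Lemma mx2P A B : A 0 0 = B 0 0 -> A 0 1 = B 0 1 -> A 1 0 = B 1 0 -> A 1 1 = B 1 1 -> A = B.
Proof.
move=> e00 e01 e10 e11; apply/matrixP => i j.
have [->|->] : i = 0 \/ i = 1 by case: i => -[|[|//]] i; [left|right]; apply: val_inj.
  by have [->|->] : j = 0 \/ j = 1 by case: j => -[|[|//]] j; [left|right]; apply: val_inj.
by have [->|->] : j = 0 \/ j = 1 by case: j => -[|[|//]] j; [left|right]; apply: val_inj.
Qed.

Lemma mul_mx2 A B i j : (A *m B) i j = A i 0 * B 0 j + A i 1 * B 1 j.
Proof.
rewrite mxE !big_ord_recl big_ord0 addr0; congr (_ + A _ _ * B _ _); exact: val_inj.
Qed.

Lemma mxtrace2 A : \tr A = A 0 0 + A 1 1.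
Proof.
rewrite /mxtrace !big_ord_recl big_ord0 addr0; congr (_ + A _ _); exact: val_inj.
Qed.

End Matrix2.

(** * Traces of matrices *)

Section MatrixTraces.
Variable C : numClosedFieldType.

Lemma trig_mxM n (A B : 'M[C]_n) : is_trig_mx A -> is_trig_mx B ->
  is_trig_mx (A *m B) /\ forall i, (A *m B) i i = A i i * B i i.
Proof.
move=> /is_trig_mxP tA /is_trig_mxP tB; split=> [|i].
  apply/is_trig_mxP => i j ij; rewrite mxE big1 // => k _.
  have [ik|ki] := ltnP i k; first by rewrite tA ?mul0r.
  by rewrite tB ?mulr0 // (leq_ltn_trans ki).
rewrite mxE (bigD1 i) //= big1 ?addr0 // => k ki.
have [ik|ki'] := ltnP i k; first by rewrite tA ?mul0r.
by rewrite tB ?mulr0 // ltn_neqAle ki' andbT.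
Qed.

Lemma trig_mx_horner n (A : 'M[C]_n.+1) p : is_trig_mx A ->
  is_trig_mx (horner_mx A p) /\ forall i, horner_mx A p i i = p.[A i i].
Proof.
move=> tA; elim/poly_ind: p => [|p c [tp Ep]].
  by rewrite raddf0; split=> [|i]; rewrite ?mx0_is_trig // mxE horner0.
rewrite rmorphD rmorphM /= horner_mx_X horner_mx_C.
have [tpA EpA] := trig_mxM tp tA; split=> [|i].
  apply/is_trig_mxP => i j ij; rewrite mxE (is_trig_mxP tpA) // mxE.
  by rewrite -val_eqE ltn_eqF // addr0.
by rewrite mxE EpA Ep !mxE eqxx !hornerE.
Qed.

(** Schur triangularisation: [e] lists the eigenvalues with multiplicity, as the diagonal of a
    triangular conjugate, on which polynomials act entrywise. *)
Lemma trace_horner n (A : 'M[C]_n.+1) : exists e : 'I_n.+1 -> C,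
  [/\ horner_mx A (\prod_i ('X - (e i)%:P)) = 0,
      forall p i, horner_mx A p = 0 -> p.[e i] = 0
    & forall p, \tr (horner_mx A p) = \sum_i p.[e i]].
Proof.
have [P uP tA] := Schur A (ltn0Sn n).
have Pu : P \in unitmx by apply: unitarymx_unit.
pose T := P *m A *m invmx P.
have tT : is_trig_mx T by move: tA; rewrite /similar_to conjumx.
have EA : A = invmx P *m T *m P by rewrite /T !mulmxA mulVmx // mul1mx mulmxKV.
have hA p : horner_mx A p = invmx P *m horner_mx T p *m P.
  by rewrite [in LHS]EA horner_mx_uconjC.
have hT p : horner_mx T p = P *m horner_mx A p *m invmx P.
  by rewrite /T horner_mx_uconj.
exists (fun i => T i i); split=> [|p i pA|p].
- by rewrite hA -char_poly_trig // Cayley_Hamilton mulmx0 mul0mx.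
- have [_ <-] := trig_mx_horner p tT.
  by rewrite hT pA mulmx0 mul0mx mxE.
- have [_ ET] := trig_mx_horner p tT.
  rewrite -(eq_bigr _ (fun i _ => ET i)) -[RHS]/(\tr _) hA.
  by rewrite mxtrace_mulC mulmxA mulmxV ?mul1mx.
Qed.

Lemma mxtrace_nilpotent_nz n (A : 'M[C]_n.+1) k : A ^+ k = 0 -> \tr A = 0.
Proof.
move=> Ak; have [e [_ e0 Et]] := trace_horner A.
have := Et 'X; rewrite horner_mx_X => ->; rewrite big1 // => i _.
have := e0 'X^k i; rewrite rmorphXn /= horner_mx_X => /(_ Ak)/eqP.
by rewrite !hornerE expf_eq0 => /andP[_ /eqP].
Qed.

(** Choose [p] with value 1 at 0 and vanishing at the nonzero eigenvalues. Then [1 - p] is divisible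
    by ['X], so its trace at [A] is 0; but this trace counts the nonzero eigenvalues. *)
Lemma nilpotent_of_traces_nz n (A : 'M[C]_n.+1) :
  (forall p, \tr (A * horner_mx A p) = 0) -> A ^+ n.+1 = 0.
Proof.
move=> tr0; have [e [Ee _ Et]] := trace_horner A.
pose s := [seq x <- undup (codom e) | x != 0].
pose p := \prod_(x <- s) (1 - x^-1 *: 'X) : {poly C}.
have p0 : p.[0] = 1.
  by rewrite horner_prod big1_seq // => x _; rewrite hornerD hornerN hornerZ hornerX hornerC mulr0 subr0.
have pe i : e i != 0 -> p.[e i] = 0.
  move=> ei0; have ei : e i \in s by rewrite mem_filter ei0 mem_undup codom_f.
  apply/eqP; rewrite horner_prod prodf_seq_eq0; apply/hasP; exists (e i) => //=.
  by rewrite hornerD hornerN hornerZ hornerX hornerC mulVf ?subrr.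
have [q Eq] : exists q, 1 - p = 'X * q.
  have /factor_theorem[q ->] : root (1 - p) 0 by rewrite /root !hornerE p0 subrr.
  by exists q; rewrite subr0 mulrC.
have := Et (1 - p); rewrite {1}Eq rmorphM /= horner_mx_X tr0.
rewrite (eq_bigr (fun i => (e i != 0)%:R)) => [|i _]; last first.
  rewrite !hornerE; have [->|ei] := eqVneq; first by rewrite p0 subrr.
  by rewrite pe ?subr0.
move/esym/eqP; rewrite psumr_eq0 => [/allP e0|i _]; last exact: ler0n.
have {}e0 i : e i = 0.
  by have := e0 i (mem_index_enum _); rewrite pnatr_eq0 eqb0 negbK => /eqP.
move: Ee; rewrite (eq_bigr (fun=> 'X)) => [|i _]; last by rewrite e0 subr0.
by rewrite prodr_const card_ord rmorphXn /= horner_mx_X.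
Qed.

(** The eigenvalues have modulus 1 and sum to their number, so the equality case of the triangle
    inequality makes them all 1. The minimal polynomial then divides a power of X - 1 and also (X -
    1) Q, where Q(1) = m + 1 is not 0; hence it divides X - 1. *)
Lemma finite_order_trace_nz n (A : 'M[C]_n.+1) m : A ^+ m.+1 = 1 ->
  \tr A = n.+1%:R -> A = 1.
Proof.
move=> Am trA; have [e [Ee e0 Et]] := trace_horner A.
have hA : horner_mx A ('X^(m.+1) - 1) = 0.
  by rewrite rmorphB rmorphXn rmorph1 /= horner_mx_X Am subrr.
have em i : e i ^+ m.+1 = 1.
  by have /eqP := e0 _ i hA; rewrite !hornerE subr_eq0 => /eqP.
have en i : `|e i| = 1.
  by apply/eqP; rewrite -(@pexpr_eq1 _ _ m.+1) // -normrX em normr1.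
have e1 i : e i = 1.
  apply: (@normC_sum_upper C 'I_n.+1 predT e (fun=> 1)) => // [j _|].
    by rewrite en.
  rewrite sumr_const card_ord -trA -[in RHS](horner_mx_X A) Et.
  by apply: eq_bigr => j _; rewrite hornerX.
pose Q : {poly C} := \sum_(i < m.+1) 'X^i.
have XQ : 'X^(m.+1) - 1 = ('X - 1) * Q :> {poly C} by rewrite subrX1.
have : mxminpoly A %| ('X - 1%:P) * Q.
  by rewrite -XQ; apply: mxminpoly_min.
rewrite Gauss_dvdpl => [|]; last first.
  have : mxminpoly A %| ('X - 1%:P) ^+ n.+1.
    apply: mxminpoly_min; move: Ee; rewrite (eq_bigr (fun=> 'X - 1%:P)) => [|i _].
      by rewrite prodr_const card_ord.
    by rewrite e1.
  move=> dv; apply: (coprimep_dvdr dv).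
  rewrite coprimep_sym coprimep_expr // coprimep_XsubC /root horner_sum.
  rewrite (eq_bigr (fun=> 1)) => [|i _]; last by rewrite hornerXn expr1n.
  by rewrite sumr_const card_ord pnatr_eq0.
rewrite dvd_mxminpoly rmorphB /= horner_mx_X horner_mx_C subr_eq0.
by move/eqP.
Qed.

Lemma mxtrace_nilpotent n (A : 'M[C]_n) k : A ^+ k = 0 -> \tr A = 0.
Proof.
case: n A => [|n] A; first by move=> _; rewrite /mxtrace big_ord0.
exact: mxtrace_nilpotent_nz.
Qed.

Lemma nilpotent_of_traces n (A : 'M[C]_n) :
  (forall k, \tr (A ^+ k.+1) = 0) -> A ^+ n = 0.
Proof.
case: n A => [|n] A trA; first by apply/matrixP => - [].
apply: nilpotent_of_traces_nz => p; rewrite -[p]coefK poly_def.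
rewrite !linear_sum /= mulr_sumr linear_sum big1 // => i _.
by rewrite linearZ /= rmorphXn /= horner_mx_X -scalerAr -exprS linearZ /= trA mulr0.
Qed.

Lemma finite_order_trace n (A : 'M[C]_n) m : A ^+ m.+1 = 1 ->
  \tr A = n%:R -> A = 1.
Proof.
case: n A => [|n] A; first by move=> _ _; apply/matrixP => - [].
exact: finite_order_trace_nz.
Qed.

End MatrixTraces.

(** * Traces of endomorphisms *)

Section LinearTrace.
Import VectorInternalTheory.
Variables (K : fieldType) (V : vectType K).
Implicit Types f g : 'End(V).

Definition emx_fun f (v : 'rV[K]_(dim V)) := v2r (f (r2v v)).
Fact emx_fun_linear f : linear (emx_fun f).
Proof. by move=> a u v; rewrite /emx_fun !linearP. Qed.
HB.instance Definition _ f :=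
  GRing.isLinear.Build K _ _ *:%R (emx_fun f) (emx_fun_linear f).

(** The matrix acts on row vectors from the right, whence the reversed product in [emx_comp]. *)
Definition emx f : 'M[K]_(dim V) := lin1_mx (emx_fun f).

Lemma mul_emx f v : v *m emx f = v2r (f (r2v v)).
Proof. exact: (mul_rV_lin1 (emx_fun f)). Qed.

Lemma emx_inj : injective emx.
Proof.
move=> f g fg; apply/lfunP => x; apply: (can_inj v2rK).
by rewrite -[x]v2rK -!mul_emx fg.
Qed.

Lemma emx_comp f g : emx (f \o g)%VF = emx g *m emx f.
Proof.
apply/row_matrixP => i; rewrite !rowE mulmxA !mul_emx v2rK.
by rewrite comp_lfunE.
Qed.

Lemma emx_linear : linear emx.
Proof.
move=> a f g; apply/row_matrixP => i; rewrite !rowE mulmxDr -scalemxAr !mul_emx.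
by rewrite add_lfunE scale_lfunE !linearP.
Qed.
HB.instance Definition _ := GRing.isLinear.Build K _ _ *:%R emx emx_linear.

Lemma emx_id : emx \1%VF = 1%:M.
Proof. by apply/row_matrixP => i; rewrite !rowE mul_emx id_lfunE r2vK mulmx1. Qed.

Definition ltrace f : K^o := \tr (emx f).
Lemma ltrace_linear : linear ltrace.
Proof. by move=> a f g; rewrite /ltrace !linearP. Qed.
HB.instance Definition _ := GRing.isLinear.Build K _ _ *:%R ltrace ltrace_linear.

Lemma ltraceC f g : ltrace (f \o g)%VF = ltrace (g \o f)%VF.
Proof. by rewrite /ltrace !emx_comp mxtrace_mulC. Qed.

End LinearTrace.

(** * The dual algebra and its Hopf structure *)

Section TensorLift.
Variables (K : fieldType) (U V : vectType K).

Lemma eq_tlift (W : lmodType K) (F G : U -> V -> W) t :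
  (forall x y, F x y = G x y) -> tlift F t = tlift G t.
Proof. by move=> FG; apply: eq_bigr => i _; apply: eq_bigr => j _; rewrite FG. Qed.

Lemma linear_tlift (W W' : lmodType K) (L : {linear W -> W'}) (F : U -> V -> W) t :
  L (tlift F t) = tlift (fun x y => L (F x y)) t.
Proof.
rewrite linear_sum; apply: eq_bigr => i _; rewrite linear_sum.
by apply: eq_bigr => j _; rewrite linearZ.
Qed.

Lemma tliftD (W : lmodType K) (F G : U -> V -> W) t :
  tlift (fun x y => F x y + G x y) t = tlift F t + tlift G t.
Proof.
rewrite -big_split; apply: eq_bigr => i _; rewrite -big_split.
by apply: eq_bigr => j _; rewrite scalerDr.
Qed.

Lemma tliftZ (W : lmodType K) (c : K) (F : U -> V -> W) t :
  tlift (fun x y => c *: F x y) t = c *: tlift F t.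
Proof.
rewrite scaler_sumr; apply: eq_bigr => i _; rewrite scaler_sumr.
by apply: eq_bigr => j _; rewrite !scalerA mulrC.
Qed.

Lemma tlift_sum (W : lmodType K) I (r : seq I) (F : I -> U -> V -> W) t :
  tlift (fun x y => \sum_(i <- r) F i x y) t = \sum_(i <- r) tlift (F i) t.
Proof.
elim: r => [|i r IH].
  rewrite big_nil; apply: big1 => i _; apply: big1 => j _.
  by rewrite big_nil scaler0.
by rewrite big_cons -IH -tliftD; apply: eq_tlift => x y; rewrite big_cons.
Qed.

(* [tlift] on K-valued maps, stated over K rather than over its alias K^o *)
Definition tliftK (F : U -> V -> K) t : K := tlift (F : U -> V -> K^o) t.

Lemma eq_tliftK (F G : U -> V -> K) t :
  (forall x y, F x y = G x y) -> tliftK F t = tliftK G t.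
Proof. exact: (@eq_tlift K^o). Qed.

Lemma tliftKD (F G : U -> V -> K) t :
  tliftK (fun x y => F x y + G x y) t = tliftK F t + tliftK G t.
Proof. exact: (@tliftD K^o). Qed.

Lemma tliftKZ c (F : U -> V -> K) t :
  tliftK (fun x y => c * F x y) t = c * tliftK F t.
Proof. exact: (@tliftZ K^o). Qed.

Lemma tliftKZr (F : U -> V -> K) c t :
  tliftK (fun x y => F x y * c) t = tliftK F t * c.
Proof. by rewrite mulrC -tliftKZ; apply: eq_tliftK => x y; rewrite mulrC. Qed.

Lemma tliftK_sum I (r : seq I) (F : I -> U -> V -> K) t :
  tliftK (fun x y => \sum_(i <- r) F i x y) t = \sum_(i <- r) tliftK (F i) t.
Proof. exact: (@tlift_sum K^o). Qed.

Lemma tliftZr (W : lmodType K) (F : U -> V -> K) (w : W) t :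
  tlift (fun x y => F x y *: w) t = tliftK F t *: w.
Proof.
rewrite scaler_suml; apply: eq_bigr => i _; rewrite scaler_suml.
by apply: eq_bigr => j _; rewrite scalerA.
Qed.

Lemma tlift_linear_param (W T : lmodType K) (F : T -> U -> V -> W) t :
  (forall x y, linear (fun a => F a x y)) -> linear (fun a => tlift (F a) t).
Proof.
by move=> lF a f g; rewrite -tliftZ -tliftD; apply: eq_tlift => x y; rewrite lF.
Qed.

End TensorLift.

Section Sweedler.
Variables (K : fieldType) (H : hopfAlgType K).

(** The axiom [comulA] lives in a threefold tensor product; composing it with the linear map that a
    trilinear [G] induces there gives the form needed for Sweedler sums. *)
Lemma coassoc (W : lmodType K) (G : H -> H -> H -> W) :
  (forall y z, linear (fun x => G x y z)) ->
  (forall x z, linear (fun y => G x y z)) -> (forall x y, linear (G x y)) ->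
  forall h,
  tlift (fun h1 h2 => tlift (fun a b => G a b h2) (comul h1)) (comul h) =
  tlift (fun h1 h2 => tlift (fun a b => G h1 a b) (comul h2)) (comul h).
Proof.
move=> l1 l2 l3 h.
pose P : {linear tensor (tensor H H) H -> W} :=
  tlift (fun t z => tlift (fun a b => G a b z) t).
have PE a b z : P (tens (tens a b) z) = G a b z.
  rewrite /P /= tlift_tens => [|y c s t|t].
  - by apply: tlift_tens.
  - by rewrite linearP.
  - by apply: tlift_linear_param => x y; apply: l3.
have := congr1 P (comulA h); rewrite !linear_tlift.
under eq_tlift do rewrite linear_tlift.
under [RHS]eq_tlift do rewrite linear_tlift.
under eq_tlift do under eq_tlift do rewrite PE.
by under [RHS]eq_tlift do under eq_tlift do rewrite PE.
Qed.

Lemma tlift_comulM (W : lmodType K) (F : H -> H -> W) h k :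
  (forall y, linear (F^~ y)) -> (forall x, linear (F x)) ->
  tlift F (comul (h * k)) = tlift (fun h1 h2 =>
    tlift (fun k1 k2 => F (h1 * k1) (h2 * k2)) (comul k)) (comul h).
Proof.
move=> l1 l2; rewrite comulM linear_tlift; apply: eq_tlift => x y.
by rewrite linear_tlift; apply: eq_tlift => z t; apply: tlift_tens.
Qed.

End Sweedler.

Section Dual.
Variables (K : fieldType) (H : hopfAlgType K).

(** A copy of the space of linear forms, made to carry the convolution product as its ring
    structure. *)
Definition dual : predArgType := 'Hom(H, K^o).
HB.instance Definition _ := Vector.copy dual 'Hom(H, K^o).

Definition ev (f : dual) : H -> K := fun_of_lfun f.
Fact ev_linear (f : dual) : linear (ev f : H -> K^o).
Proof. by move=> a x y; rewrite /ev linearP. Qed.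
HB.instance Definition _ f :=
  GRing.isLinear.Build K H K^o *:%R (ev f) (ev_linear f).

Definition mk_dual (f : {linear H -> K^o}) : dual := linfun f.
Lemma mk_dualE (f : {linear H -> K^o}) h : ev (mk_dual f) h = f h.
Proof. by rewrite /ev lfunE. Qed.

Lemma dualP (f g : dual) : (forall h, ev f h = ev g h) <-> f = g.
Proof. by split=> [fg|->//]; apply/lfunP => h; apply: fg. Qed.

Definition conv_fun (f g : dual) (h : H) : K^o :=
  tliftK (fun x y => ev f x * ev g y) (comul h).
Fact conv_fun_linear f g : linear (conv_fun f g).
Proof. by move=> a x y; rewrite /conv_fun /tliftK !linearP. Qed.
HB.instance Definition _ f g :=
  GRing.isLinear.Build K H K^o *:%R (conv_fun f g) (conv_fun_linear f g).

Definition conv (f g : dual) : dual := mk_dual (conv_fun f g).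
Lemma convE f g h : ev (conv f g) h = tliftK (fun x y => ev f x * ev g y) (comul h).
Proof. exact: mk_dualE. Qed.

Definition conv1 : dual := mk_dual counit.
Lemma conv1E h : ev conv1 h = counit h.
Proof. exact: mk_dualE. Qed.

Fact dualD (f g : dual) h : ev (f + g) h = ev f h + ev g h.
Proof. by rewrite /ev add_lfunE. Qed.
Fact dualZ c (f : dual) h : ev (c *: f) h = c * ev f h.
Proof. by rewrite /ev scale_lfunE. Qed.

Lemma ev_tlift (f : dual) (U V : vectType K) (F : U -> V -> H) t :
  ev f (tlift F t) = tliftK (fun x y => ev f (F x y)) t.
Proof. exact: (linear_tlift (ev f : {linear H -> K^o})). Qed.
Lemma evP (f : dual) a x y : ev f (a *: x + y) = a * ev f x + ev f y.
Proof. exact: ev_linear. Qed.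
Lemma ev_sum (f : dual) I (r : seq I) (P : pred I) (F : I -> H) :
  ev f (\sum_(i <- r | P i) F i) = \sum_(i <- r | P i) ev f (F i).
Proof. exact: (linear_sum (ev f : {linear H -> K^o})). Qed.

Lemma ev0 (f : dual) : ev f 0 = 0.
Proof. exact: (linear0 (ev f : {linear H -> K^o})). Qed.
Lemma evZ (f : dual) a x : ev f (a *: x) = a * ev f x.
Proof. exact: linearZ. Qed.

Fact convA : associative conv.
Proof.
move=> f g k; apply/dualP => h; rewrite !convE.
under eq_tliftK do rewrite convE -tliftKZ.
under [RHS]eq_tliftK do rewrite convE -tliftKZr.
rewrite /tliftK -(coassoc (G := fun x a b => ev f x * (ev g a * ev k b) : K^o)).
- by under eq_tlift do under eq_tlift do rewrite mulrA.
- by move=> y z a x x'; rewrite evP mulrDl -mulrA.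
- by move=> x z a y y'; rewrite evP mulrDl mulrDr -mulrA mulrCA.
- by move=> x y a z z'; rewrite evP !mulrDr !(mulrCA _ a).
Qed.

Fact conv1l : left_id conv1 conv.
Proof.
move=> f; apply/dualP => h; rewrite convE -[in RHS](counitl h) ev_tlift.
by apply: eq_tliftK => x y; rewrite evZ conv1E.
Qed.
Fact conv1r : right_id conv1 conv.
Proof.
move=> f; apply/dualP => h; rewrite convE -[in RHS](counitr h) ev_tlift.
by apply: eq_tliftK => x y; rewrite evZ conv1E mulrC.
Qed.
Fact convDl : left_distributive conv +%R.
Proof.
move=> f g k; apply/dualP => h; rewrite dualD !convE -tliftKD.
by apply: eq_tliftK => x y; rewrite dualD mulrDl.
Qed.
Fact convDr : right_distributive conv +%R.
Proof.
move=> f g k; apply/dualP => h; rewrite dualD !convE -tliftKD.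
by apply: eq_tliftK => x y; rewrite dualD mulrDr.
Qed.
Fact conv1_neq0 : conv1 != 0.
Proof.
apply/eqP => /dualP/(_ 1)/eqP; rewrite conv1E counit1 /ev zero_lfunE.
by rewrite oner_eq0.
Qed.
HB.instance Definition _ := GRing.Zmodule_isNzRing.Build dual
  convA conv1l conv1r convDl convDr conv1_neq0.

Fact conv_scaleAl (a : K) (f g : dual) : a *: (f * g) = (a *: f) * g.
Proof.
apply/dualP => h; rewrite dualZ !convE -tliftKZ.
by apply: eq_tliftK => x y; rewrite dualZ mulrA.
Qed.
HB.instance Definition _ := GRing.Lmodule_isLalgebra.Build K dual conv_scaleAl.
Fact conv_scaleAr (a : K) (f g : dual) : a *: (f * g) = f * (a *: g).
Proof.
apply/dualP => h; rewrite dualZ !convE -tliftKZ.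
by apply: eq_tliftK => x y; rewrite dualZ mulrCA.
Qed.
HB.instance Definition _ := GRing.Lalgebra_isAlgebra.Build K dual conv_scaleAr.
HB.instance Definition _ := Algebra_isFalgebra.Build K dual.

Lemma dual0 h : ev 0 h = 0. Proof. by rewrite /ev zero_lfunE. Qed.
Lemma dualN (f : dual) h : ev (- f) h = - ev f h.
Proof. by rewrite /ev opp_lfunE. Qed.
Lemma dualB (f g : dual) h : ev (f - g) h = ev f h - ev g h.
Proof. by rewrite dualD dualN. Qed.
Lemma dual1 h : ev 1 h = counit h. Proof. exact: conv1E. Qed.
Lemma dualM (f g : dual) h :
  ev (f * g) h = tliftK (fun x y => ev f x * ev g y) (comul h).
Proof. exact: convE. Qed.
Lemma dual_sum I (r : seq I) (P : pred I) (F : I -> dual) h :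
  ev (\sum_(i <- r | P i) F i) h = \sum_(i <- r | P i) ev (F i) h.
Proof. by rewrite /ev sum_lfunE. Qed.
Lemma dual_at1 (f g : dual) : ev (f * g) 1 = ev f 1 * ev g 1.
Proof.
rewrite dualM comul1 /tliftK tlift_tens // => [y|x] a u v.
  by rewrite evP mulrDl -mulrA.
by rewrite evP mulrDr mulrCA.
Qed.

End Dual.

(** * Coproduct and antipode of the dual *)

Section DualHopf.
Variables (K : fieldType) (H : hopfAlgType K).
Import VectorInternalTheory.
Local Notation dual := (dual H).
Implicit Types (f g : dual) (x y z : H).

Lemma tlift_exchange (U V U' V' : vectType K) (W : lmodType K)
    (F : U -> V -> U' -> V' -> W) s t :
  tlift (fun a b => tlift (fun c d => F a b c d) t) s =
  tlift (fun c d => tlift (fun a b => F a b c d) s) t.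
Proof.
rewrite {1}/tlift [RHS]tlift_sum; apply: eq_bigr => i _.
by rewrite [RHS]tlift_sum; apply: eq_bigr => j _; rewrite tliftZ.
Qed.

Lemma tliftM (U V U' V' : vectType K) (F : U -> V -> K) (G : U' -> V' -> K) s t :
  tliftK (fun a b => tliftK (fun c d => F a b * G c d) t) s = tliftK F s * tliftK G t.
Proof. by under eq_tliftK do rewrite tliftKZ; rewrite tliftKZr. Qed.

Lemma dualM_mul f g x y : ev (f * g) (x * y) =
  tliftK (fun x1 x2 => tliftK (fun y1 y2 => ev f (x1 * y1) * ev g (x2 * y2))
    (comul y)) (comul x).
Proof.
rewrite dualM /tliftK tlift_comulM // => [z|z] a u v.
  by rewrite evP mulrDl -mulrA.
by rewrite evP mulrDr mulrCA.
Qed.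

(* s lists the pairs of a decomposition of the coproduct of f, dual to the
   product of H *)
Definition is_comul f (s : seq (dual * dual)) :=
  forall x y, ev f (x * y) = \sum_(p <- s) ev p.1 x * ev p.2 y.

Lemma is_comulM f g s s' : is_comul f s -> is_comul g s' ->
  is_comul (f * g) [seq (p.1 * q.1, p.2 * q.2) | p <- s, q <- s'].
Proof.
move=> fs gs' x y; rewrite dualM_mul big_allpairs_dep /=.
transitivity (tliftK (fun x1 x2 => tliftK (fun y1 y2 =>
    \sum_(p <- s) \sum_(q <- s') (ev p.1 x1 * ev q.1 x2) * (ev p.2 y1 * ev q.2 y2))
    (comul y)) (comul x)).
  apply: eq_tliftK => x1 x2; apply: eq_tliftK => y1 y2.
  rewrite fs gs' mulr_suml; apply: eq_bigr => p _.
  by rewrite mulr_sumr; apply: eq_bigr => q _; rewrite mulrACA.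
under eq_tliftK do rewrite tliftK_sum.
rewrite tliftK_sum; apply: eq_bigr => p _.
under eq_tliftK do rewrite tliftK_sum.
rewrite tliftK_sum; apply: eq_bigr => q _.
by rewrite tliftM !dualM.
Qed.

Lemma is_comul1 : is_comul 1 [:: (1, 1)].
Proof. by move=> x y; rewrite big_seq1 !dual1 counitM. Qed.

Lemma is_comulD f g s s' : is_comul f s -> is_comul g s' -> is_comul (f + g) (s ++ s').
Proof. by move=> fs gs' x y; rewrite dualD fs gs' big_cat. Qed.

Lemma is_comulZ c f s : is_comul f s ->
  is_comul (c *: f) [seq (c *: p.1, p.2) | p <- s].
Proof.
move=> fs x y; rewrite dualZ fs big_map mulr_sumr.
by apply: eq_bigr => p _; rewrite dualZ mulrA.
Qed.

Definition antip_fun f (x : H) : K^o := ev f (antipode x).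
Fact antip_fun_linear f : linear (antip_fun f).
Proof. by move=> a x y; rewrite /antip_fun !linearP. Qed.
HB.instance Definition _ f :=
  GRing.isLinear.Build K H K^o *:%R (antip_fun f) (antip_fun_linear f).
Definition antip f : dual := mk_dual (antip_fun f).
Lemma antipE f x : ev (antip f) x = ev f (antipode x).
Proof. exact: mk_dualE. Qed.

Lemma antipZ a f : antip (a *: f) = a *: antip f.
Proof. by apply/dualP => x; rewrite !(antipE, dualZ). Qed.
Lemma antipD f g : antip (f + g) = antip f + antip g.
Proof. by apply/dualP => x; rewrite !(antipE, dualD). Qed.
Lemma antip_sum I (r : seq I) (F : I -> dual) :
  antip (\sum_(i <- r) F i) = \sum_(i <- r) antip (F i).
Proof.
elim: r => [|i r IH]; last by rewrite !big_cons antipD IH.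
by rewrite !big_nil; apply/dualP => x; rewrite antipE !dual0.
Qed.

Lemma antip_mull f s : is_comul f s ->
  \sum_(p <- s) antip p.1 * p.2 = ev f 1 *: 1.
Proof.
move=> fs; apply/dualP => h; rewrite dual_sum dualZ dual1.
transitivity (ev f (tlift (fun x y => antipode x * y) (comul h))).
  rewrite ev_tlift; under [RHS]eq_tliftK do rewrite fs.
  rewrite tliftK_sum; apply: eq_bigr => p _; rewrite dualM.
  by apply: eq_tliftK => x y; rewrite antipE.
by rewrite antipodel evZ mulrC.
Qed.

Lemma antip_mulr f s : is_comul f s ->
  \sum_(p <- s) p.1 * antip p.2 = ev f 1 *: 1.
Proof.
move=> fs; apply/dualP => h; rewrite dual_sum dualZ dual1.
transitivity (ev f (tlift (fun x y => x * antipode y) (comul h))).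
  rewrite ev_tlift; under [RHS]eq_tliftK do rewrite fs.
  rewrite tliftK_sum; apply: eq_bigr => p _; rewrite dualM.
  by apply: eq_tliftK => x y; rewrite antipE.
by rewrite antipoder evZ mulrC.
Qed.

(* The matrix coefficients of the regular representation of H span its dual. *)
Definition reg_fun (i j : 'I_(dim H)) (x : H) : K^o :=
  v2r (x * r2v (delta_mx 0 j)) 0 i.
Fact reg_fun_linear i j : linear (reg_fun i j).
Proof. by move=> a x y; rewrite /reg_fun mulrDl -scalerAl linearP !mxE. Qed.
HB.instance Definition _ i j :=
  GRing.isLinear.Build K H K^o *:%R (reg_fun i j) (reg_fun_linear i j).
Definition reg i j : dual := mk_dual (reg_fun i j).
Lemma regE i j x : ev (reg i j) x = v2r (x * r2v (delta_mx 0 j)) 0 i.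
Proof. exact: mk_dualE. Qed.

Lemma reg_at1 i j : ev (reg i j) 1 = (i == j)%:R.
Proof. by rewrite regE mul1r r2vK !mxE eqxx. Qed.

Lemma reg_comul i j :
  is_comul (reg i j) [seq (reg i l, reg l j) | l <- index_enum 'I_(dim H)].
Proof.
move=> x y; rewrite big_map regE -mulrA.
rewrite [in y * _](vec_coord (y * _)) mulr_sumr linear_sum summxE.
by apply: eq_bigr => l _; rewrite -scalerAr linearZ mxE !regE mulrC.
Qed.

(** Expand x = x 1: f(x) is the sum of f(e_i) times the i-th coordinate of x 1, and 1 is expanded in
    the same basis. *)
Lemma dual_reg f : f = \sum_i \sum_j (ev f (r2v (delta_mx 0 i)) * v2r (1 : H) 0 j) *: reg i j.
Proof.
apply/dualP => x; rewrite {1}(vec_coord x) ev_sum dual_sum; apply: eq_bigr => i _.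
rewrite evZ dual_sum -[x in v2r x](mulr1 x) {1}(vec_coord 1).
rewrite mulr_sumr linear_sum summxE mulr_suml; apply: eq_bigr => j _.
by rewrite -scalerAr linearZ dualZ regE mxE [LHS]mulrC mulrA.
Qed.

(** Both sides are convolution inverses of the same matrix: [E] is the tensor square of the regular
    representation, [EZ] makes the left side a left inverse of it, [Er] makes the right side a right
    inverse, and reassociating the product of all three identifies them. *)
Lemma antip_regM i p k q : antip (reg i p * reg k q) = antip (reg k q) * antip (reg i p).
Proof.
have sumA (F : 'I_(dim H) -> dual) (a : 'I_(dim H)) :
    \sum_b (a == b)%:R *: F b = F a.
  rewrite (bigD1 a) //= eqxx scale1r big1 ?addr0 // => b /negPf ba.
  by rewrite eq_sym ba scale0r.
pose E l l' m n : dual := reg l m * reg l' n.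
have EZ m n : \sum_j \sum_l antip (E i k j l) * E j l m n = ((i == m)%:R * (k == n)%:R) *: 1.
  have := antip_mull (is_comulM (reg_comul i m) (reg_comul k n)).
  rewrite dual_at1 !reg_at1 => <-; rewrite big_allpairs_dep big_map /=.
  by apply: eq_bigr => j _; rewrite big_map.
have Er j l : \sum_m \sum_n E j l m n * (antip (reg n q) * antip (reg m p)) =
    ((j == p)%:R * (l == q)%:R) *: 1.
  have := antip_mulr (reg_comul j p); rewrite big_map reg_at1 /= => rj.
  have := antip_mulr (reg_comul l q); rewrite big_map reg_at1 /= => rl.
  transitivity (\sum_m reg j m * (\sum_n reg l n * antip (reg n q)) * antip (reg m p)).
    apply: eq_bigr => m _; rewrite mulr_sumr mulr_suml; apply: eq_bigr => n _.
    by rewrite /E !mulrA.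
  rewrite rl; under eq_bigr do rewrite -scalerAr mulr1 -scalerAl.
  by rewrite -scaler_sumr rj scalerA mulrC.
transitivity (\sum_j \sum_l antip (E i k j l) * (((j == p)%:R * (l == q)%:R) *: 1)).
  rewrite -[LHS]/(antip (E i k p q)) -[LHS](sumA (fun p => antip (E i k p q))).
  apply: eq_bigr => j _; rewrite -(sumA (fun q => antip (E i k j q))) scaler_sumr.
  apply: eq_bigr => l _; rewrite -scalerAr mulr1 scalerA.
  by rewrite (eq_sym p) (eq_sym q).
under eq_bigr do under eq_bigr do rewrite -Er.
transitivity (\sum_m \sum_n (\sum_j \sum_l antip (E i k j l) * E j l m n) *
    (antip (reg n q) * antip (reg m p))).
  transitivity (\sum_j \sum_l \sum_m \sum_n antip (E i k j l) * E j l m n *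
      (antip (reg n q) * antip (reg m p))).
    apply: eq_bigr => j _; apply: eq_bigr => l _; rewrite mulr_sumr.
    by apply: eq_bigr => m _; rewrite mulr_sumr; apply: eq_bigr => n _; rewrite mulrA.
  under eq_bigr do rewrite exchange_big /=.
  rewrite exchange_big /=; apply: eq_bigr => m _.
  under eq_bigr do rewrite exchange_big /=.
  rewrite exchange_big /=; apply: eq_bigr => n _.
  by rewrite mulr_suml; apply: eq_bigr => j _; rewrite mulr_suml.
under eq_bigr do under eq_bigr do rewrite EZ -scalerAl mul1r -scalerA.
under eq_bigr do rewrite -scaler_sumr sumA.
by rewrite sumA.
Qed.

Lemma antipM f g : antip (f * g) = antip g * antip f.
Proof.
have linl g' : (forall i j, antip (reg i j * g') = antip g' * antip (reg i j)) ->
    antip (f * g') = antip g' * antip f.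
  move=> Pg; rewrite (dual_reg f) mulr_suml !antip_sum mulr_sumr.
  apply: eq_bigr => i _; rewrite mulr_suml !antip_sum mulr_sumr.
  by apply: eq_bigr => j _; rewrite -scalerAl !antipZ -scalerAr Pg.
apply: linl => i j; rewrite (dual_reg g) mulr_sumr !antip_sum mulr_suml.
apply: eq_bigr => k _; rewrite mulr_sumr !antip_sum mulr_suml.
by apply: eq_bigr => l _; rewrite -scalerAr !antipZ -scalerAl antip_regM.
Qed.

Lemma antip1 : antip 1 = 1.
Proof.
have := antip_mull is_comul1.
by rewrite big_seq1 mulr1 dual1 counit1 scale1r.
Qed.

End DualHopf.

(** * Translations and the trace form *)

Section Translation.
Variables (K : fieldType) (H : hopfAlgType K).
Local Notation dual := (dual H).
Implicit Types (f g : dual) (x y z : H).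

Definition trans_fun y f (t : H) : K^o := ev f (t * y).
Fact trans_fun_linear y f : linear (trans_fun y f).
Proof. by move=> a u v; rewrite /trans_fun mulrDl -scalerAl evP. Qed.
HB.instance Definition _ y f :=
  GRing.isLinear.Build K H K^o *:%R (trans_fun y f) (trans_fun_linear y f).
Definition trans y f : dual := mk_dual (trans_fun y f).
Lemma transE y f t : ev (trans y f) t = ev f (t * y).
Proof. exact: mk_dualE. Qed.

Fact trans_linear y : linear (trans y).
Proof. by move=> a f g; apply/dualP => t; rewrite !(transE, dualD, dualZ). Qed.
HB.instance Definition _ y :=
  GRing.isLinear.Build K dual dual *:%R (trans y) (trans_linear y).

Lemma transM x y f : trans (x * y) f = trans x (trans y f).
Proof. by apply/dualP => t; rewrite !transE mulrA. Qed.

Definition ltrans_fun y f (t : H) : K^o := ev f (y * t).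
Fact ltrans_fun_linear y f : linear (ltrans_fun y f).
Proof. by move=> a u v; rewrite /ltrans_fun mulrDr -scalerAr evP. Qed.
HB.instance Definition _ y f :=
  GRing.isLinear.Build K H K^o *:%R (ltrans_fun y f) (ltrans_fun_linear y f).
Definition ltrans y f : dual := mk_dual (ltrans_fun y f).
Lemma ltransE y f t : ev (ltrans y f) t = ev f (y * t).
Proof. exact: mk_dualE. Qed.

Lemma dual_tlift (U V : vectType K) (F : U -> V -> dual) t x :
  ev (tlift F t) x = tliftK (fun a b => ev (F a b) x) t.
Proof.
rewrite /tliftK /tlift dual_sum; apply: eq_bigr => i _.
by rewrite dual_sum; apply: eq_bigr => j _; rewrite dualZ.
Qed.

(* h f g = h1 (f (S(h2) g)) in the H-module algebra [dual] *)
Lemma trans_mull y f g : trans y f * g =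
  tlift (fun y1 y2 => trans y1 (f * trans (antipode y2) g)) (comul y).
Proof.
apply/dualP => t; rewrite dualM dual_tlift.
have E : tliftK (fun t1 t2 : H => tliftK (fun y1 y2 : H => tliftK (fun a b : H =>
    ev f (t1 * a) * ev g (t2 * (b * antipode y2))) (comul y1)) (comul y)) (comul t) =
    tliftK (fun t1 t2 => ev (trans y f) t1 * ev g t2) (comul t).
  apply: eq_tliftK => t1 t2; rewrite transE.
  rewrite /tliftK (coassoc (G := fun a b c : H => ev f (t1 * a) * ev g (t2 * (b * antipode c)) : K^o)).
  - rewrite -(ltransE t1) -[in RHS](counitr y) ev_tlift -tliftKZr; apply: eq_tliftK => y1 y2.
    rewrite -/(tliftK _ _) tliftKZ evZ ltransE mulrAC [RHS]mulrC; congr (_ * _).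
    transitivity (ev (ltrans t2 g) (tlift (fun a b => a * antipode b) (comul y2))).
      by rewrite ev_tlift; apply: eq_tliftK => a b; rewrite ltransE.
    by rewrite antipoder evZ ltransE mulr1 mulrC.
  - by move=> b c e a a'; rewrite mulrDr -scalerAr evP mulrDl -mulrA.
  - by move=> a c e b b'; rewrite mulrDl -scalerAl mulrDr -scalerAr evP mulrDr mulrCA.
  - by move=> a b e c c'; rewrite linearP mulrDr -scalerAr mulrDr -scalerAr evP mulrDr mulrCA.
rewrite -E /tliftK [LHS]tlift_exchange; apply: eq_tliftK => y1 y2.
rewrite transE dualM_mul; apply: eq_tliftK => t1 t2; apply: eq_tliftK => a b.
by rewrite transE mulrA.
Qed.

Record sub_hopf (B : {vspace dual}) : Prop := SubHopf {
  sub_hopf1 : 1 \in B;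
  sub_hopfM : forall f g, f \in B -> g \in B -> f * g \in B;
  sub_hopf_comul : forall f, f \in B -> exists2 s, is_comul f s &
    forall p, p \in s -> (p.1 \in B) && (p.2 \in B);
  sub_hopf_antip : forall f, f \in B -> antip f \in B
}.

Lemma trans_sub (B : {vspace dual}) y f : sub_hopf B -> f \in B -> trans y f \in B.
Proof.
move=> sB fB; have [s fs sinB] := sub_hopf_comul sB fB.
have -> : trans y f = \sum_(p <- s) ev p.2 y *: p.1.
  by apply/dualP => t; rewrite transE fs dual_sum; apply: eq_bigr => p _; rewrite dualZ mulrC.
by rewrite big_seq rpred_sum // => p /sinB/andP[p1 _]; rewrite rpredZ.
Qed.

Lemma ltrans_sub (B : {vspace dual}) y f : sub_hopf B -> f \in B -> ltrans y f \in B.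
Proof.
move=> sB fB; have [s fs sinB] := sub_hopf_comul sB fB.
have -> : ltrans y f = \sum_(p <- s) ev p.1 y *: p.2.
  by apply/dualP => t; rewrite ltransE fs dual_sum; apply: eq_bigr => p _; rewrite dualZ.
by rewrite big_seq rpred_sum // => p /sinB/andP[_ p2]; rewrite rpredZ.
Qed.

Lemma subX (B : {vspace dual}) f n : sub_hopf B -> f \in B -> f ^+ n \in B.
Proof.
move=> sB fB; elim: n => [|n IH]; first exact: sub_hopf1.
by rewrite exprS sub_hopfM.
Qed.

Section Commutative.
Variable B : {vspace dual}.
Hypothesis sB : sub_hopf B.
Hypothesis cB : {in B &, commutative *%R}.

(* S(h2) h1 acts on B as the counit of h, since S(k1) k2 = k2 S(k1) in B *)
Lemma trans_antip_swap k y : k \in B ->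
  tlift (fun y1 y2 => trans (antipode y2 * y1) k) (comul y) = (counit y : K) *: k.
Proof.
move=> kB; apply/dualP => t; rewrite dual_tlift dualZ.
have [s ks sinB] := sub_hopf_comul sB (ltrans_sub t sB kB).
transitivity (ev (\sum_(p <- s) antip p.1 * p.2) y); last first.
  by rewrite (antip_mull ks) dualZ dual1 ltransE mulr1 mulrC.
rewrite dual_sum; transitivity (tliftK (fun y1 y2 =>
    \sum_(p <- s) ev p.1 (antipode y2) * ev p.2 y1) (comul y)).
  by apply: eq_tliftK => y1 y2; rewrite transE -ltransE ks.
rewrite tliftK_sum; apply: eq_big_seq => p /sinB/andP[p1 p2].
rewrite cB ?sub_hopf_antip // dualM.
by apply: eq_tliftK => y1 y2; rewrite antipE mulrC.
Qed.

Local Notation tr k := (ltrace (amull k \o projv B)).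

(** Multiplication by [trans y k] is a Sweedler sum of [D y1] after [A y2]. Cyclicity of the trace
    moves [D y1] to the other side, where the two translations merge into one by S(y2) y1, which
    [trans_antip_swap] evaluates. Composing with [projv B] lets endomorphisms of [B] be handled as
    endomorphisms of the whole dual. *)
Lemma ltrace_trans k y : k \in B -> tr (trans y k) = counit y * tr k.
Proof.
move=> kB; pose A y2 := (amull k \o linfun (trans (antipode y2)) \o projv B)%VF.
pose D y1 : 'End(dual) := linfun (trans y1).
have PD y1 : (projv B \o (D y1 \o projv B) = D y1 \o projv B)%VF.
  by apply/lfunP => x; rewrite !comp_lfunE !lfunE /= projv_id // trans_sub // memv_proj.
have PA y2 : (projv B \o A y2 = A y2)%VF.
  apply/lfunP => x; rewrite !comp_lfunE !lfunE /= projv_id //.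
  by rewrite sub_hopfM // trans_sub // memv_proj.
have -> : (amull (trans y k) \o projv B)%VF =
    tlift (fun y1 y2 => D y1 \o A y2)%VF (comul y).
  apply/lfunP => x; rewrite comp_lfunE lfunE /= trans_mull /tlift sum_lfunE.
  apply: eq_bigr => i _; rewrite sum_lfunE; apply: eq_bigr => j _.
  by rewrite scale_lfunE !comp_lfunE !lfunE.
rewrite linear_tlift.
transitivity (ltrace (tlift (fun y1 y2 : H =>
    (amull k \o linfun (trans (antipode y2 * y1)) \o projv B)%VF) (comul y))).
  rewrite [RHS]linear_tlift; apply: eq_tlift => y1 y2.
  rewrite -[LHS]/(ltrace _) -[RHS]/(ltrace _) -{1}PA comp_lfunA ltraceC comp_lfunA.
  congr ltrace; rewrite -!comp_lfunA PD.
  by apply/lfunP => x; rewrite !comp_lfunE !lfunE /= ?lfunE /= transM.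
rewrite -[RHS]linearZ; congr ltrace; apply/lfunP => x.
rewrite scale_lfunE !comp_lfunE !lfunE /= scalerAr -(trans_antip_swap _ (memv_proj B x)).
rewrite /tlift mulr_sumr sum_lfunE; apply: eq_bigr => i _.
rewrite mulr_sumr sum_lfunE; apply: eq_bigr => j _.
by rewrite scale_lfunE !comp_lfunE !lfunE /= scalerAr.
Qed.

(** The exponent is positive because for exponent 0 the left side would be the matrix of a
    projection onto [B] and not the identity. *)
Lemma emx_mullX k j : k \in B ->
  emx (amull (k ^+ j.+1) \o projv B) = emx (amull k \o projv B) ^+ j.+1.
Proof.
move=> kB; elim: j => [|j IH]; first by rewrite !expr1.
rewrite [RHS]exprSr -IH -[_ * _]/(_ *m _) -emx_comp; congr emx.
apply/lfunP => x; rewrite !comp_lfunE !lfunE /=.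
have h : k ^+ j.+1 * projv B x \in B by rewrite sub_hopfM ?subX ?memv_proj.
by rewrite (projv_id h) mulrA -exprS.
Qed.

End Commutative.
End Translation.

Section Reduced.
Variables (C : numClosedFieldType) (H : hopfAlgType C).
Variable B : {vspace dual H}.
Hypothesis sB : sub_hopf B.
Hypothesis cB : {in B &, commutative *%R}.
Local Notation tr k := (ltrace (amull k \o projv B)).

Lemma ltrace_mull_nilpotent k j : k \in B -> k ^+ j.+1 = 0 -> tr k = 0.
Proof.
move=> kB kj; apply: (@mxtrace_nilpotent _ _ _ j.+1).
rewrite -emx_mullX // kj (_ : (_ \o _)%VF = 0) ?linear0 //.
by apply/lfunP => x; rewrite comp_lfunE zero_lfunE !lfunE.
Qed.

Lemma nilpotent_of_ltrace k : k \in B -> (forall j, tr (k ^+ j.+1) = 0) -> exists j, k ^+ j.+1 = 0.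
Proof.
move=> kB trk; have : forall j, \tr (emx (amull k \o projv B) ^+ j.+1) = 0.
  by move=> j; rewrite -emx_mullX //; exact: trk.
move/nilpotent_of_traces; set n := (X in _ ^+ X) => An; exists n.
have : emx (amull (k ^+ n.+1) \o projv B) = emx 0.
  by rewrite emx_mullX // exprS An mulr0 linear0.
move=> /emx_inj/lfunP/(_ 1); rewrite comp_lfunE lfunE /= projv_id ?mulr1 ?zero_lfunE //.
exact: sub_hopf1.
Qed.

(* The nilpotent elements lie in the radical of the trace form, which is stable
   under translation *)
Lemma sub_hopf_reduced f j : f \in B -> f ^+ j = 0 -> f = 0.
Proof.
move=> fB fj; apply/dualP => y; rewrite dual0.
have fj1 : f ^+ j.+1 = 0 by rewrite exprS fj mulr0.
(* By [trans_mull] the product is a Sweedler sum of translates of multiples of [f]. These multiples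
   are nilpotent by commutativity, and translation only multiplies their trace 0 by a counit. *)
have tr0 g : g \in B -> tr (trans y f * g) = 0.
  move=> gB; rewrite trans_mull.
  have -> : (amull (tlift (fun y1 y2 : H => trans y1 (f * trans (antipode y2) g)) (comul y)) \o projv B)%VF =
     tlift (fun y1 y2 : H => (amull (trans y1 (f * trans (antipode y2) g)) \o projv B)%VF) (comul y).
    apply/lfunP => x; rewrite comp_lfunE lfunE /= /tlift mulr_suml sum_lfunE.
    apply: eq_bigr => i _; rewrite mulr_suml sum_lfunE; apply: eq_bigr => l _.
    by rewrite scale_lfunE comp_lfunE lfunE /= scalerAl.
  rewrite linear_tlift /tlift big1 // => i _; rewrite big1 // => l _.
  set z := antipode _.
  have fgB : f * trans z g \in B by rewrite sub_hopfM ?trans_sub.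
  rewrite -[X in _ *: X]/(tr (trans _ (f * trans z g))) ltrace_trans //.
  rewrite (ltrace_mull_nilpotent (j := j)) ?mulr0 ?scaler0 //.
  by rewrite exprMn_comm ?fj1 ?mul0r //; apply: cB => //; exact: trans_sub.
have tfB : trans y f \in B by exact: trans_sub.
have [l tl] : exists l, trans y f ^+ l.+1 = 0.
  by apply: nilpotent_of_ltrace => // l; rewrite exprS tr0 // subX.
(* Evaluation at 1 is multiplicative and sends [trans y f] to f(y), so nilpotency of the translate
   kills f(y). *)
have : ev (trans y f) 1 ^+ l.+1 = 0.
  rewrite -[RHS](dual0 (1 : H)) -tl; elim: (l.+1) => [|n IH]; first by rewrite !expr0 dual1 counit1.
  by rewrite exprS [in RHS]exprS dual_at1 IH.
by move/eqP; rewrite expf_eq0 transE mul1r => /andP[_ /eqP].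
Qed.

End Reduced.

(** * Joint diagonalization *)

Section LinearAlgebra.
Variable K : fieldType.

(** A subspace of maximal dimension among those contained in [P] absorbs every vector that satisfies
    [P]. *)
Lemma vspace_of_pred (V : vectType K) (P : V -> Prop) : P 0 ->
  (forall a x y, P x -> P y -> P (a *: x + y)) ->
  exists U : {vspace V}, forall x, x \in U <-> P x.
Proof.
move=> P0 PL.
pose Q n := `[< exists2 U : {vspace V}, \dim U = n & forall x, x \in U -> P x >].
have exQ : exists n, Q n.
  by exists 0%N; apply/asboolP; exists 0%VS => [|x]; rewrite ?dimv0 // memv0 => /eqP->.
have Qb n : Q n -> (n <= dim V)%N.
  by case/asboolP=> U <- _; rewrite -dimvf dimvS ?subvf.
have [n /asboolP[U Un UP] maxn] := ex_maxnP exQ Qb.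
exists U => x; split=> [|Px]; first exact: UP.
have : (\dim (U + <[x]>) <= n)%N.
  apply: maxn; apply/asboolP; exists (U + <[x]>)%VS => // y /memv_addP[u uU [v /vlineP[a ->] ->]].
  by rewrite addrC; apply: PL => //; apply: UP.
rewrite -Un => leU; have /eqP eU : U == (U + <[x]>)%VS by rewrite eqEdim addvSl.
by rewrite eU memvE addvSr.
Qed.

End LinearAlgebra.

Section Diagonalization.
Variable C : numClosedFieldType.

Lemma mx_annihilator n (A : 'M[C]_n) : exists rs : seq C, \prod_(r <- rs) (A - r%:M) = 0.
Proof.
case: n A => [|n] A; first by exists [::]; apply/matrixP => - [].
have [rs Ers] := closed_field_poly_normal (char_poly A).
exists rs; have := Cayley_Hamilton A.
rewrite Ers (monicP (char_poly_monic A)) scale1r rmorph_prod /= => <-.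
by apply: eq_bigr => r _; rewrite rmorphB /= horner_mx_X horner_mx_C.
Qed.

Lemma diagonalizable_separable n (A : 'M[C]_n) rs : uniq rs ->
  \prod_(r <- rs) (A - r%:M) = 0 -> exists2 P, P \in unitmx & similar_diag P A.
Proof.
case: n A => [|n] A uniq_rs A0.
  by exists 1%:M; rewrite ?unitmx1 //; apply/is_diag_mxP => - [].
apply/diagonalizableP; exists rs => //; apply: mxminpoly_min.
rewrite rmorph_prod /= -[RHS]A0; apply: eq_bigr => r _.
by rewrite rmorphB /= horner_mx_X horner_mx_C.
Qed.

Lemma codiagonalize n (As : seq 'M[C]_n) :
  {in As &, forall A B, A *m B = B *m A} ->
  (forall A, A \in As -> exists2 rs, uniq rs & \prod_(r <- rs) (A - r%:M) = 0) ->
  exists2 P, P \in unitmx &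
    forall A, A \in As -> exists d, P *m A *m invmx P = diag_mx d.
Proof.
move=> cAs dAs; have [|P uP /allP dP] := (codiagonalizableP As).1 _.
  split=> // A /dAs[rs u A0]; exact: diagonalizable_separable u A0.
exists P => // A /dP; rewrite /= /similar_to /= conjumx //.
by move=> /is_diag_mxP dA; exists (\row_i (P *m A *m invmx P) i i); apply/matrixP => i j;
  rewrite [RHS]mxE [X in X *+ _]mxE; case: eqVneq => [->//|ij]; rewrite dA // -val_eqE.
Qed.

(* On the block of x and y where the joint eigenvalue goes from M(q) to M(p), the
   hypotheses say that the rows of M(p) - M(q) are proportional to (x_pq, y_pq). *)
Lemma commute_of_row_symmetry n (P a b c d x y : 'M[C]_n) (ev : 'I_n -> C * C * C * C) :
  P \in unitmx ->
  P *m a *m invmx P = diag_mx (\row_i (ev i).1.1.1) ->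
  P *m b *m invmx P = diag_mx (\row_i (ev i).1.1.2) ->
  P *m c *m invmx P = diag_mx (\row_i (ev i).1.2) ->
  P *m d *m invmx P = diag_mx (\row_i (ev i).2) ->
  a *m y - y *m a = b *m x - x *m b ->
  c *m y - y *m c = d *m x - x *m d ->
  (forall i j, ((ev i).1.1.1 - (ev j).1.1.1) * ((ev i).2 - (ev j).2) =
    ((ev i).1.1.2 - (ev j).1.1.2) * ((ev i).1.2 - (ev j).1.2) -> ev i = ev j) ->
  forall m z, m \in [:: a; b; c; d] -> z \in [:: x; y] -> m *m z = z *m m.
Proof.
move=> uP Da Db Dc Dd xy1 xy2 sep.
pose cj A := P *m A *m invmx P.
have cjM A B : cj (A *m B) = cj A *m cj B by rewrite /cj !mulmxA mulmxKV.
have cjB A B : cj (A - B) = cj A - cj B by rewrite /cj mulmxBr mulmxBl.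
have cjI : injective cj.
  move=> A B /(congr1 (fun X => invmx P *m X *m P)).
  by rewrite /cj !mulmxA !mulVmx // !mul1mx !mulmxKV.
have dE (e : 'rV[C]_n) X i j : (diag_mx e *m X - X *m diag_mx e) i j =
    (e 0 i - e 0 j) * X i j.
  by rewrite mul_diag_mx mul_mx_diag !mxE mulrBl [X in _ - X]mulrC.
have e1 i j : ((ev i).1.1.1 - (ev j).1.1.1) * cj y i j = ((ev i).1.1.2 - (ev j).1.1.2) * cj x i j.
  move: (congr1 cj xy1); rewrite !cjB !cjM /cj Da Db => /matrixP/(_ i j).
  by rewrite !dE !mxE.
have e2 i j : ((ev i).1.2 - (ev j).1.2) * cj y i j = ((ev i).2 - (ev j).2) * cj x i j.
  move: (congr1 cj xy2); rewrite !cjB !cjM /cj Dc Dd => /matrixP/(_ i j).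
  by rewrite !dE !mxE.
have key i j : ev i = ev j \/ cj x i j = 0 /\ cj y i j = 0.
  have {e1} := e1 i j; have {e2} := e2 i j; have {sep} := sep i j.
  set A := (_ - _); set D := (_ - _); set B := (_ - _); set E := (_ - _).
  move=> sep e2 e1.
  have [/sep->|ne] := eqVneq (A * D) (B * E); first by left.
  right; move: ne; rewrite -subr_eq0 => ne; split; apply/eqP.
    rewrite -(mulrI_eq0 _ (mulfI ne)); apply/eqP.
    transitivity (A * (D * cj x i j) - E * (B * cj x i j)); first by ring.
    by rewrite -e1 -e2; ring.
  rewrite -(mulrI_eq0 _ (mulfI ne)); apply/eqP.
  transitivity (D * (A * cj y i j) - B * (E * cj y i j)); first by ring.
  by rewrite e1 e2; ring.
have comm (e : 'rV[C]_n) (h : C * C * C * C -> C) A z : e = \row_i h (ev i) ->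
    cj A = diag_mx e -> z \in [:: x; y] -> A *m z = z *m A.
  move=> -> DA zxy; apply: cjI; rewrite !cjM DA; apply/eqP; rewrite -subr_eq0; apply/eqP.
  apply/matrixP => i j; rewrite dE [RHS]mxE.
  have rE k : (\row_i h (ev i)) 0 k = h (ev k) by rewrite mxE.
  rewrite !rE.
  have [->|[x0 y0]] := key i j; first by rewrite subrr mul0r.
  by move: zxy; rewrite !inE => /orP[]/eqP->; rewrite ?x0 ?y0 mulr0.
move=> m z mi zi; move: mi; rewrite !inE => /or4P[] /eqP->.
- exact: (comm _ (fun e => e.1.1.1) _ z erefl Da zi).
- exact: (comm _ (fun e => e.1.1.2) _ z erefl Db zi).
- exact: (comm _ (fun e => e.1.2) _ z erefl Dc zi).
- exact: (comm _ (fun e => e.2) _ z erefl Dd zi).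
Qed.

End Diagonalization.


(** * Separable and group-like elements of the dual *)

Section DualElements.
Import VectorInternalTheory.
Variables (C : numClosedFieldType) (H : hopfAlgType C).
Local Notation dual := (dual H).
Implicit Types (f g k D : dual) (x y z : H).

(** Right multiplication combined with row vectors makes [rmx] preserve the order of products. *)
Definition rmx f := emx (amulr f).

Lemma rmxE f v : v *m rmx f = v2r (r2v v * f : dual).
Proof. by rewrite mul_emx lfunE. Qed.

Lemma rmxM f g : rmx (f * g) = rmx f *m rmx g.
Proof.
rewrite /rmx -emx_comp; congr emx; apply/lfunP => x.
by rewrite comp_lfunE !lfunE /= mulrA.
Qed.

Lemma rmx1 : rmx 1 = 1%:M.
Proof. by rewrite /rmx -emx_id; congr emx; apply/lfunP => x; rewrite id_lfunE lfunE /= mulr1. Qed.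

Lemma rmx_linear : linear rmx.
Proof. by move=> a f g; rewrite /rmx !linearP. Qed.
HB.instance Definition _ := GRing.isLinear.Build C dual _ *:%R rmx rmx_linear.

Lemma rmxB f g : rmx (f - g) = rmx f - rmx g.
Proof. exact: linearB. Qed.

Lemma rmx_inj : injective rmx.
Proof. by move=> f g /emx_inj/amulr_inj. Qed.

Lemma rmx_prod_sub f rs :
  rmx (\prod_(r <- rs) (f - r%:A)) = \prod_(r <- rs) (rmx f - r%:M).
Proof.
elim: rs => [|r rs IH]; first by rewrite !big_nil rmx1.
by rewrite !big_cons rmxM IH linearB linearZ /= rmx1 scalemx1.
Qed.

Lemma dual_annihilator f : exists rs : seq C, \prod_(r <- rs) (f - r%:A) = 0.
Proof.
have [rs rs0] := mx_annihilator (rmx f); exists rs.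
by apply: rmx_inj; rewrite rmx_prod_sub rs0 linear0.
Qed.

Lemma horner_alg_prod f rs :
  horner_alg f (\prod_(r <- rs) ('X - r%:P)) = \prod_(r <- rs) (f - r%:A).
Proof.
rewrite rmorph_prod; apply: eq_bigr => r _.
by rewrite rmorphB /= horner_algX horner_algC.
Qed.

Definition separable_elt f (rs : seq C) := uniq rs /\ \prod_(r <- rs) (f - r%:A) = 0.

(** An annihilating product with repeated roots divides a power of the product over the distinct
    roots, so the latter takes a nilpotent value at [f], which is 0 in a reduced algebra. *)
Lemma separable_of_reduced (B : {vspace dual}) f : sub_hopf B ->
  {in B &, commutative *%R} -> f \in B -> exists rs, separable_elt f rs.
Proof.
move=> sB cB fB; have [rs rs0] := dual_annihilator f.
exists (undup rs); split; first exact: undup_uniq.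
pose p := \prod_(r <- undup rs) ('X - r%:P) : {poly C}.
have dvd_p s : {subset s <= rs} -> \prod_(r <- s) ('X - r%:P) %| p ^+ size s.
  elim: s => [|r s IH] sub; first by rewrite big_nil dvd1p.
  rewrite big_cons exprS dvdp_mul //; last by apply: IH => t ts; apply: sub; rewrite inE ts orbT.
  by rewrite dvdp_XsubCl root_prod_XsubC mem_undup sub ?mem_head.
have /dvdpP[q Eq] := dvd_p rs (fun t ts => ts).
apply: (sub_hopf_reduced sB cB (j := size rs)).
  rewrite big_seq; elim/big_rec: _ => [|r g _ gB]; first exact: sub_hopf1.
  by rewrite sub_hopfM ?rpredB // rpredZ // sub_hopf1.
have := congr1 (horner_alg f) Eq.
by rewrite rmorphM rmorphXn /= !horner_alg_prod rs0 mulr0.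
Qed.

Lemma is_comulX D n : is_comul D [:: (D, D)] -> is_comul (D ^+ n) [:: (D ^+ n, D ^+ n)].
Proof.
move=> cD; elim: n => [|n IH]; first exact: is_comul1.
by rewrite exprS; apply: (is_comulM cD IH).
Qed.

Lemma dualX_at1 f n : ev (f ^+ n) 1 = ev f 1 ^+ n.
Proof.
elim: n => [|n IH]; first by rewrite dual1 counit1.
by rewrite exprS dual_at1 IH exprS.
Qed.

(* Dedekind: a minimal linear relation between the powers of D equates two of them *)
Lemma grouplike_finite_order D : is_comul D [:: (D, D)] -> ev D 1 = 1 ->
  exists m, D ^+ m.+1 = 1.
Proof.
move=> cD D1; pose X r := [seq D ^+ i | i <- iota 0 r].
have XS r : perm_eq (X r.+1) (D ^+ r :: X r).
  by rewrite /X -addn1 iotaD map_cat /= perm_catC.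
have [r nfree minr] : exists2 r, ~~ free (X r.+1) & free (X r).
  have exf : exists n, ~~ free (X n).
    exists (\dim {:dual}).+1; rewrite /free size_map size_iota eqn_leq negb_and.
    by rewrite -!ltnNge ltnS dimvS ?subvf // orbC.
  case: (ex_minnP exf) => -[|r]; first by rewrite /free span_nil dimv0.
  by move=> nf minr; exists r => //; apply: contraT => /minr; rewrite ltnn.
have sX : size (X r) = r by rewrite size_map size_iota.
have : D ^+ r \in <<X r>>%VS.
  by move: nfree; rewrite (perm_free (XS r)) free_cons minr andbT negbK.
pose XT := in_tuple (X r); move/(coord_span (X := XT)) => ED.
pose c i := coord XT i (D ^+ r).
have XE (i : 'I_(size (X r))) : XT`_i = D ^+ i.
  have ir : (i < r)%N by rewrite -[X in (_ < X)%N]sX ltn_ord.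
  by rewrite /= (nth_map 0%N) ?size_iota // nth_iota.
(* Expand D^r(x y) = D^r(x) D^r(y) in two ways: the relation is applied to the left side at x y and
   to the factor D^r(x). The lower powers are free as functions of x, which separates the
   coefficients. *)
have rel i y : c i * (ev (D ^+ r) y - ev (D ^+ i) y) = 0.
  have /freeP := minr : free XT.
  move=> /(_ (fun i => c i * (ev (D ^+ r) y - ev (D ^+ i) y))); apply.
  apply/dualP => x; rewrite dual0 dual_sum.
  transitivity (ev (D ^+ r) y * ev (D ^+ r) x - ev (D ^+ r) (x * y)).
    rewrite [in X in _ * X - _]ED [in X in _ - X]ED !dual_sum mulr_sumr -sumrB.
    apply: eq_bigr => j _; rewrite !dualZ XE (is_comulX j cD) big_seq1 /=; ring.
  by rewrite (is_comulX r cD) big_seq1 /=; ring.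
have [i ci] : exists i, c i != 0.
  apply: contrapT => /forallNP c0; have : ev (D ^+ r) 1 = 0.
    rewrite ED dual_sum big1 // => i _; have /negP := c0 i; rewrite negbK => /eqP.
    by rewrite dualZ -/(c i) => ->; rewrite mul0r.
  by rewrite dualX_at1 D1 expr1n => /eqP; rewrite oner_eq0.
have Dri : D ^+ r = D ^+ i.
  by apply/dualP => y; have /eqP := rel i y; rewrite mulf_eq0 (negPf ci) subr_eq0 => /eqP.
have ir : (i < r)%N by rewrite -[X in (_ < X)%N]sX ltn_ord.
(* The antipode inverts [D ^+ i], which can therefore be cancelled from D^r = D^i. *)
have Di : antip (D ^+ i) * D ^+ i = 1.
  by have := antip_mull (is_comulX i cD); rewrite big_seq1 /= dualX_at1 D1 expr1n scale1r.
exists (r - i).-1; rewrite prednK ?subn_gt0 // -[LHS]mul1r -Di -mulrA -exprD.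
by rewrite subnKC ?(ltnW ir) // Dri.
Qed.

Lemma grouplike_trace D : is_comul D [:: (D, D)] -> ev D 1 = 1 ->
  \tr (rmx D) = \tr (rmx 1) -> D = 1.
Proof.
move=> cD D1; have [m Dm] := grouplike_finite_order cD D1.
rewrite rmx1 mxtrace1 => /finite_order_trace trD; apply: rmx_inj; rewrite rmx1.
apply: (trD m); rewrite -[RHS]rmx1 -Dm; elim: (m.+1) => [|n IH]; first by rewrite rmx1.
by rewrite !exprS rmxM IH.
Qed.

Lemma mxtraceB n (A B : 'M[C]_n) : \tr (A - B) = \tr A - \tr B.
Proof. exact: linearB. Qed.

Lemma mxtrace_comm f g : \tr (rmx (f * g - g * f)) = 0.
Proof. by rewrite rmxB mxtraceB !rmxM mxtrace_mulC subrr. Qed.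

Lemma grouplike_unipotent D f g : is_comul D [:: (D, D)] -> ev D 1 = 1 ->
  D = 1 - (f * g - g * f) -> D = 1.
Proof.
move=> cD D1 ED; apply: grouplike_trace => //.
rewrite ED.
rewrite rmxB.
rewrite mxtraceB.
rewrite (mxtrace_comm f g).
by rewrite subr0.
Qed.

End DualElements.

(** * Subalgebras of the dual given by generators *)

Section Generation.
Variables (K : fieldType) (H : hopfAlgType K).
Local Notation dual := (dual H).
Implicit Types (f g : dual) (s : seq dual).

Inductive gen s : dual -> Prop :=
| gen_mem f : f \in s -> gen s f
| gen_1 : gen s 1
| gen_lin a f g : gen s f -> gen s g -> gen s (a *: f + g)
| gen_mul f g : gen s f -> gen s g -> gen s (f * g).

Lemma gen_0 s : gen s 0.
Proof. by rewrite -[0](addNr 1) -scaleN1r; apply: gen_lin; apply: gen_1. Qed.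

Lemma gen_opp s f : gen s f -> gen s (- f).
Proof. by move=> gf; rewrite -[- f]addr0 -scaleN1r; apply: gen_lin => //; apply: gen_0. Qed.

Lemma gen_add s f g : gen s f -> gen s g -> gen s (f + g).
Proof. by move=> gf gg; rewrite -[f]scale1r; apply: gen_lin. Qed.

Lemma gen_vspace s : exists B : {vspace dual}, forall f, f \in B <-> gen s f.
Proof. by apply: vspace_of_pred; [apply: gen_0|move=> *; apply: gen_lin]. Qed.

Lemma gen_comm s : {in s &, commutative *%R} ->
  forall f g, gen s f -> gen s g -> f * g = g * f.
Proof.
move=> cs f g + gg; elim=> {f} [f fs||a f k _ IHf _ IHk|f k _ IHf _ IHk].
- elim: gg => {g} [g|| a g k _ IHg _ IHk|g k _ IHg _ IHk]; first exact: cs.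
  + by rewrite mulr1 mul1r.
  + by rewrite mulrDr mulrDl -scalerAr -scalerAl IHg IHk.
  + by rewrite mulrA IHg -!mulrA IHk.
- by rewrite mulr1 mul1r.
- by rewrite mulrDr mulrDl -scalerAr -scalerAl IHf IHk.
- by rewrite -mulrA IHk mulrA IHf -mulrA.
Qed.

Lemma gen_sub_hopf s (B : {vspace dual}) : (forall f, f \in B <-> gen s f) ->
  (forall f, f \in s ->
    exists2 t, is_comul f t & forall p, p \in t -> gen s p.1 /\ gen s p.2) ->
  (forall f, f \in s -> gen s (antip f)) -> sub_hopf B.
Proof.
move=> BP comul_s antip_s; split; first by apply/BP/gen_1.
- by move=> f g /BP gf /BP gg; apply/BP/gen_mul.
- move=> f /BP; elim=> {f} [f fs||a f k _ [t ft tB] _ [t' kt' tB']|f k _ [t ft tB] _ [t' kt' tB']].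
  + have [t ft tP] := comul_s f fs; exists t => // p /tP[/BP-> /BP->] //.
  + by exists [:: (1, 1)] => [|p]; [apply: is_comul1|rewrite inE => /eqP->; apply/andP; split; apply/BP/gen_1].
  + exists ([seq (a *: p.1, p.2) | p <- t] ++ t'); first exact: is_comulD (is_comulZ a ft) kt'.
    move=> p; rewrite mem_cat => /orP[/mapP[q /tB/andP[q1 q2] ->]|/tB'//].
    by rewrite rpredZ.
  + exists [seq (p.1 * q.1, p.2 * q.2) | p <- t, q <- t']; first exact: is_comulM.
    move=> p /allpairsP[[q r] [/tB/andP[/BP q1 /BP q2] /tB'/andP[/BP r1 /BP r2] ->]] /=.
    by apply/andP; split; apply/BP/gen_mul.
- move=> f /BP gf; apply/BP; elim: gf => {f} [//||a f k _ IHf _ IHk|f k _ IHf _ IHk].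
  + by rewrite antip1; apply: gen_1.
  + by rewrite antipD antipZ; apply: gen_lin.
  + by rewrite antipM; apply: gen_mul.
Qed.

End Generation.

(** * Characters of a sub-Hopf algebra *)

Section Points.
Variables (C : numClosedFieldType) (H : hopfAlgType C).
Local Notation dual := (dual H).
Implicit Types (f g k : dual) (x y : H).
Variable B : {vspace dual}.
Hypothesis sB : sub_hopf B.

(** Evaluation at [x] restricts to a character of [B]. Different elements may give the same
    character; products in H induce the group law of characters. *)
Definition point x := ev 1 x = 1 /\ {in B &, forall f g, ev (f * g) x = ev f x * ev g x}.

Lemma point_mul x y : point x -> point y -> point (x * y).
Proof.
move=> [x1 xM] [y1 yM]; split; first by rewrite (@is_comul1 _ H) big_seq1 /= x1 y1 mulr1.
move=> f g fB gB; have [s fs sB'] := sub_hopf_comul sB fB.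
have [t gt tB'] := sub_hopf_comul sB gB.
rewrite (is_comulM fs gt) big_allpairs_dep fs gt mulr_suml; apply: eq_big_seq => p /sB'/andP[p1 p2].
rewrite mulr_sumr; apply: eq_big_seq => q /tB'/andP[q1 q2] /=.
by rewrite xM // yM // mulrACA.
Qed.

Lemma point_1 : point 1.
Proof. by split=> [|f g _ _]; rewrite ?dual_at1 // dual1 counit1. Qed.

Lemma point_exp x n : point x -> point (x ^+ n).
Proof.
move=> px; elim: n => [|n IH]; first exact: point_1.
by rewrite exprS; apply: point_mul.
Qed.

Lemma point_antip x : point x -> point (antipode x).
Proof.
move=> [x1 xM]; split=> [|f g fB gB]; first by rewrite -antipE antip1.
by rewrite -!antipE antipM xM ?sub_hopf_antip // mulrC.
Qed.

Lemma point_horner x f rs : point x -> f \in B ->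
  ev (\prod_(r <- rs) (f - r%:A)) x = \prod_(r <- rs) (ev f x - r).
Proof.
move=> [x1 xM] fB; elim: rs => [|r rs IH]; first by rewrite !big_nil.
rewrite !big_cons xM ?IH ?dualB ?dualZ ?x1 ?mulr1 //.
  by rewrite rpredB // rpredZ // sub_hopf1.
elim: rs {IH} => [|t rs IH]; first by rewrite big_nil sub_hopf1.
by rewrite big_cons sub_hopfM // rpredB // rpredZ // sub_hopf1.
Qed.

Lemma point_values x f rs : point x -> f \in B -> separable_elt f rs -> ev f x \in rs.
Proof.
move=> px fB [_ rs0]; have := point_horner rs px fB; rewrite rs0 dual0 => /esym/eqP.
rewrite prodf_seq_eq0 => /hasP[r rrs]; rewrite subr_eq0 => /eqP->.
by [].
Qed.

(** When k(y) is not 0, the eigenvalue of f is (k f)(y) / k(y), and convolution writes (k f)(y) as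
    the value of f at the Sweedler sum of k(y1) y2. So the character is evaluation at an element of
    H. *)
Lemma point_of_eigenvector k : k != 0 ->
  (forall f, f \in B -> exists c, k * f = c *: k) ->
  exists2 x, point x & forall f, f \in B -> k * f = ev f x *: k.
Proof.
move=> k0 eig.
have [y ky] : exists y, ev k y != 0.
  apply: contrapT => /forallNP k00; case/eqP: k0; apply/dualP => y.
  by rewrite dual0; have /negP := k00 y; rewrite negbK => /eqP.
pose x := (ev k y)^-1 *: tlift (fun y1 y2 : H => ev k y1 *: y2) (comul y).
have evx f : ev f x = (ev k y)^-1 * ev (k * f) y.
  by rewrite evZ ev_tlift dualM; congr (_ * _); apply: eq_tliftK => a b; rewrite evZ.
have eigx f : f \in B -> k * f = ev f x *: k.
  by move=> /eig[c kf]; rewrite evx kf dualZ mulrCA mulVf ?mulr1.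
exists x => //; split=> [|f g fB gB]; first by rewrite evx mulr1 mulVf.
rewrite evx mulrA (eigx f) // -scalerAl (eigx g) // scalerA dualZ.
by rewrite mulrCA mulVf ?mulr1.
Qed.

End Points.

Section JointDiagonalization.
Variables (C : numClosedFieldType) (H : hopfAlgType C).
Import VectorInternalTheory.
Local Notation dual := (dual H).

(** Reducedness makes each [rmx f] diagonalisable. The rows of [P] are common eigenvectors, and each
    of them yields a point. *)
Lemma joint_diagonalization (s : seq dual) (B : {vspace dual}) :
  (forall f, f \in B <-> gen s f) -> sub_hopf B -> {in s &, commutative *%R} ->
  exists (P : 'M[C]_(dim dual)) (x : 'I_(dim dual) -> H),
    [/\ P \in unitmx, forall i, point B (x i) & forall f, f \in B ->
        P *m rmx f *m invmx P = diag_mx (\row_i ev f (x i))].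
Proof.
move=> BP sB cs.
have cB : {in B &, commutative *%R} by move=> f g /BP gf /BP gg; exact: (gen_comm cs gf gg).
have [||P uP dP] := @codiagonalize _ _ [seq rmx f | f <- s].
- move=> _ _ /mapP[f fs ->] /mapP[g gs ->]; rewrite -!rmxM cs //.
- move=> _ /mapP[f fs ->].
  have [|rs [u rs0]] := separable_of_reduced sB cB (f := f); first by apply/BP/gen_mem.
  by exists rs; rewrite // -rmx_prod_sub rs0 linear0.
pose k i : dual := r2v (row i P).
have k0 i : k i != 0.
  apply/eqP => /(congr1 v2r); rewrite r2vK linear0 => P0.
  have : row i P *m invmx P = 0 by rewrite P0 mul0mx.
  rewrite -row_mul mulmxV // => /rowP/(_ i); rewrite !mxE eqxx => /eqP.
  by rewrite oner_eq0.
have eig i f : f \in B -> exists e, k i * f = e *: k i.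
  move=> /BP; elim=> [h hs||e h g _ [x hx] _ [y gy]|h g _ [x hx] _ [y gy]].
  - have [e de] := dP _ (map_f _ hs); exists (e 0 i).
    have Ph : P *m rmx h = diag_mx e *m P by rewrite -de mulmxKV.
    apply: (can_inj v2rK); rewrite linearZ /= r2vK -rmxE -row_mul Ph.
    by rewrite row_mul row_diag_mx -scalemxAl -rowE.
  - by exists 1; rewrite mulr1 scale1r.
  - by exists (e * x + y); rewrite mulrDr -scalerAr hx gy scalerA scalerDl.
  - by exists (x * y); rewrite mulrA hx -scalerAl gy scalerA.
have /choice[x xP] i : exists x, point B x /\ forall f, f \in B -> k i * f = ev f x *: k i.
  by have [x px xk] := point_of_eigenvector (k0 i) (eig i); exists x.
exists P, x; split=> // [i|f fB]; first by have [] := xP i.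
apply: (canLR (mulmxK uP)); apply/row_matrixP => i; rewrite row_mul.
rewrite row_mul row_diag_mx -scalemxAl -rowE mxE; have [_ /(_ f fB)] := xP i.
by move/(congr1 v2r); rewrite linearZ /= -rmxE r2vK.
Qed.

End JointDiagonalization.

(** * Coactions on the Weyl algebra *)

Section Coaction.
Variables (C : numClosedFieldType) (H : hopfAlgType C).
Import VectorInternalTheory.
Local Notation dual := (dual H).
Implicit Types (f g k : dual) (x y : H).

(* u |-> u (x) a + v (x) c + 1 (x) p and v |-> u (x) b + v (x) d + 1 (x) q is a coaction
   which preserves the relation v u - u v = 1. *)
Record weyl_coaction (a b c d p q : dual) : Prop := WeylCoaction {
  wc_comul_a : is_comul a [:: (a, a); (b, c)];
  wc_comul_b : is_comul b [:: (a, b); (b, d)];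
  wc_comul_c : is_comul c [:: (c, a); (d, c)];
  wc_comul_d : is_comul d [:: (c, b); (d, d)];
  wc_comul_p : is_comul p [:: (1, p); (p, a); (q, c)];
  wc_comul_q : is_comul q [:: (1, q); (p, b); (q, d)];
  wc_a1 : ev a 1 = 1; wc_b1 : ev b 1 = 0; wc_c1 : ev c 1 = 0; wc_d1 : ev d 1 = 1;
  wc_p1 : ev p 1 = 0; wc_q1 : ev q 1 = 0;
  wc_u2 : b * a - a * b = 0;
  wc_v2 : d * c - c * d = 0;
  wc_uv : b * c - a * d + (d * a - c * b) = 0;
  wc_1 : d * a - c * b + (q * p - p * q) = 1;
  wc_u : b * p + q * a - (a * q + p * b) = 0;
  wc_v : d * p + q * c - (c * q + p * d) = 0 }.

Variables a b c d p q : dual.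
Hypothesis W : weyl_coaction a b c d p q.

Let ab : a * b = b * a.
Proof. by apply/esym/eqP; rewrite -subr_eq0 (wc_u2 W). Qed.
Let cd : c * d = d * c.
Proof. by apply/esym/eqP; rewrite -subr_eq0 (wc_v2 W). Qed.

Let D := a * d - b * c.
Let D' : D = d * a - c * b.
Proof. by apply/esym/eqP; rewrite -subr_eq0 /D opprB addrC (wc_uv W). Qed.

(** At this stage only ab = ba and cd = dc are known. They cancel the mixed terms, and the others
    recombine because D also equals da - cb. *)
Let comulD : is_comul D [:: (D, D)].
Proof.
move=> x y; rewrite {1}/D dualB.
rewrite (is_comulM (wc_comul_a W) (wc_comul_d W)) (is_comulM (wc_comul_b W) (wc_comul_c W)).
rewrite /= !big_cons !big_nil /= !addr0.
rewrite {2}D' /D !dualB -ab -cd.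
have := congr1 (fun f => ev f y) D'; rewrite /D !dualB => Dy.
rewrite [RHS]mulrBl -{1}Dy.
have -> : ev (a * c) x * ev (a * b) y + (ev (a * d) x * ev (a * d) y +
   (ev (b * c) x * ev (c * b) y + ev (b * d) x * ev (c * d) y)) -
   (ev (a * c) x * ev (a * b) y + (ev (a * d) x * ev (b * c) y +
   (ev (b * c) x * ev (d * a) y + ev (b * d) x * ev (c * d) y))) =
   ev (a * d) x * (ev (a * d) y - ev (b * c) y) - ev (b * c) x * (ev (d * a) y - ev (c * b) y).
  by ring.
by [].
Qed.

(* D = 1 + [p, q] has the same trace as 1, and finite order *)
Let D1 : D = 1.
Proof.
have ED : D = 1 - (q * p - p * q) by rewrite -[in RHS](wc_1 W) addrK D'.
apply: grouplike_unipotent ED => //.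
by rewrite /D dualB !dual_at1 (wc_a1 W) (wc_b1 W) (wc_d1 W) mul0r mulr1 subr0.
Qed.

Let adbc : a * d - b * c = 1. Proof. exact: D1. Qed.
Let dacb : d * a - c * b = 1. Proof. by rewrite -D' D1. Qed.

Let pq : p * q = q * p.
Proof.
have := wc_1 W; rewrite dacb => /eqP; rewrite -subr_eq0 addrAC subrr add0r subr_eq0.
by move=> /eqP.
Qed.

(** The adjugate (d, -b; -c, a) is a right inverse of (a, b; c, d) by D = 1, ab = ba, cd = dc. The
    antipode matrix is a left inverse, so the two coincide. *)
Lemma antip_a_b_c_d : [/\ antip a = d, antip b = - b, antip c = - c & antip d = a].
Proof.
have := antip_mull (wc_comul_a W); rewrite !big_cons big_nil addr0 /= (wc_a1 W) scale1r => Ea.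
have := antip_mull (wc_comul_b W); rewrite !big_cons big_nil addr0 /= (wc_b1 W) scale0r => Eb.
have := antip_mull (wc_comul_c W); rewrite !big_cons big_nil addr0 /= (wc_c1 W) scale0r => Ec.
have := antip_mull (wc_comul_d W); rewrite !big_cons big_nil addr0 /= (wc_d1 W) scale1r => Ed.
split.
- transitivity ((antip a * a + antip b * c) * d - (antip a * b + antip b * d) * c).
    transitivity (antip a * (a * d - b * c) + antip b * (c * d - d * c)).
      by rewrite adbc cd subrr mulr1 mulr0 addr0.
    by rewrite !mulrBr !mulrDl !mulrA opprD addrACA.
  by rewrite Ea Eb mul1r mul0r subr0.
- transitivity ((antip a * b + antip b * d) * a - (antip a * a + antip b * c) * b).
    transitivity (antip a * (b * a - a * b) + antip b * (d * a - c * b)).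
      by rewrite dacb ab subrr mulr1 mulr0 add0r.
    by rewrite !mulrBr !mulrDl !mulrA opprD addrACA.
  by rewrite Ea Eb mul1r mul0r sub0r.
- transitivity ((antip c * a + antip d * c) * d - (antip c * b + antip d * d) * c).
    transitivity (antip c * (a * d - b * c) + antip d * (c * d - d * c)).
      by rewrite adbc cd subrr mulr1 mulr0 addr0.
    by rewrite !mulrBr !mulrDl !mulrA opprD addrACA.
  by rewrite Ec Ed mul1r mul0r sub0r.
- transitivity ((antip c * b + antip d * d) * a - (antip c * a + antip d * c) * b).
    transitivity (antip c * (b * a - a * b) + antip d * (d * a - c * b)).
      by rewrite dacb ab subrr mulr1 mulr0 add0r.
    by rewrite !mulrBr !mulrDl !mulrA opprD addrACA.
  by rewrite Ec Ed mul1r mul0r subr0.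
Qed.

(** Being the antipode matrix, the adjugate is also a left inverse of (a, b; c, d). Comparing its
    entries with those of the right inverse identity gives the missing commutations. *)
Let commM : {in [:: a; b; c; d] &, commutative *%R}.
Proof.
have [Sa Sb Sc Sd] := antip_a_b_c_d.
have := antip_mull (wc_comul_a W); rewrite !big_cons big_nil addr0 /= (wc_a1 W) scale1r Sa Sb => Ea.
have := antip_mull (wc_comul_b W); rewrite !big_cons big_nil addr0 /= (wc_b1 W) scale0r Sa Sb => Eb.
have := antip_mull (wc_comul_c W); rewrite !big_cons big_nil addr0 /= (wc_c1 W) scale0r Sc Sd => Ec.
have ad : a * d = d * a.
  by apply: (@subIr _ (b * c)); rewrite adbc -Ea mulNr.
have bc : b * c = c * b by apply: (@subrI _ (d * a)); rewrite dacb -Ea mulNr.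
have bd : b * d = d * b by apply/esym/eqP; rewrite -subr_eq0 -mulNr Eb.
have ac : a * c = c * a by apply/eqP; rewrite -subr_eq0 addrC -mulNr Ec.
move=> f g; rewrite !inE => /or4P[]/eqP-> /or4P[]/eqP-> //.
Qed.

Lemma gen_sub_hopf_M (B : {vspace dual}) :
  (forall f, f \in B <-> gen [:: a; b; c; d] f) -> sub_hopf B.
Proof.
move=> BP; have [Sa Sb Sc Sd] := antip_a_b_c_d.
have [ga gb gc gd] : [/\ gen [:: a; b; c; d] a, gen [:: a; b; c; d] b,
    gen [:: a; b; c; d] c & gen [:: a; b; c; d] d].
  by split; apply: gen_mem; rewrite !inE eqxx ?orbT.
apply: (gen_sub_hopf BP) => f; rewrite !inE => /or4P[]/eqP->.
- by exists [:: (a, a); (b, c)]; [apply: wc_comul_a W|move=> r; rewrite !inE => /orP[]/eqP->].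
- by exists [:: (a, b); (b, d)]; [apply: wc_comul_b W|move=> r; rewrite !inE => /orP[]/eqP->].
- by exists [:: (c, a); (d, c)]; [apply: wc_comul_c W|move=> r; rewrite !inE => /orP[]/eqP->].
- by exists [:: (c, b); (d, d)]; [apply: wc_comul_d W|move=> r; rewrite !inE => /orP[]/eqP->].
- by rewrite Sa.
- by rewrite Sb; apply: gen_opp.
- by rewrite Sc; apply: gen_opp.
- by rewrite Sd.
Qed.

Section MatrixPoints.
Variable B : {vspace dual}.
Hypothesis BP : forall f, f \in B <-> gen [:: a; b; c; d] f.
Let sB : sub_hopf B := gen_sub_hopf_M BP.
Let cB : {in B &, commutative *%R}.
Proof. by move=> f g /BP gf /BP gg; exact: (gen_comm commM gf gg). Qed.
Let inB f : f \in [:: a; b; c; d] -> f \in B.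
Proof. by move=> fM; apply/BP/gen_mem. Qed.
Let aB : a \in B. Proof. by apply: inB; rewrite !inE eqxx. Qed.
Let bB : b \in B. Proof. by apply: inB; rewrite !inE eqxx orbT. Qed.
Let cB' : c \in B. Proof. by apply: inB; rewrite !inE eqxx !orbT. Qed.
Let dB : d \in B. Proof. by apply: inB; rewrite !inE eqxx !orbT. Qed.

Let evaM x y : ev a (x * y) = ev a x * ev a y + ev b x * ev c y.
Proof. by rewrite (wc_comul_a W) !big_cons big_nil addr0. Qed.
Let evbM x y : ev b (x * y) = ev a x * ev b y + ev b x * ev d y.
Proof. by rewrite (wc_comul_b W) !big_cons big_nil addr0. Qed.
Let evcM x y : ev c (x * y) = ev c x * ev a y + ev d x * ev c y.
Proof. by rewrite (wc_comul_c W) !big_cons big_nil addr0. Qed.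
Let evdM x y : ev d (x * y) = ev c x * ev b y + ev d x * ev d y.
Proof. by rewrite (wc_comul_d W) !big_cons big_nil addr0. Qed.

Lemma point_det x : point B x -> ev a x * ev d x - ev b x * ev c x = 1.
Proof. by case=> x1 xM; rewrite -!xM // -dualB adbc. Qed.

(* The powers of a unipotent point would take infinitely many values otherwise *)
Lemma point_unipotent x : point B x -> ev a x + ev d x = 2 ->
  [/\ ev a x = 1, ev b x = 0, ev c x = 0 & ev d x = 1].
Proof.
move=> px tr2; have det1 := point_det px.
have dE : ev d x = 2 - ev a x by rewrite -tr2; ring.
have bcE : ev b x * ev c x = - (ev a x - 1) ^+ 2.
  transitivity (ev a x * ev d x - 1); first by rewrite -[X in _ - X]det1; ring.
  by rewrite dE; ring.
have powE n : [/\ ev a (x ^+ n) = 1 + n%:R * (ev a x - 1), ev b (x ^+ n) = n%:R * ev b x,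
    ev c (x ^+ n) = n%:R * ev c x & ev d (x ^+ n) = 1 + n%:R * (ev d x - 1)].
  elim: n => [|n [IHa IHb IHc IHd]].
    by rewrite (wc_a1 W) (wc_b1 W) (wc_c1 W) (wc_d1 W) !mul0r !addr0.
  rewrite exprS evaM evbM evcM evdM IHa IHb IHc IHd -natr1.
  have bcn : ev b x * (n%:R * ev c x) = n%:R * - (ev a x - 1) ^+ 2 by rewrite -bcE; ring.
  have cbn : ev c x * (n%:R * ev b x) = n%:R * - (ev a x - 1) ^+ 2 by rewrite -bcE; ring.
  by rewrite bcn cbn dE; split; ring.
have const f (t : C) : f \in B -> (forall n, ev f (x ^+ n) = ev f 1 + n%:R * t) -> t = 0.
  move=> fB fn; have [rs rsP] := separable_of_reduced sB cB fB.
  apply: contraTeq (leqnn (size rs)) => t0; rewrite -ltnNge.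
  have us : uniq [seq ev f (x ^+ n) | n <- iota 0 (size rs).+1].
    rewrite map_inj_uniq ?iota_uniq // => m n; rewrite !fn => /addrI/(mulIf t0)/eqP.
    by rewrite eqr_nat => /eqP.
  have := uniq_leq_size us; rewrite size_map size_iota; apply=> _ /mapP[n _ ->].
  by apply: (point_values sB _ fB rsP); apply: point_exp.
have a0 : ev a x - 1 = 0 by apply: (const a) => // n; have [-> _ _ _] := powE n; rewrite (wc_a1 W).
have b0 : ev b x = 0 by apply: (const b) => // n; have [_ -> _ _] := powE n; rewrite (wc_b1 W) add0r.
have c0 : ev c x = 0 by apply: (const c) => // n; have [_ _ -> _] := powE n; rewrite (wc_c1 W) add0r.
have a1 : ev a x = 1 by apply/eqP; rewrite -subr_eq0 a0.
by split=> //; rewrite dE a1; ring.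
Qed.

(** The hypothesis says det (M(x) - M(y)) = 0. Then z = S(x) y, with matrix M(x)^-1 M(y), has trace
    2 minus this determinant, so [point_unipotent] gives M(z) = 1. *)
Lemma point_separated x y : point B x -> point B y ->
  (ev a x - ev a y) * (ev d x - ev d y) = (ev b x - ev b y) * (ev c x - ev c y) ->
  (ev a x, ev b x, ev c x, ev d x) = (ev a y, ev b y, ev c y, ev d y).
Proof.
move=> px py dxy; have detx := point_det px; have dety := point_det py.
have [Sa Sb Sc Sd] := antip_a_b_c_d.
pose z := antipode x * y.
have pz : point B z by apply: point_mul => //; apply: point_antip.
have az : ev a z = ev d x * ev a y - ev b x * ev c y.
  by rewrite evaM -!antipE Sa Sb dualN mulNr.
have bz : ev b z = ev d x * ev b y - ev b x * ev d y.
  by rewrite evbM -!antipE Sa Sb dualN mulNr.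
have cz : ev c z = - ev c x * ev a y + ev a x * ev c y.
  by rewrite evcM -!antipE Sc Sd dualN.
have dz : ev d z = - ev c x * ev b y + ev a x * ev d y.
  by rewrite evdM -!antipE Sc Sd dualN.
have trz : ev a z + ev d z = 2.
  rewrite az dz; transitivity (1 + 1 - ((ev a x - ev a y) * (ev d x - ev d y) -
      (ev b x - ev b y) * (ev c x - ev c y)) : C); last by rewrite dxy subrr; ring.
  by rewrite -{1}detx -dety; ring.
have [az1 bz0 cz0 dz1] := point_unipotent pz trz.
move: az bz cz dz; rewrite az1 bz0 cz0 dz1 => az bz cz dz.
have ea : ev a y = ev a x.
  transitivity ((ev a x * ev d x - ev b x * ev c x) * ev a y); first by rewrite detx mul1r.
  transitivity (ev a x * (ev d x * ev a y - ev b x * ev c y) +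
    ev b x * (- ev c x * ev a y + ev a x * ev c y)); first by ring.
  by rewrite -az -cz mulr1 mulr0 addr0.
have eb : ev b y = ev b x.
  transitivity ((ev a x * ev d x - ev b x * ev c x) * ev b y); first by rewrite detx mul1r.
  transitivity (ev a x * (ev d x * ev b y - ev b x * ev d y) +
    ev b x * (- ev c x * ev b y + ev a x * ev d y)); first by ring.
  by rewrite -bz -dz mulr1 mulr0 add0r.
have ec : ev c y = ev c x.
  transitivity ((ev a x * ev d x - ev b x * ev c x) * ev c y); first by rewrite detx mul1r.
  transitivity (ev c x * (ev d x * ev a y - ev b x * ev c y) +
    ev d x * (- ev c x * ev a y + ev a x * ev c y)); first by ring.
  by rewrite -az -cz mulr1 mulr0 addr0.
have ed : ev d y = ev d x.
  transitivity ((ev a x * ev d x - ev b x * ev c x) * ev d y); first by rewrite detx mul1r.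
  transitivity (ev c x * (ev d x * ev b y - ev b x * ev d y) +
    ev d x * (- ev c x * ev b y + ev a x * ev d y)); first by ring.
  by rewrite -bz -dz mulr1 mulr0 add0r.
by rewrite ea eb ec ed.
Qed.

(** In a basis of joint eigenvectors, [wc_u] and [wc_v] become for each pair (i, j) a homogeneous
    linear system in the entries of p and q, with determinant det (M(x i) - M(x j)) up to sign. It
    vanishes only if M(x i) = M(x j), where the commutators are trivially 0. *)
Let commMw : forall f g, f \in [:: a; b; c; d] -> g \in [:: p; q] -> f * g = g * f.
Proof.
have [P [x [uP px dP]]] := joint_diagonalization BP sB commM.
have u1 : a * q - q * a = b * p - p * b.
  by apply/eqP; rewrite subr_eq addrAC (subr0_eq (wc_u W)) addrK.
have v1 : c * q - q * c = d * p - p * d.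
  by apply/eqP; rewrite subr_eq addrAC (subr0_eq (wc_v W)) addrK.
move=> f g fM gw; apply: rmx_inj; rewrite !rmxM.
have comm := @commute_of_row_symmetry _ _ P (rmx a) (rmx b) (rmx c) (rmx d) (rmx p) (rmx q)
  (fun i => (ev a (x i), ev b (x i), ev c (x i), ev d (x i))) uP
  (dP a aB) (dP b bB) (dP c cB') (dP d dB) _ _ _ (rmx f) (rmx g) (map_f (@rmx C H) fM) (map_f (@rmx C H) gw).
apply: comm.
- by rewrite -!rmxM -!rmxB u1.
- by rewrite -!rmxM -!rmxB v1.
- by move=> i j; apply: point_separated.
Qed.

Lemma comm_generators : {in [:: a; b; c; d; p; q] &, commutative *%R}.
Proof.
have cases f : f \in [:: a; b; c; d; p; q] -> (f \in [:: a; b; c; d]) || (f \in [:: p; q]).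
  by rewrite -mem_cat.
move=> f g /cases/orP[] ff /cases/orP[] gg.
- exact: commM.
- exact: commMw.
- by rewrite -commMw.
- by move: ff gg; rewrite !inE => /orP[]/eqP-> /orP[]/eqP->.
Qed.

End MatrixPoints.

Lemma coaction_sub_hopf (B : {vspace dual}) :
  (forall f, f \in B <-> gen [:: a; b; c; d; p; q] f) -> sub_hopf B.
Proof.
move=> BP; have [Sa Sb Sc Sd] := antip_a_b_c_d.
set s := [:: a; b; c; d; p; q] in BP *.
have [ga gb gc gd] : [/\ gen s a, gen s b, gen s c & gen s d].
  by split; apply: gen_mem; rewrite !inE eqxx ?orbT.
have [gp gq] : gen s p /\ gen s q by split; apply: gen_mem; rewrite !inE eqxx ?orbT.
have g1 := gen_1 s.
have sE f : f \in s -> [\/ f = a, f = b, f = c | f = d] \/ (f = p \/ f = q).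
  rewrite !inE => /orP[/eqP->|]; first by left; constructor 1.
  move=> /orP[/eqP->|]; first by left; constructor 2.
  move=> /orP[/eqP->|]; first by left; constructor 3.
  move=> /orP[/eqP->|]; first by left; constructor 4.
  by move=> /orP[]/eqP->; right; [left|right].
apply: (gen_sub_hopf BP) => f /sE[[]->|[]->].
- by exists [:: (a, a); (b, c)]; [apply: wc_comul_a W|move=> r; rewrite !inE => /orP[]/eqP->].
- by exists [:: (a, b); (b, d)]; [apply: wc_comul_b W|move=> r; rewrite !inE => /orP[]/eqP->].
- by exists [:: (c, a); (d, c)]; [apply: wc_comul_c W|move=> r; rewrite !inE => /orP[]/eqP->].
- by exists [:: (c, b); (d, d)]; [apply: wc_comul_d W|move=> r; rewrite !inE => /orP[]/eqP->].
- by exists [:: (1, p); (p, a); (q, c)]; [apply: wc_comul_p W|move=> r; rewrite !inE => /or3P[]/eqP->].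
- by exists [:: (1, q); (p, b); (q, d)]; [apply: wc_comul_q W|move=> r; rewrite !inE => /or3P[]/eqP->].
- by rewrite Sa.
- by rewrite Sb; apply: gen_opp.
- by rewrite Sc; apply: gen_opp.
- by rewrite Sd.
(* The antipode axiom reads S(p) + p S(a) + q S(c) = 0 and is solved for S(p). *)
- have := antip_mulr (wc_comul_p W); rewrite !big_cons big_nil addr0 /= (wc_p1 W) scale0r mul1r.
  move/eqP; rewrite addr_eq0 Sa Sc => /eqP->; apply/gen_opp/gen_add; apply: gen_mul => //.
  exact: gen_opp.
- have := antip_mulr (wc_comul_q W); rewrite !big_cons big_nil addr0 /= (wc_q1 W) scale0r mul1r.
  move/eqP; rewrite addr_eq0 Sb Sd => /eqP->; apply/gen_opp/gen_add; apply: gen_mul => //.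
  exact: gen_opp.
Qed.

Lemma coaction_comm : {in [:: a; b; c; d; p; q] &, commutative *%R}.
Proof. by have [B BP] := gen_vspace [:: a; b; c; d]; apply: (comm_generators BP). Qed.

Lemma coaction_det x : {in [:: a; b; c; d] &, forall f g, ev (f * g) x = ev f x * ev g x} ->
  ev 1 x = 1 -> ev a x * ev d x - ev b x * ev c x = 1.
Proof.
by move=> xM x1; rewrite -!xM ?inE ?eqxx ?orbT // -dualB adbc.
Qed.

End Coaction.

(** * From the action to the coaction *)

Section Weyl.
Local Open Scope quotient_scope.
Variable K : fieldType.
Local Notation A1 := (weyl K).
Local Notation u := (weyl_u K).
Local Notation v := (weyl_v K).

Let weylP f g : weyl_ideal (f - g) -> \pi_A1 f = \pi_A1 g :> A1.
Proof. by move=> fg; apply/eqmodP/asboolP. Qed.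

Let weyl_repr (f : free_alg2 K) : weyl_ideal (generic_quotient.repr (\pi_A1 f : A1) - f).
Proof.
apply/asboolP; rewrite -[X in is_true X]/(weyl_equiv K _ _).
by apply/eqmodP; rewrite reprK.
Qed.

Lemma weyl_piD (f g : free_alg2 K) : (\pi_A1 f : A1) + \pi_A1 g = \pi_A1 (f + g).
Proof.
by apply: weylP; rewrite opprD addrACA; apply: weyl_idealD; apply: weyl_repr.
Qed.

Lemma weyl_piM (f g : free_alg2 K) : (\pi_A1 f : A1) * \pi_A1 g = \pi_A1 (f * g).
Proof.
apply: weylP; set f' := generic_quotient.repr _; set g' := generic_quotient.repr _.
rewrite (_ : _ - _ = (f' - f) * g' + f * (g' - g)); last by rewrite mulrBl mulrBr addrA subrK.
by apply: weyl_idealD; [apply: weyl_idealMr|apply: weyl_idealMl]; apply: weyl_repr.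
Qed.

Lemma weyl_piZ c (f : free_alg2 K) : c *: (\pi_A1 f : A1) = \pi_A1 (c *: f).
Proof.
apply: weylP; rewrite -scalerBr -mul_malgC.
by apply/weyl_idealMl/weyl_repr.
Qed.

Lemma malgU_scale (c : K) (w : {fmonom 'I_2}) : << c *g w >> = c *: << w >> :> free_alg2 K.
Proof. by apply/malgP => z; rewrite mcoeffZ !mcoeffU mulr_natr. Qed.

(** Expresses that u and v generate the algebra, so that the quotient construction can be forgotten
    afterwards. *)
Lemma weyl_ind (P : A1 -> Prop) : P 1 -> P u -> P v ->
  (forall a x y, P x -> P y -> P (a *: x + y)) -> (forall x y, P x -> P y -> P (x * y)) ->
  forall x, P x.
Proof.
move=> P1 Pu Pv PL PM x.
have P0 : P 0 by rewrite -[0](addNr 1) -scaleN1r; apply: PL.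
have Pw (w : {fmonom 'I_2}) : P (\pi_A1 << w >>).
  case: w => w; elim: w => [|i w IH]; first by rewrite -fmoneE.
  have -> : << FMonom (i :: w) >> = << fmu i >> * << FMonom w >> :> free_alg2 K.
    rewrite malgM_def fgmulUU mul1r; congr << _ >>; apply/eqP.
    by rewrite fmP fmM fmU.
  rewrite -weyl_piM; apply: PM => //.
  have [->|i1] : i = 0 \/ i = 1.
    by case: i => -[|[|//]] i; [left|right]; apply: val_inj.
  - exact: Pu.
  - by rewrite i1; exact: Pv.
rewrite -[x]reprK [X in \pi_A1 X]monalgE; elim: (enum_fset _) => [|w s IH].
  by rewrite big_nil.
rewrite big_cons -weyl_piD.
move: IH; set y := \pi_A1 (\sum_(i <- s) _) => Py; move: (_@_w) => c.
by rewrite malgU_scale -weyl_piZ; exact: PL (Pw w) Py.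
Qed.

End Weyl.

Section Combinations.
Variables (K : comPzRingType) (V : lmodType K).

Lemma scale_combination (f e g p a c k q b d : K) (x y z : V) :
  f *: (e *: x) + g *: (p *: x + a *: y + c *: z) + k *: (q *: x + b *: y + d *: z) =
  (f * e + g * p + k * q) *: x + (g * a + k * b) *: y + (g * c + k * d) *: z.
Proof.
rewrite !scalerDr !scalerA !scalerDl -!addrA; congr (_ + (_ + _)).
rewrite !(addrCA _ ((k * q) *: x)); congr (_ + (_ + _)).
by rewrite addrCA.
Qed.

Lemma sub_combination (a0 a1 a2 a3 a4 a5 b0 b1 b2 b3 b4 b5 e : K) (x0 x1 x2 x3 x4 x5 : V) :
  (a0 - b0 - e) *: x0 + (a1 - b1) *: x1 + (a2 - b2) *: x2 + (a3 - b3) *: x3 +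
  (a4 - b4) *: x4 + (a5 - b5) *: x5 =
  a0 *: x0 + a1 *: x1 + a2 *: x2 + a3 *: x3 + a4 *: x4 + a5 *: x5 -
  (b0 *: x0 + b1 *: x1 + b2 *: x2 + b3 *: x3 + b4 *: x4 + b5 *: x5) - e *: x0.
Proof.
rewrite !scalerBl !opprD.
do 4!rewrite [in RHS](addrACA _ _ (_ + _)); rewrite [in RHS](addrACA (a0 *: x0)).
by do 5!(rewrite [RHS]addrAC; congr (_ + _)).
Qed.
End Combinations.

Section WeylCoordinates.
Variables (C : numClosedFieldType) (A : algType C) (u v : A).
Hypothesis rel : v * u - u * v = 1.

Let vu : v * u = u * v + 1.
Proof. by apply/eqP; rewrite addrC -subr_eq rel. Qed.

(** Normal ordering: v u is replaced by u v + 1, whence the extra constant a2 b1. *)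
Lemma mul_F1 (a0 a1 a2 b0 b1 b2 : C) :
  (a0 *: 1 + a1 *: u + a2 *: v) * (b0 *: 1 + b1 *: u + b2 *: v) =
  (a0 * b0 + a2 * b1) *: 1 + (a0 * b1 + a1 * b0) *: u + (a0 * b2 + a2 * b0) *: v +
  (a1 * b1) *: (u * u) + (a1 * b2 + a2 * b1) *: (u * v) + (a2 * b2) *: (v * v).
Proof.
rewrite !mulrDl !mulrDr -!scalerAl -!scalerAr !mul1r !mulr1 vu !scalerA scalerDr !scalerDl.
rewrite -!addrA !(addrCA _ (a2 * b1)%:A); do 3!congr (_ + _).
by rewrite addrCA !(addrCA _ ((a2 * b0) *: v)).
Qed.

Let ad (x y : A) := x * y - y * x.
Let adD x y z : ad x (y + z) = ad x y + ad x z.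
Proof. by rewrite /ad mulrDr mulrDl opprD addrACA. Qed.
Let adZ x c y : ad x (c *: y) = c *: ad x y.
Proof. by rewrite /ad -scalerAr -scalerAl scalerBr. Qed.
Let adM x y z : ad x (y * z) = ad x y * z + y * ad x z.
Proof. by rewrite /ad mulrBl mulrBr !mulrA addrA subrK. Qed.
Let ad1 x : ad x 1 = 0. Proof. by rewrite /ad mulr1 mul1r subrr. Qed.
Let ad0 x : ad x 0 = 0. Proof. by rewrite /ad mulr0 mul0r subrr. Qed.
Let adxx x : ad x x = 0. Proof. by rewrite /ad subrr. Qed.
Let advu : ad v u = 1. Proof. exact: rel. Qed.
Let aduv : ad u v = -1. Proof. by rewrite /ad vu opprD addrA subrr add0r. Qed.

(** The commutators with v and u act as d/du and -d/dv. Two of them isolate each quadratic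
    coefficient, one then isolates each linear one. *)
Lemma weyl_independent (c0 c1 c2 c3 c4 c5 : C) :
  c0 *: 1 + c1 *: u + c2 *: v + c3 *: (u * u) + c4 *: (u * v) + c5 *: (v * v) = 0 ->
  [/\ c0 = 0, c1 = 0, c2 = 0, c3 = 0 & c4 = 0 /\ c5 = 0].
Proof.
move=> X0.
have inj (c : C) : c *: (1 : A) = 0 -> c = 0.
  by move/eqP; rewrite scaler_eq0 oner_eq0 orbF => /eqP.
have ev1 := congr1 (ad v) X0.
rewrite !(adD, adZ, adM, ad1, adxx, advu, ad0, mul1r, mulr1, mulr0, mul0r, scaler0, addr0, add0r) in ev1.
have eu1 := congr1 (ad u) X0.
rewrite !(adD, adZ, adM, ad1, adxx, aduv, ad0, mulrN1, mulN1r, mulr0, mul0r, scaler0, addr0, add0r) in eu1.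
have := congr1 (ad v) ev1.
rewrite !(adD, adZ, ad1, adxx, advu, ad0, scaler0, addr0, add0r) scalerDr -scalerDl -mulr2n.
move=> /inj/eqP; rewrite mulrn_eq0 /= => /eqP z3.
have := congr1 (ad u) ev1.
rewrite !(adD, adZ, ad1, adxx, aduv, ad0, scaler0, addr0, add0r) scalerN -scaleNr => /inj/eqP.
rewrite oppr_eq0 => /eqP z4.
have := congr1 (ad u) eu1.
rewrite z3 z4 !scale0r !addr0 -!scaleN1r.
rewrite !(adD, adZ, ad1, adxx, aduv, ad0, scaler0, addr0, add0r) -!scaleN1r !scalerA mulrNN mulr1.
rewrite scale1r scalerDr -scalerDl -mulr2n => /inj/eqP; rewrite mulrn_eq0 /= => /eqP z5.
move: ev1; rewrite z3 z4 !scale0r !addr0 => /inj z1.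
move: eu1; rewrite z4 z5 !scale0r !addr0 scalerN -scaleNr => /inj/eqP.
rewrite oppr_eq0 => /eqP z2.
by move: X0; rewrite z1 z2 z3 z4 z5 !scale0r !addr0 => /inj z0.
Qed.

Lemma weyl_F1_inj (c0 c1 c2 e0 e1 e2 : C) :
  c0 *: 1 + c1 *: u + c2 *: v = e0 *: 1 + e1 *: u + e2 *: v ->
  [/\ c0 = e0, c1 = e1 & c2 = e2].
Proof.
move/eqP; rewrite -subr_eq0 => /eqP E.
have := @weyl_independent (c0 - e0) (c1 - e1) (c2 - e2) 0 0 0.
rewrite !scale0r !addr0 !scalerBl.
have -> : c0 *: 1 - e0 *: 1 + (c1 *: u - e1 *: u) + (c2 *: v - e2 *: v) =
    c0 *: 1 + c1 *: u + c2 *: v - (e0 *: 1 + e1 *: u + e2 *: v).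
  by rewrite !opprD [in RHS]addrACA [in RHS](addrACA (c0 *: 1)).
by case/(_ E) => /subr0_eq-> /subr0_eq-> /subr0_eq->.
Qed.

Variable H : hopfAlgType C.
Local Notation dual := (dual H).

Definition F1_elt (f g k : dual) (h : H) : A := ev f h *: 1 + ev g h *: u + ev k h *: v.

Lemma F1_coordinates (F : H -> A) : linear F ->
  (forall h, exists c : C * C * C, F h = c.1.1%:A + c.1.2 *: u + c.2 *: v) ->
  exists f g k, forall h, F h = F1_elt f g k h.
Proof.
move=> linF F1F; have /choice[c cP] := F1F.
have lin3 a x y : [/\ (c (a *: x + y)).1.1 = a * (c x).1.1 + (c y).1.1,
    (c (a *: x + y)).1.2 = a * (c x).1.2 + (c y).1.2
  & (c (a *: x + y)).2 = a * (c x).2 + (c y).2].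
  apply: weyl_F1_inj; rewrite -cP linF !cP !scalerDr !scalerDl !scalerA.
  by rewrite [LHS]addrACA; congr (_ + _); rewrite [LHS]addrACA.
pose f0 (h : H) : C^o := (c h).1.1; pose f1 (h : H) : C^o := (c h).1.2.
pose f2 (h : H) : C^o := (c h).2.
have l0 : linear f0 by move=> a x y; rewrite /f0; have [-> _ _] := lin3 a x y.
have l1 : linear f1 by move=> a x y; rewrite /f1; have [_ -> _] := lin3 a x y.
have l2 : linear f2 by move=> a x y; rewrite /f2; have [_ _ ->] := lin3 a x y.
pose g0 : {linear H -> C^o} := HB.pack f0 (GRing.isLinear.Build C H C^o *:%R f0 l0).
pose g1 : {linear H -> C^o} := HB.pack f1 (GRing.isLinear.Build C H C^o *:%R f1 l1).
pose g2 : {linear H -> C^o} := HB.pack f2 (GRing.isLinear.Build C H C^o *:%R f2 l2).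
by exists (mk_dual g0), (mk_dual g1), (mk_dual g2) => h; rewrite /F1_elt !mk_dualE cP.
Qed.

Lemma tlift_F1_mul (f0 f1 f2 g0 g1 g2 : dual) (h : H) :
  tlift (fun x y : H => F1_elt f0 f1 f2 x * F1_elt g0 g1 g2 y) (comul h) =
  ev (f0 * g0 + f2 * g1) h *: 1 + ev (f0 * g1 + f1 * g0) h *: u +
  ev (f0 * g2 + f2 * g0) h *: v + ev (f1 * g1) h *: (u * u) +
  ev (f1 * g2 + f2 * g1) h *: (u * v) + ev (f2 * g2) h *: (v * v).
Proof.
transitivity (tlift (fun x y : H =>
    (ev f0 x * ev g0 y + ev f2 x * ev g1 y) *: (1 : A) +
    (ev f0 x * ev g1 y + ev f1 x * ev g0 y) *: u +
    (ev f0 x * ev g2 y + ev f2 x * ev g0 y) *: v + (ev f1 x * ev g1 y) *: (u * u) +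
    (ev f1 x * ev g2 y + ev f2 x * ev g1 y) *: (u * v) +
    (ev f2 x * ev g2 y) *: (v * v)) (comul h)).
  by apply: eq_tlift => x y; rewrite /F1_elt mul_F1.
by rewrite !tliftD !tliftZr !tliftKD !dualD !dualM.
Qed.

Variable act : H -> A -> A.
Hypothesis act_modalg : module_algebra act.
Hypothesis act_F1 : forall h a,
  (exists c : C * C * C, a = c.1.1%:A + c.1.2 *: u + c.2 *: v) ->
  exists c : C * C * C, act h a = c.1.1%:A + c.1.2 *: u + c.2 *: v.

(** The six elements are the coordinates of [act h u] and [act h v] as functions of h. Associativity
    of the action gives their coproducts, the action of 1 their values at 1, and applying h to v u -
    u v = 1 gives the relations, read off in the normally ordered basis. *)
Lemma weyl_coaction_of_action : exists a b c d p q,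
  [/\ weyl_coaction a b c d p q, forall h, act h u = F1_elt p a c h
    & forall h, act h v = F1_elt q b d h].
Proof.
have [|p [a [c uE]]] := F1_coordinates (act_linearl act_modalg u).
  move=> h; apply: act_F1; exists (0, 1, 0); rewrite /= scale1r !scale0r.
  by rewrite add0r addr0.
have [|q [b [d vE]]] := F1_coordinates (act_linearl act_modalg v).
  move=> h; apply: act_F1; exists (0, 0, 1); rewrite /= scale1r !scale0r.
  by rewrite !add0r.
pose L h : {linear A -> A} :=
  HB.pack (act h) (GRing.isLinear.Build C A A *:%R (act h) (act_linearr act_modalg h)).
have actF f g k x y : act x (F1_elt f g k y) =
    (ev f y * ev 1 x + ev g y * ev p x + ev k y * ev q x) *: 1 +
    (ev g y * ev a x + ev k y * ev b x) *: u + (ev g y * ev c x + ev k y * ev d x) *: v.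
  rewrite -[act x _]/(L x _) /F1_elt !linearD !linearZ /= (act_one act_modalg) uE vE.
  by rewrite scale_combination dual1.
have act_comul f g k x y (w : A) : (forall h, act h w = F1_elt f g k h) ->
    [/\ ev f (x * y) = ev f y * ev 1 x + ev g y * ev p x + ev k y * ev q x,
      ev g (x * y) = ev g y * ev a x + ev k y * ev b x
    & ev k (x * y) = ev g y * ev c x + ev k y * ev d x].
  by move=> wE; apply: weyl_F1_inj; rewrite -actF -wE -(Defs.actM act_modalg) wE.
have act_at1 f g k (w : A) e0 e1 e2 : (forall h, act h w = F1_elt f g k h) ->
    w = e0 *: 1 + e1 *: u + e2 *: v -> [/\ ev f 1 = e0, ev g 1 = e1 & ev k 1 = e2].
  by move=> wE we; apply: weyl_F1_inj; rewrite -[LHS]/(F1_elt f g k 1) -wE (Defs.act1 act_modalg).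
have [|p1 a1 c1] := act_at1 _ _ _ u 0 1 0 uE.
  by rewrite scale1r !scale0r add0r addr0.
have [|q1 b1 d1] := act_at1 _ _ _ v 0 0 1 vE.
  by rewrite scale1r !scale0r !add0r.
have relE h : act h (v * u) - act h (u * v) = counit h *: 1.
  by rewrite -[LHS]/(L h _ - L h _) -linearB /= rel (act_one act_modalg).
have coef h : [/\ ev (q * p + d * a) h - ev (p * q + c * b) h - ev 1 h = 0,
    ev (q * a + b * p) h - ev (p * b + a * q) h = 0,
    ev (q * c + d * p) h - ev (p * d + c * q) h = 0,
    ev (b * a) h - ev (a * b) h = 0
  & ev (b * c + d * a) h - ev (a * d + c * b) h = 0 /\ ev (d * c) h - ev (c * d) h = 0].
  apply: weyl_independent; have := relE h.
  rewrite !(act_mul act_modalg).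
  under eq_tlift do rewrite uE vE.
  rewrite tlift_F1_mul.
  under [X in _ - X]eq_tlift do rewrite uE vE.
  rewrite tlift_F1_mul -dual1 => E; rewrite -(subrr (ev 1 h *: 1 : A)) -[X in _ = X - _]E.
  exact: sub_combination.
exists a, b, c, d, p, q; split=> //; split=> //.
- by move=> x y; have [_ -> _] := act_comul _ _ _ x y u uE; rewrite !big_cons big_nil addr0 /= ![ev _ y * _]mulrC.
- by move=> x y; have [_ -> _] := act_comul _ _ _ x y v vE; rewrite !big_cons big_nil addr0 /= ![ev _ y * _]mulrC.
- by move=> x y; have [_ _ ->] := act_comul _ _ _ x y u uE; rewrite !big_cons big_nil addr0 /= ![ev _ y * _]mulrC.
- by move=> x y; have [_ _ ->] := act_comul _ _ _ x y v vE; rewrite !big_cons big_nil addr0 /= ![ev _ y * _]mulrC.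
- move=> x y; have [-> _ _] := act_comul _ _ _ x y u uE; rewrite !big_cons big_nil addr0 addrA /=.
  by rewrite ![ev _ y * _]mulrC.
- move=> x y; have [-> _ _] := act_comul _ _ _ x y v vE; rewrite !big_cons big_nil addr0 addrA /=.
  by rewrite ![ev _ y * _]mulrC.
- by apply/dualP => h; rewrite dual0 dualB; have [_ _ _ -> _] := coef h.
- by apply/dualP => h; rewrite dual0 dualB; have [_ _ _ _ [_ ->]] := coef h.
- apply/dualP => h; rewrite dual0; have [_ _ _ _ [<- _]] := coef h.
  by rewrite !(dualD, dualN); ring.
- apply/dualP => h; apply/eqP; rewrite -subr_eq0; apply/eqP; have [<- _ _ _ _] := coef h.
  by rewrite !(dualD, dualN); ring.
- apply/dualP => h; rewrite dual0; have [_ <- _ _ _] := coef h.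
  by rewrite !(dualD, dualN); ring.
- apply/dualP => h; rewrite dual0; have [_ _ <- _ _] := coef h.
  by rewrite !(dualD, dualN); ring.
Qed.

End WeylCoordinates.

(** * Annihilators and Hopf ideals *)

Section Annihilator.
Variables (K : fieldType) (H : hopfAlgType K).
Import VectorInternalTheory.
Local Notation dual := (dual H).
Implicit Types (f g : dual) (x y : H).

Lemma tens_tensv (U V : vectType K) (X : {vspace U}) (Y : {vspace V}) (x : U) (y : V) :
  x \in X -> y \in Y -> tens x y \in tensv X Y.
Proof.
move=> xX yY; rewrite (coord_vbasis xX) (coord_vbasis yY).
pose F z : {linear U -> tensor U V} :=
  HB.pack (fun w : U => tens w z) (GRing.isLinear.Build K U (tensor U V) *:%R _ (@tens_linearl K U V z)).
pose G z : {linear V -> tensor U V} :=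
  HB.pack (tens z) (GRing.isLinear.Build K V (tensor U V) *:%R _ (@tens_linearr K U V z)).
have FE (p : U) (q : V) : tens p q = F q p by [].
have GE (p : U) (q : V) : tens p q = G p q by [].
rewrite FE linear_sum rpred_sum // => i _; rewrite linearZ rpredZ //=.
rewrite GE linear_sum rpred_sum // => j _; rewrite linearZ rpredZ //=.
by apply/memv_span/allpairs_f; apply: mem_nth; rewrite size_tuple ltn_ord.
Qed.

(** Finite-dimensional duality: the columns of the cokernel of [M] are coordinate vectors of
    elements of H killed by [B]. *)
Lemma double_annihilator (B : {vspace dual}) f :
  (forall x, (forall g, g \in B -> ev g x = 0) -> ev f x = 0) -> f \in B.
Proof.
move=> fB; pose M := \matrix_(i < \dim B, j < dim H) ev (vbasis B)`_i (r2v (delta_mx 0 j)).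
pose phi := \row_(j < dim H) ev f (r2v (delta_mx 0 j)).
have evE g (w : 'cV[K]_(dim H)) :
    ev g (r2v w^T) = ((\row_(j < dim H) ev g (r2v (delta_mx 0 j))) *m w) 0 0.
  rewrite [in LHS](row_sum_delta w^T) linear_sum ev_sum mxE; apply: eq_bigr => j _.
  by rewrite linearZ evZ !mxE mulrC.
have /submxP[D phiE] : (phi <= M)%MS.
  rewrite submxE; apply/eqP/rowP => k; rewrite [RHS]mxE.
  pose w := col k (cokermx M).
  have -> : (phi *m cokermx M) 0 k = (phi *m w) 0 0 by rewrite mxE [RHS]mxE; apply: eq_bigr => j _; rewrite [w _ _]mxE.
  rewrite -evE; apply: fB => g gB; rewrite (coord_vbasis gB) dual_sum big1 // => i _.
  rewrite dualZ evE.
  have -> : \row_(j < dim H) ev (vbasis B)`_i (r2v (delta_mx 0 j)) = row i M.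
    by apply/rowP => j; rewrite !mxE.
  have -> : (row i M *m w) 0 0 = (M *m cokermx M) i k.
    by rewrite mxE [RHS]mxE; apply: eq_bigr => j _; rewrite [w _ _]mxE [row _ _ _ _]mxE.
  by rewrite mulmx_coker mxE mulr0.
have -> : f = \sum_(i < \dim B) D 0 i *: (vbasis B)`_i.
  apply/dualP => x; rewrite (vec_coord x) !ev_sum; apply: eq_bigr => j _; rewrite !evZ; congr (_ * _).
  have := congr1 (fun X : 'rV_(dim H) => X 0 j) phiE; rewrite mxE => ->.
  by rewrite dual_sum mxE; apply: eq_bigr => i _; rewrite dualZ mxE.
rewrite rpred_sum // => i _; rewrite rpredZ // vbasis_mem // mem_nth // size_tuple ltn_ord //.
Qed.

Variable B : {vspace dual}.
Hypothesis sB : sub_hopf B.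
Variable I : {vspace H}.
Hypothesis IP : forall x, x \in I <-> forall f, f \in B -> ev f x = 0.

Let s x := x - projv I x.
Let s_linear : linear s.
Proof. by move=> a x y; rewrite /s linearP scalerBr opprD addrACA. Qed.
Let s0 x : x \in I -> s x = 0.
Proof. by move=> xI; rewrite /s projv_id // subrr. Qed.

(** The coordinates of [s] vanish on [I], so they lie in [B]. So do their products, which are
    therefore killed by x; these values are the entries of the tensor. *)
Lemma comul_complement x : x \in I -> tlift (fun y z : H => tens (s y) (s z)) (comul x) = 0.
Proof.
move=> xI; pose F i (y : H) : K^o := v2r (s y) 0 i.
have Fl i : linear (F i) by move=> a y z; rewrite /F s_linear linearP !mxE.
pose G i : {linear H -> K^o} := HB.pack (F i) (GRing.isLinear.Build K H K^o *:%R _ (Fl i)).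
have GB i : mk_dual (G i) \in B.
  apply: double_annihilator => y yB; rewrite mk_dualE /= /F s0 ?linear0 ?mxE //.
  exact/IP.
apply/matrixP => i j; rewrite [RHS]mxE.
have /IP/(_ (mk_dual (G i) * mk_dual (G j))) := xI.
rewrite sub_hopfM // => <- //; rewrite dualM.
rewrite /tlift summxE; apply: eq_bigr => k _; rewrite summxE; apply: eq_bigr => l _.
by rewrite !mxE big_ord1 !mxE !mk_dualE.
Qed.

Lemma annihilator_hopf_ideal : hopf_ideal I.
Proof.
split=> [h x /IP xI|x xI|x /IP xI|x /IP xI].
- split; apply/IP => f fB; first by rewrite -ltransE xI // ltrans_sub.
  by rewrite -transE xI // trans_sub.
- rewrite -(tlift_id (comul x)).
  (* With pi the projection onto [I], the identity splits as pi (x) id + s (x) pi + s (x) s, and the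
     last term vanishes on the coproduct of x. *)
  have tE : tlift (@tens K H H) (comul x) = tlift (fun y z : H => tens (projv I y) z) (comul x) +
     tlift (fun y z : H => tens (s y) (projv I z)) (comul x).
    rewrite -[RHS]addr0 -(comul_complement xI) -!tliftD; apply: eq_tlift => y z.
    rewrite -addrA.
    have -> : tens (s y) (projv I z) + tens (s y) (s z) = tens (s y) z.
      by rewrite -[X in X + _]scale1r -tens_linearr scale1r /s (addrC (projv I z)) subrK.
    by rewrite -[X in X + _]scale1r -tens_linearl scale1r /s (addrC (projv I y)) subrK.
  rewrite tE memv_add //.
    rewrite rpred_sum // => i _; rewrite rpred_sum // => j _; rewrite rpredZ //.
    by rewrite tens_tensv ?memv_proj ?memvf.
  rewrite rpred_sum // => i _; rewrite rpred_sum // => j _; rewrite rpredZ //.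
  by rewrite tens_tensv ?memv_proj ?memvf.
- by rewrite -dual1 xI // sub_hopf1.
- by apply/IP => f fB; rewrite -antipE xI // sub_hopf_antip.
Qed.

Variables (A : algType K) (act : H -> A -> A) (u v : A).
Hypothesis act_modalg : module_algebra act.
Hypothesis gen_A : forall P : A -> Prop, P 1 -> P u -> P v ->
  (forall a w z, P w -> P z -> P (a *: w + z)) -> (forall w z, P w -> P z -> P (w * z)) ->
  forall w, P w.
Hypothesis act_u : forall x, x \in I -> act x u = 0.
Hypothesis act_v : forall x, x \in I -> act x v = 0.

(** Induction on w. For a product, elements of [I] kill both factors, so both legs of the coproduct
    may be projected to the complement of [I], and [comul_complement] leaves 0. *)
Lemma annihilator_act x w : x \in I -> act x w = 0.
Proof.
move: x; apply: (gen_A (P := fun w => forall x, x \in I -> act x w = 0)) => //.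
- move=> x /IP xI; rewrite (act_one act_modalg) -dual1 xI ?scale0r //.
  exact: sub_hopf1.
- by move=> a w1 w2 y0 z0 x xI; rewrite (act_linearr act_modalg) y0 // z0 // scaler0 addr0.
move=> w1 w2 y0 z0 x xI; rewrite (act_mul act_modalg).
have actDl p q w' : act (p + q) w' = act p w' + act q w'.
  by rewrite -{1}[p]scale1r (act_linearl act_modalg) scale1r.
pose F (p q : H) := act p w1 * act q w2.
have Fl q : linear (F^~ q).
  by move=> a p p'; rewrite /F (act_linearl act_modalg) mulrDl -scalerAl.
have Fr p : linear (F p).
  by move=> a q q'; rewrite /F (act_linearl act_modalg) mulrDr -scalerAr.
transitivity (tlift F (tlift (fun p q : H => tens (s p) (s q)) (comul x))).
  rewrite linear_tlift; apply: eq_tlift => p q.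
  rewrite -[RHS]/(tlift F (tens (s p) (s q))) tlift_tens // /F /s.
  by rewrite -{1}(subrK (projv I p) p) -{1}(subrK (projv I q) q) !actDl
     (y0 (projv I p)) ?memv_proj // (z0 (projv I q)) ?memv_proj // !addr0.
by rewrite comul_complement // linear0.
Qed.

(** The annihilator of [B] is a Hopf ideal acting by 0, so inner faithfulness makes it 0. *)
Lemma inner_faithful_full : inner_faithful act -> forall f, f \in B.
Proof.
move=> faithful f; have I0 : I = 0%VS.
  apply/eqP; apply: contraT => /(faithful I annihilator_hopf_ideal)[h [m [hI]]].
  by rewrite annihilator_act // eqxx.
apply: double_annihilator => x /IP; rewrite I0 memv0 => /eqP->.
exact: ev0.
Qed.

End Annihilator.

(** * Group algebras *)

Section GroupLike.
Variables (C : numClosedFieldType) (H : hopfAlgType C).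
Import VectorInternalTheory.
Local Notation dual := (dual H).
Implicit Types (f g : dual) (x y z h : H).

Lemma dual_separates x y : (forall f, ev f x = ev f y) -> x = y.
Proof.
move=> fxy; apply: (can_inj v2rK); apply/rowP => i.
pose F (z : H) : C^o := v2r z 0 i.
have Fl : linear F by move=> a z t; rewrite /F linearP !mxE.
pose G : {linear H -> C^o} := HB.pack F (GRing.isLinear.Build C H C^o *:%R F Fl).
by have := fxy (mk_dual G); rewrite !mk_dualE.
Qed.

Definition glike x := ev 1 x = 1 /\ forall f g, ev (f * g) x = ev f x * ev g x.

Lemma glike_comul x : glike x -> comul x = tens x x.
Proof.
move=> [_ xM]; apply/matrixP => i j.
pose F i (z : H) : C^o := v2r z 0 i.
have Fl k : linear (F k) by move=> a z t; rewrite /F linearP !mxE.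
pose G k : {linear H -> C^o} := HB.pack (F k) (GRing.isLinear.Build C H C^o *:%R (F k) (Fl k)).
have := xM (mk_dual (G i)) (mk_dual (G j)); rewrite dualM !mk_dualE /= /F => E.
rewrite [RHS]mxE big_ord1 !mxE -E -[in LHS](tlift_id (comul x)).
rewrite /tliftK /tlift summxE; apply: eq_bigr => k _; rewrite summxE; apply: eq_bigr => l _.
by rewrite !mxE big_ord1 !mxE !mk_dualE.
Qed.

Lemma glike_mul x y : glike x -> glike y -> glike (x * y).
Proof.
move=> [x1 xM] [y1 yM]; split; first by rewrite (@is_comul1 _ H) big_seq1 /= x1 y1 mulr1.
move=> f g; rewrite dualM_mul.
have [xE yE] := (glike_comul (conj x1 xM), glike_comul (conj y1 yM)).
rewrite xE yE /tliftK tlift_tens; first last.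
- move=> p; apply: tlift_linear_param => r s a z t.
  by rewrite mulrDl -scalerAl evP mulrDr mulrCA.
- move=> p; apply: tlift_linear_param => r s a z t.
  by rewrite mulrDl -scalerAl evP mulrDl -mulrA.
rewrite tlift_tens // => p a z t.
- by rewrite mulrDr -scalerAr evP mulrDl -mulrA.
- by rewrite mulrDr -scalerAr evP mulrDr mulrCA.
Qed.

Lemma glike_1 : glike 1.
Proof. by split=> [|f g]; rewrite ?dual_at1 // dual1 counit1. Qed.

Lemma glike_antip x : glike x -> glike (antipode x).
Proof.
move=> [x1 xM]; split=> [|f g]; first by rewrite -antipE antip1.
by rewrite -!antipE antipM xM mulrC.
Qed.

Lemma glike_mulV x : glike x -> x * antipode x = 1.
Proof.
move=> gx; have := antipoder x; rewrite (glike_comul gx) tlift_tens; first last.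
- by move=> z a p q; rewrite linearP mulrDr -scalerAr.
- by move=> z a p q; rewrite mulrDl -scalerAl.
by move=> ->; rewrite -dual1; case: gx => -> _; rewrite scale1r.
Qed.

Lemma glike_mulIr x : glike x -> injective (fun y => y * x).
Proof.
move=> gx y z /(congr1 (fun t => t * antipode x)).
by rewrite -!mulrA glike_mulV // !mulr1.
Qed.

(** Lagrange interpolation: the product over y in [s] of (f - f(y)) / (f(x) - f(y)), where f is
    chosen for each y. *)
Lemma glike_separating (s : seq H) x : glike x -> (forall y, y \in s -> glike y) ->
  x \notin s -> exists2 e, ev e x = 1 & forall y, y \in s -> ev e y = 0.
Proof.
move=> gx; elim: s => [|y s IH] gs xs; first by exists 1; rewrite ?gx.1.
move: xs; rewrite inE negb_or => /andP[xy xs].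
have [|e ex es] := IH _ xs; first by move=> z zs; apply: gs; rewrite inE zs orbT.
have gy : glike y by apply: gs; rewrite mem_head.
have [f fxy] : exists f, ev f x != ev f y.
  apply: contrapT => /forallNP fE; case/eqP: xy; apply: dual_separates => f.
  by apply/eqP; have /negP := fE f; rewrite negbK.
have fxy0 : ev f x - ev f y != 0 by rewrite subr_eq0.
exists (((ev f x - ev f y)^-1 *: (f - ev f y *: 1)) * e) => [|z].
  by rewrite gx.2 ex dualZ dualB dualZ gx.1 !mulr1 mulVf.
rewrite inE => /orP[/eqP->|zs].
  by rewrite gy.2 dualZ dualB dualZ gy.1 mulr1 subrr mulr0 mul0r.
have gz : glike z by apply: gs; rewrite inE zs orbT.
by rewrite gz.2 es // mulr0.
Qed.

(** The points that diagonalise the whole dual exhaust the group-likes: for any other one, a form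
    with value 1 there and vanishing on all these points would have zero right multiplication. *)
Lemma glike_basis (s : seq dual) : {in s &, commutative *%R} -> (forall f, gen s f) ->
  exists X : seq H, [/\ uniq X, forall x, (x \in X) <-> glike x
    & forall f, (forall x, x \in X -> ev f x = 0) -> f = 0].
Proof.
move=> cs full.
have BP f : f \in (fullv : {vspace dual}) <-> gen s f by split=> // _; apply: memvf.
have sB : sub_hopf (fullv : {vspace dual}).
  split=> [|f g _ _|f _|f _]; rewrite ?memvf //.
  pose r := [seq (reg i j, \sum_k ((ev f (r2v (delta_mx 0 i)) * v2r (1 : H) 0 k) *: reg j k))
     | i <- index_enum 'I_(dim H), j <- index_enum 'I_(dim H)].
  exists r => [x y|p _]; last by rewrite !memvf.
   rewrite big_allpairs_dep {1}(dual_reg f) dual_sum; apply: eq_bigr => i _.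
  rewrite dual_sum; under [RHS]eq_bigr do rewrite /= dual_sum mulr_sumr.
  rewrite exchange_big; apply: eq_bigr => k _ /=.
  rewrite dualZ (reg_comul i k x y) big_map mulr_sumr; apply: eq_bigr => j _ /=.
  by rewrite dualZ mulrCA.
have [P [x [uP px dP]]] := joint_diagonalization BP sB cs.
have gx i : glike (x i) by have [x1 xM] := px i; split=> // f g; rewrite xM ?memvf.
pose X := undup (codom x).
have X0 f : (forall x, x \in X -> ev f x = 0) -> f = 0.
  move=> fX; apply: rmx_inj; rewrite linear0; have := dP f (memvf f).
  have -> : \row_i ev f (x i) = 0.
    by apply/rowP => i; rewrite !mxE fX // mem_undup codom_f.
  have -> : diag_mx (0 : 'rV[C]_(dim dual)) = 0 by apply/matrixP => i j; rewrite !mxE mul0rn.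
  move/(congr1 (fun A => invmx P *m A *m P)).
  by rewrite mulmx0 mul0mx !mulmxA mulVmx // mul1mx mulmxKV.
have gX y : y \in X -> glike y by rewrite mem_undup => /codomP[i ->].
exists X; split=> // [|y]; first exact: undup_uniq.
split=> [/gX//|gy]; apply: contraT => yX; have [e ey eX] := glike_separating gy gX yX.
by move/eqP: ey; rewrite (X0 e eX) dual0 eq_sym oner_eq0.
Qed.

End GroupLike.

Section GroupAlgebraIso.
Variables (C : numClosedFieldType) (H : hopfAlgType C) (gT : finGroupType).
Variable iota : gT -> H.
Hypothesis iota_inj : injective iota.
Hypothesis iota_glike : forall g, glike (iota g).
Hypothesis iotaM : forall g h, iota (g * h)%g = iota g * iota h.
Hypothesis iota1 : iota 1%g = 1.
Hypothesis iotaV : forall g, iota g^-1%g = antipode (iota g).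
Hypothesis iota_full : forall f : dual H, (forall g, ev f (iota g) = 0) -> f = 0.

Let e_exists g : exists e : dual H, forall h, ev e (iota h) = (h == g)%:R.
Proof.
have [||e e1 e0] := @glike_separating _ _ [seq iota h | h <- enum gT & h != g] (iota g) (iota_glike g).
- by move=> _ /mapP[h _ ->]; apply: iota_glike.
- by apply/negP => /mapP[h]; rewrite mem_filter => /andP[hg _] /iota_inj gh; rewrite gh eqxx in hg.
exists e => h; have [->//|hg] := eqVneq.
by apply: e0; apply/mapP; exists h => //; rewrite mem_filter hg mem_enum.
Qed.

Let e g : dual H := sval (cid (e_exists g)).
Let eE g h : ev (e g) (iota h) = (h == g)%:R.
Proof. by rewrite /e; case: cid. Qed.

(** The interpolating forms [e g] are dual to the [iota g], and by [iota_full] they span the dual;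
    hence the [iota g] form a basis of H. *)
Let expand x : x = \sum_g ev (e g) x *: iota g.
Proof.
apply: dual_separates => f; rewrite ev_sum.
have -> : f = \sum_g ev f (iota g) *: e g.
  apply/eqP; rewrite -subr_eq0; apply/eqP/iota_full => h; rewrite dualB dual_sum.
  rewrite (bigD1 h) //= dualZ eE eqxx mulr1 big1 ?addr0 ?subrr // => g /negPf gh.
  by rewrite dualZ eE eq_sym gh mulr0.
rewrite dual_sum; apply: eq_bigr => g _; rewrite evZ dualZ mulrC; congr (_ * _).
rewrite dual_sum (bigD1 g) //= dualZ eE eqxx mulr1 big1 ?addr0 // => h /negPf gh.
by rewrite dualZ eE eq_sym gh mulr0.
Qed.

Let F (x : H) : grpalg C gT := [ffun g => ev (e g) x].
Let F_linear : linear F.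
Proof. by move=> a x y; apply/ffunP => g; rewrite !ffunE evP. Qed.
Let Fl : {linear H -> grpalg C gT} :=
  HB.pack F (GRing.isLinear.Build C H (grpalg C gT) *:%R F F_linear).

Let Fi g : F (iota g) = grp_elt C g.
Proof. by apply/ffunP => h; rewrite !ffunE eE eq_sym. Qed.

Let ext (W : lmodType C) (f1 f2 : {linear H -> W}) :
  (forall g, f1 (iota g) = f2 (iota g)) -> f1 =1 f2.
Proof.
move=> fE x; rewrite (expand x) !linear_sum; apply: eq_bigr => g _.
by rewrite !linearZ /= fE.
Qed.

Let F1 : F 1 = 1.
Proof. by rewrite -iota1 Fi. Qed.

Let FM x y : F (x * y) = F x * F y.
Proof.
have sumE z : F z = \sum_g ev (e g) z *: grp_elt C g.
  rewrite -[F z]/(Fl z) {1}(expand z) linear_sum; apply: eq_bigr => g _.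
  by rewrite linearZ /= Fi.
rewrite {1}(expand x) {1}(expand y) mulr_suml -[F _]/(Fl _) linear_sum (sumE x) (sumE y) mulr_suml.
apply: eq_bigr => g _; rewrite !mulr_sumr linear_sum; apply: eq_bigr => h _.
rewrite -!scalerAl -!scalerAr !linearZ /= -iotaM Fi grp_eltM.
by rewrite !scalerA mulrC.
Qed.

Lemma grpalg_iso : hopf_isomorphic H (grpalg C gT).
Proof.
have Fmm : GRing.monoid_morphism F by split=> [|x y]; [apply: F1|apply: FM].
pose f : {lrmorphism H -> grpalg C gT} := HB.pack F
  (GRing.isLinear.Build C H (grpalg C gT) *:%R F F_linear)
  (GRing.isMonoidMorphism.Build H (grpalg C gT) F Fmm).
exists f; split.
- exists (fun phi : grpalg C gT => \sum_g phi g *: iota g) => [x|phi].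
    by rewrite [RHS]expand; apply: eq_bigr => g _; rewrite ffunE.
  rewrite linear_sum [RHS]grpalgE; apply: eq_bigr => g _.
  by rewrite linearZ /= Fi.
- pose L1 : {linear H -> tensor (grpalg C gT) (grpalg C gT)} := comul \o f.
  pose t (h1 h2 : H) : tensor (grpalg C gT) (grpalg C gT) := tens (f h1) (f h2).
  pose L2 : {linear H -> tensor (grpalg C gT) (grpalg C gT)} := tlift t \o comul.
  apply: (ext (f1 := L1) (f2 := L2)) => g.
  rewrite /L1 /L2 /= Fi (glike_comul (iota_glike g)) tlift_tens; first last.
  + by move=> x; rewrite /t => a y z; rewrite linearP tens_linearr.
  + by move=> x; rewrite /t => a y z; rewrite linearP tens_linearl.
  by rewrite /t /= Fi; apply: grpalg_comul_elt.
- pose L1 : {linear H -> C^o} := counit \o f.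
  apply: (ext (f1 := L1) (f2 := counit)) => g.
  rewrite /L1 /= Fi -[RHS]dual1 (iota_glike g).1.
  exact: grpalg_counit_elt.
- pose L1 : {linear H -> grpalg C gT} := antipode \o f.
  pose L2 : {linear H -> grpalg C gT} := f \o antipode.
  apply: (ext (f1 := L1) (f2 := L2)) => g.
  rewrite /L1 /L2 /= -iotaV !Fi.
  exact: grpalg_antipode_elt.
Qed.

End GroupAlgebraIso.

(** * The matrix group of the group-like elements *)

Section MatrixGroup.
Variables (C : numClosedFieldType) (H : hopfAlgType C).
Local Notation dual := (dual H).
Variables a b c d p q : dual.
Hypothesis W : weyl_coaction a b c d p q.
Hypothesis full : forall f, gen [:: a; b; c; d; p; q] f.
Implicit Types (f g : dual) (x y : H).

Definition point_mx x : 'M[C]_2 := \matrix_(i < 2, j < 2)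
  (if i == 0 then if j == 0 then ev a x else ev b x
   else if j == 0 then ev c x else ev d x).

Lemma point_mxM x y : point_mx (x * y) = point_mx x *m point_mx y.
Proof.
apply/matrixP => i j; rewrite !mxE !big_ord_recl big_ord0 addr0 !mxE /=.
case: i => -[|[|//]] i; case: j => -[|[|//]] j /=.
- by rewrite (wc_comul_a W) !big_cons big_nil addr0.
- by rewrite (wc_comul_b W) !big_cons big_nil addr0.
- by rewrite (wc_comul_c W) !big_cons big_nil addr0.
- by rewrite (wc_comul_d W) !big_cons big_nil addr0.
Qed.

Lemma point_mx1 : point_mx 1 = 1%:M.
Proof.
apply/matrixP => i j; rewrite !mxE (wc_a1 W) (wc_b1 W) (wc_c1 W) (wc_d1 W).
by case: i => -[|[|//]] i; case: j => -[|[|//]] j.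
Qed.

Lemma point_mx_det x : glike x -> \det (point_mx x) = 1.
Proof.
move=> [x1 xM]; rewrite det_mx2 !mxE /=; apply: (coaction_det W) x1 => f g _ _.
exact: xM.
Qed.

(** Right multiplication by a group-like permutes the finite list [X]. The resulting averages
    determine p and q from the matrix, so x and y agree on generators of the dual. *)
Lemma point_mx_inj (X : seq H) : uniq X -> (forall x, x \in X <-> glike x) ->
  {in X &, injective point_mx}.
Proof.
move=> uX XP x y xX yX Mxy.
have EX (f : dual) z : z \in X -> \sum_(t <- X) ev f (t * z) = \sum_(t <- X) ev f t.
  move=> zX; rewrite -(big_map (fun t => t * z) xpredT (fun t => ev f t)).
  have um : uniq [seq t * z | t <- X] by rewrite map_inj_uniq //; apply/glike_mulIr/XP.
  have sub : {subset [seq t * z | t <- X] <= X}.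
    by move=> _ /mapP[t /XP gt ->]; apply/XP/glike_mul => //; apply/XP.
  have [|_ E] := uniq_min_size um sub; first by rewrite size_map.
  by apply: perm_big; apply: uniq_perm.
have [eqa eqb eqc eqd] : [/\ ev a x = ev a y, ev b x = ev b y, ev c x = ev c y & ev d x = ev d y].
  have E i j : point_mx x i j = point_mx y i j by rewrite Mxy.
  by have := (E 0 0, E 0 1, E 1 0, E 1 1); rewrite !mxE /= => -[[[-> ->] ->] ->].
have X0 : (size X)%:R != 0 :> C by rewrite pnatr_eq0; case: (X) xX.
(* A cocycle on a finite group is a coboundary: average over the group. *)
have avg f z e1 e2 :
    (forall t, t \in X -> ev f (t * z) = ev f z + ev p t * e1 + ev q t * e2) -> z \in X ->
    (size X)%:R * ev f z = \sum_(t <- X) ev f t - (\sum_(t <- X) ev p t) * e1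
      - (\sum_(t <- X) ev q t) * e2.
  move=> fz zX; rewrite -(EX f z zX) (eq_big_seq _ fz) !big_split /=.
  rewrite -!mulr_suml big_const_seq count_predT iter_addr_0 mulr_natl.
  by rewrite addrAC !addrK.
have pE z t : t \in X -> ev p (t * z) = ev p z + ev p t * ev a z + ev q t * ev c z.
  move=> /XP[t1 _]; rewrite (wc_comul_p W) !big_cons big_nil addr0 addrA /=.
  by rewrite t1 mul1r.
have qE z t : t \in X -> ev q (t * z) = ev q z + ev p t * ev b z + ev q t * ev d z.
  move=> /XP[t1 _]; rewrite (wc_comul_q W) !big_cons big_nil addr0 addrA /=.
  by rewrite t1 mul1r.
have eqp : ev p x = ev p y.
  apply: (mulfI X0); rewrite (avg p x _ _ (pE x) xX) (avg p y _ _ (pE y) yX).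
  by rewrite eqa eqc.
have eqq : ev q x = ev q y.
  apply: (mulfI X0); rewrite (avg q x _ _ (qE x) xX) (avg q y _ _ (qE y) yX).
  by rewrite eqb eqd.
have [[x1 xM] [y1 yM]] := ((XP x).1 xX, (XP y).1 yX).
apply: dual_separates => f; elim: (full f) => {f} [f||e f g _ IHf _ IHg|f g _ IHf _ IHg].
- by rewrite !inE => /or4P[/eqP->|/eqP->|/eqP->|/or3P[]/eqP->].
- by rewrite x1 y1.
- by rewrite !(dualD, dualZ) IHf IHg.
- by rewrite xM yM IHf IHg.
Qed.

Lemma coaction_group : exists G : finSL2 C, hopf_isomorphic H (grpalg C (finSL2_elt G)).
Proof.
have [X [uX XP X0]] := glike_basis (coaction_comm W) full.
have injM := point_mx_inj uX XP.
have [Sa Sb Sc Sd] := antip_a_b_c_d W.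
pose S : {fset 'M[C]_2} := [fset point_mx x | x in X]%fset.
have SP A : reflect (exists2 x, x \in X & A = point_mx x) (A \in S) by apply: imfsetP.
have S1 : 1%:M \in S by apply/SP; exists 1; [apply/XP/glike_1|rewrite point_mx1].
have SM A B : A \in S -> B \in S -> A *m B \in S.
  move=> /SP[x /XP gx ->] /SP[y /XP gy ->]; apply/SP; exists (x * y); last by rewrite point_mxM.
  exact/XP/glike_mul.
have Sdet A : A \in S -> \det A = 1 by case/SP=> x /XP gx ->; apply: point_mx_det.
have invM x : glike x -> invmx (point_mx x) = point_mx (antipode x).
  move=> gx; have ux : point_mx x \in unitmx by rewrite unitmxE point_mx_det ?unitr1.
  by rewrite -[LHS]mulmx1 -point_mx1 -(glike_mulV gx) point_mxM mulmxA mulVmx // mul1mx.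
have SV A : A \in S -> invmx A \in S.
  case/SP=> x /XP gx ->; rewrite invM //; apply/SP; exists (antipode x) => //.
  exact/XP/glike_antip.
pose G := FinSL2 Sdet S1 SM SV; exists G.
have /choice[iota iotaP] (A : finSL2_elt G) : exists x, x \in X /\ point_mx x = val A.
  by have /SP[x xX ->] := valP A; exists x.
have iotaX A : iota A \in X by have [] := iotaP A.
have iotaE A : point_mx (iota A) = val A by have [] := iotaP A.
have iota_of x : x \in X -> exists A, x = iota A.
  move=> xX; have xS : point_mx x \in S by apply/SP; exists x.
  by exists [` xS]%fset; apply: injM => //; rewrite iotaE.
apply: (@grpalg_iso _ _ _ iota).
- by move=> A B AB; apply: val_inj; rewrite -!iotaE AB.
- by move=> A; apply/XP.
- move=> A B; apply: injM => //; last by rewrite point_mxM !iotaE.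
  by apply/XP/glike_mul; apply/XP.
- by apply: injM => //; [apply/XP/glike_1|rewrite point_mx1 iotaE].
- move=> A; apply: injM => //; first by apply/XP/glike_antip/XP.
  by rewrite iotaE -invM ?iotaE //; apply/XP.
- move=> f f0; apply: X0 => x /iota_of[A ->]; exact: f0.
Qed.

End MatrixGroup.

Section HopfAction.
Variables (C : numClosedFieldType) (H : hopfAlgType C) (A : algType C) (u v : A).
Variable act : H -> A -> A.
Hypothesis rel : v * u - u * v = 1.
Hypothesis gen_A : forall P : A -> Prop, P 1 -> P u -> P v ->
  (forall a w z, P w -> P z -> P (a *: w + z)) -> (forall w z, P w -> P z -> P (w * z)) ->
  forall w, P w.
Hypothesis act_modalg : module_algebra act.
Hypothesis act_F1 : forall h a,
  (exists c : C * C * C, a = c.1.1%:A + c.1.2 *: u + c.2 *: v) ->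
  exists c : C * C * C, act h a = c.1.1%:A + c.1.2 *: u + c.2 *: v.
Hypothesis act_faithful : inner_faithful act.

(** Stated for any algebra generated by two elements with v u - u v = 1, so that the quotient
    defining [weyl] stays out of the argument. *)
Lemma hopf_action_group : exists G : finSL2 C, hopf_isomorphic H (grpalg C (finSL2_elt G)).
Proof.
have [a [b [c [d [p [q [W uE vE]]]]]]] := weyl_coaction_of_action rel act_modalg act_F1.
have [B BP] := gen_vspace [:: a; b; c; d; p; q].
have sB := coaction_sub_hopf W BP.
have [I IP] : exists I : {vspace H}, forall x, x \in I <-> forall f, f \in B -> ev f x = 0.
  apply: vspace_of_pred => [f _|e x y x0 y0 f fB]; first exact: ev0.
  by rewrite evP x0 // y0 // mulr0 addr0.
have genB f : f \in [:: a; b; c; d; p; q] -> f \in B by move=> fs; apply/BP/gen_mem.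
have zero f g k x : f \in [:: a; b; c; d; p; q] -> g \in [:: a; b; c; d; p; q] ->
    k \in [:: a; b; c; d; p; q] -> x \in I -> F1_elt u v f g k x = 0.
  by move=> fs gs ks /IP x0; rewrite /F1_elt !x0 ?genB // !scale0r !addr0.
apply: (coaction_group W) => f; apply/BP.
apply: (inner_faithful_full sB IP act_modalg gen_A _ _ act_faithful) => x xI.
  by rewrite uE zero // !inE eqxx ?orbT.
by rewrite vE zero // !inE eqxx ?orbT.
Qed.

End HopfAction.

Lemma weyl_action_group (C : numClosedFieldType) (H : hopfAlgType C)
    (act : H -> weyl C -> weyl C) : module_algebra act -> preserves_std_filtration act ->
  inner_faithful act -> exists G : finSL2 C, hopf_isomorphic H (grpalg C (finSL2_elt G)).
Proof.
move=> act_modalg act_filt; apply: (hopf_action_group (weyl_relation C)) act_modalg _.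
  exact: weyl_ind.
exact: act_filt.
Qed.

(** * Axes of matrices of determinant 1 *)

Section Matrices.
Variable C : numClosedFieldType.
Implicit Types (A B Q P : 'M[C]_2).

Lemma cayley_hamilton2 A : A *m A = \tr A *: A - (\det A)%:M.
Proof.
rewrite det_mx2 mxtrace2.
by apply: mx2P; rewrite mul_mx2 !mxE /=; ring.
Qed.

Lemma traceless_anticomm A B : \tr A = 0 -> \tr B = 0 ->
  A *m B + B *m A = (\tr (A *m B))%:M.
Proof.
move=> /eqP; rewrite !mxtrace2 !mul_mx2 addr_eq0 => /eqP A0 /eqP; rewrite addr_eq0 => /eqP B0.
by apply: mx2P; rewrite mxE !mul_mx2 mxE /= A0 B0; ring.
Qed.

(** By Cayley-Hamilton A - 1 has square 0, so A^k = 1 + k (A - 1), which returns to 1 only when A =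
    1. *)
Lemma unipotent_mx2 A n : \det A = 1 -> \tr A = 2 -> A ^+ n.+1 = 1 -> A = 1.
Proof.
move=> dA tA An.
have N2 : (A - 1) * (A - 1) = 0.
  have := cayley_hamilton2 A; rewrite dA tA => CH.
  rewrite mulrBl mulrBr !mulr1 mul1r -[A * A]/(A *m A) CH scaler_nat.
  by apply/eqP; rewrite mulr2n subr_eq0 addrAC addrK.
have powE k : A ^+ k = 1 + (A - 1) *+ k.
  elim: k => [|k IH]; first by rewrite mulr0n addr0.
  rewrite exprSr IH -{2}[A](subrK 1) mulrDr mulr1 mulrDl mul1r mulrnAl N2 mul0rn addr0.
  by rewrite mulrS addrCA addrA.
have := powE n.+1; rewrite An => /esym/eqP; rewrite -[X in _ == X]addr0 (inj_eq (addrI 1)).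
rewrite -scaler_nat scaler_eq0 pnatr_eq0 /= subr_eq0 => /eqP //.
Qed.

(** Such a matrix has eigenvalues 1 and -1: it encodes an ordered pair of distinct lines, and its
    opposite the reversed pair. *)
Definition axis Q := (\tr Q == 0) && (Q *m Q == 1%:M).

Lemma axis_opp Q : axis (- Q) = axis Q.
Proof. by rewrite /axis raddfN oppr_eq0 mulNmx mulmxN opprK. Qed.

(** By the polarised Cayley-Hamilton identity, the product of two commuting traceless matrices is
    scalar; so Q' is a multiple of Q. *)
Lemma axis_commute Q Q' : axis Q -> axis Q' -> Q *m Q' = Q' *m Q -> Q' = Q \/ Q' = - Q.
Proof.
move=> /andP[/eqP tQ /eqP QQ] /andP[/eqP tQ' /eqP QQ'] QC.
have := traceless_anticomm tQ tQ'; rewrite -QC -mulr2n => E.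
pose c := \tr (Q *m Q') / 2.
have {}E : Q *m Q' = c%:M.
  have half X : X = 2^-1 *: (X *+ 2) :> 'M[C]_2.
    by rewrite -scaler_nat scalerA mulVf ?scale1r // pnatr_eq0.
  by rewrite [LHS]half E scale_scalar_mx mulrC.
have Q'E : Q' = c *: Q by rewrite -[LHS]mul1mx -QQ -mulmxA E mul_mx_scalar.
have c2 : c ^+ 2 = 1.
  move: QQ'; rewrite Q'E -scalemxAl -scalemxAr scalerA QQ scalemx1 -expr2.
  by move/matrixP/(_ 0 0); rewrite !mxE.
by rewrite Q'E; have /eqP := c2; rewrite sqrf_eq1 => /orP[]/eqP->;
  rewrite ?scale1r ?scaleN1r; [left|right].
Qed.

Definition dmx (x y : C) : 'M[C]_2 := \matrix_(i, j) (if i == j then if i == 0 then x else y else 0).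

Lemma dmx_mul x y x' y' : dmx x y *m dmx x' y' = dmx (x * x') (y * y').
Proof. by apply: mx2P; rewrite mul_mx2 !mxE /= ?(mul0r, mulr0, addr0, add0r). Qed.

Lemma det_dmx x y : \det (dmx x y) = x * y.
Proof. by rewrite det_mx2 !mxE /= mul0r subr0. Qed.

(** The rows of P are left eigenvectors, taken from the rows of 1 + Q and 1 - Q: the first ones if y
    is not 0, else the second ones if z is not 0. Dividing one row by the determinant gives
    determinant 1. *)
Lemma diagonalize_axis Q : axis Q ->
  exists2 P : 'M[C]_2, \det P = 1 & P *m Q = dmx 1 (-1) *m P.
Proof.
move=> /andP[/eqP]; rewrite mxtrace2 => /eqP; rewrite addrC addr_eq0 => /eqP tQ /eqP QQ.
set x := Q 0 0 in tQ *; set y := Q 0 1; set z := Q 1 0.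
have xyz : x * x + y * z = 1.
  by have := congr1 (fun M : 'M[C]_2 => M 0 0) QQ; rewrite mul_mx2 mxE.
have build (p11 p12 p21 p22 : C) : p11 * p22 - p12 * p21 != 0 ->
    p11 * x + p12 * z = p11 -> p11 * y - p12 * x = p12 ->
    p21 * x + p22 * z = - p21 -> p21 * y - p22 * x = - p22 ->
    exists2 P : 'M[C]_2, \det P = 1 & P *m Q = dmx 1 (-1) *m P.
  set D := p11 * p22 - _ => D0 e1 e2 e3 e4.
  exists (\matrix_(i, j) (if i == 0 then if j == 0 then D^-1 * p11 else D^-1 * p12
     else if j == 0 then p21 else p22)).
    by rewrite det_mx2 !mxE /= -!mulrA -mulrBr mulVf.
  apply: mx2P; rewrite !mul_mx2 !mxE /= ?tQ -/x -/y -/z ?mul0r ?addr0 ?add0r ?mul1r ?mulN1r.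
  - by rewrite -{2}e1; ring.
  - by rewrite -{2}e2; ring.
  - exact: e3.
  - by rewrite mulrN e4.
have [y0|y0] := eqVneq y 0; last first.
  apply: (build (1 + x) y (1 - x) (- y)).
  - rewrite (_ : _ - _ = - 2 * y); last by ring.
    by rewrite mulf_neq0 // oppr_eq0 pnatr_eq0.
  - by rewrite -[X in _ + X](addKr (x * x)) xyz; ring.
  - by ring.
  - by rewrite mulNr -[X in _ - X](addKr (x * x)) xyz; ring.
  - by ring.
have [z0|z0] := eqVneq z 0; last first.
  apply: (build z (1 - x) (- z) (1 + x)).
  - rewrite (_ : _ - _ = 2 * z); last by ring.
    by rewrite mulf_neq0 // pnatr_eq0.
  - by ring.
  - by rewrite -[z * y](addKr (x * x)) [z * y]mulrC xyz; ring.
  - by ring.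
  - by rewrite mulNr -[z * y](addKr (x * x)) [z * y]mulrC xyz; ring.
move: xyz; rewrite y0 mul0r addr0 -expr2 => /eqP; rewrite sqrf_eq1 => /orP[]/eqP x1.
  by apply: (build 1 0 0 1); rewrite ?x1 ?y0 ?z0 ?(mul0r, mulr0, subr0, addr0, oner_eq0, mul1r, mulr1, add0r, sub0r) ?oppr0.
by apply: (build 0 1 (-1) 0); rewrite ?x1 ?y0 ?z0 ?(mul0r, mulr0, subr0, addr0, oner_eq0, mul1r, mulr1, add0r, sub0r, mulrN1, opprK, oppr0) ?oner_eq0.
Qed.

Lemma commute_dmx A : A *m dmx 1 (-1) = dmx 1 (-1) *m A -> A = dmx (A 0 0) (A 1 1).
Proof.
move=> E; have e01 := congr1 (fun M : 'M[C]_2 => M 0 1) E.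
have e10 := congr1 (fun M : 'M[C]_2 => M 1 0) E.
move: e01 e10; rewrite !mul_mx2 !mxE /= !(mul0r, mulr0, add0r, addr0, mul1r, mulr1, mulN1r, mulrN1).
move=> /esym/eqP; rewrite -addr_eq0 -mulr2n mulrn_eq0 /= => /eqP e01.
move=> /eqP; rewrite -addr_eq0 -mulr2n mulrn_eq0 /= => /eqP e10.
by apply: mx2P; rewrite !mxE.
Qed.

Lemma anticommute_dmx A : A *m dmx 1 (-1) = - (dmx 1 (-1) *m A) -> A 0 0 = 0 /\ A 1 1 = 0.
Proof.
move=> /eqP; rewrite -addr_eq0 => /eqP E.
have addE X Y i j : (X + Y : 'M[C]_2) i j = X i j + Y i j by rewrite mxE.
have e00 := congr1 (fun M : 'M[C]_2 => M 0 0) E; have e11 := congr1 (fun M : 'M[C]_2 => M 1 1) E.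
move: e00 e11; rewrite !addE !mul_mx2 !mxE /=.
rewrite !(mul0r, mulr0, add0r, addr0, mul1r, mulr1, mulN1r, mulrN1) -opprD -!mulr2n.
by move=> /eqP; rewrite mulrn_eq0 /= => /eqP -> /eqP; rewrite oppr_eq0 mulrn_eq0 /= => /eqP ->.
Qed.

(** By Cayley-Hamilton the traceless part of A has square t^2 / 4 - 1, nonzero exactly when t is not
    2 or -2; [Q] is this part divided by a square root. *)
Lemma axis_of_noncentral A : \det A = 1 -> \tr A != 2 -> \tr A != -2 ->
  exists2 Q, axis Q & exists2 s, s != 0 & A = (\tr A / 2)%:M + s *: Q.
Proof.
move=> dA t2 tN2; set t := \tr A.
pose s := sqrtC (t ^+ 2 / 4 - 1).
have s2 : s ^+ 2 = t ^+ 2 / 4 - 1 by rewrite sqrtCK.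
have s0 : s != 0.
  rewrite -sqrf_eq0 s2; have -> : t ^+ 2 / 4 - 1 = (t - 2) * (t + 2) / 4 :> C by field.
  by rewrite !mulf_neq0 ?invr_eq0 ?pnatr_eq0 // ?subr_eq0 // addr_eq0.
exists (s^-1 *: (A - (t / 2)%:M)); last first.
  exists s; rewrite // scalerA mulfV // scale1r addrC subrK //.
have tE : t = A 0 0 + A 1 1 by rewrite /t mxtrace2.
apply/andP; split.
  by rewrite linearZ /= mxtrace2 !mxE /= tE; apply/eqP; field.
rewrite -scalemxAl -scalemxAr scalerA -invfM -expr2 s2.
have BB : (A - (t / 2)%:M) *m (A - (t / 2)%:M) = (t ^+ 2 / 4 - \det A)%:M.
  by rewrite det_mx2; apply: mx2P; rewrite mul_mx2 !mxE /= tE; field.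
by rewrite BB dA scale_scalar_mx mulVf // -s2 sqrf_eq0.
Qed.

End Matrices.

(** * Poles of a finite group *)

Record sl2_rep (C : numClosedFieldType) (gT : finGroupType) (r : gT -> 'M[C]_2) : Prop :=
  Sl2Rep { repM : forall x y, r (x * y)%g = r x *m r y;
           rep_inj : injective r;
           rep_det : forall x, \det (r x) = 1 }.

Section Rep.
Variables (C : numClosedFieldType) (gT : finGroupType) (r : gT -> 'M[C]_2).
Hypothesis rP : sl2_rep r.
Implicit Types (x y g : gT) (Q : 'M[C]_2).

Lemma rep_unit x : r x \in unitmx.
Proof. by rewrite unitmxE (rep_det rP) unitr1. Qed.

Lemma rep1 : r 1%g = 1%:M.
Proof.
by rewrite -[LHS](mulmxK (rep_unit 1%g)) -(repM rP) mulg1 mulmxV // rep_unit.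
Qed.

Lemma repV x : r x^-1%g = invmx (r x).
Proof.
by rewrite -[LHS](mulmxK (rep_unit x)) -(repM rP) mulVg rep1 mul1mx.
Qed.

Lemma repX x n : r (x ^+ n)%g = r x ^+ n.
Proof.
elim: n => [|n IH]; first exact: rep1.
by rewrite expgS (repM rP) IH exprS.
Qed.

Lemma rep_order x : r x ^+ #[x]%g = 1.
Proof. by rewrite -repX expg_order rep1. Qed.

Lemma rep_trace2 x : \tr (r x) = 2 -> r x = 1%:M.
Proof.
move=> tx; apply: (@unipotent_mx2 _ (r x) #[x]%g.-1) => //; first exact: (rep_det rP).
by rewrite prednK ?order_gt0 // rep_order.
Qed.

(** Central in SL_2; for a cyclic group this may be a proper part of the centre of the group
    itself. *)
Definition central x := (r x == 1%:M) || (r x == - 1%:M).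

Lemma rep_traceN2 x : \tr (r x) = - 2 -> r x = - 1%:M.
Proof.
move=> tx; apply: oppr_inj; rewrite opprK.
apply: (@unipotent_mx2 _ _ (2 * #[x]%g).-1).
- by rewrite -scaleN1r detZ (rep_det rP) mulr1 expr2 mulrNN mulr1.
- by rewrite raddfN /= tx opprK.
- rewrite prednK ?muln_gt0 ?order_gt0 // exprM expr2 mulrNN -expr2 -exprM mulnC exprM.
  by rewrite rep_order expr1n.
Qed.

Lemma axis_exists x : ~~ central x ->
  exists2 Q, axis Q & exists2 s, s != 0 & r x = (\tr (r x) / 2)%:M + s *: Q.
Proof.
rewrite /central negb_or => /andP[x1 xN1]; apply: axis_of_noncentral.
- exact: (rep_det rP).
- by apply: contraNneq x1 => /rep_trace2->.
- by apply: contraNneq xN1 => /rep_traceN2->.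
Qed.

Definition stab Q := [set g | r g *m Q == Q *m r g].

Lemma stab_group_set Q : group_set (stab Q).
Proof.
apply/group_setP; split=> [|x y]; rewrite !inE; first by rewrite rep1 mul1mx mulmx1.
by move=> /eqP xQ /eqP yQ; rewrite (repM rP) -mulmxA yQ mulmxA xQ mulmxA.
Qed.
Definition stab_group Q := Group (stab_group_set Q).

Lemma stab_opp Q : stab (- Q) = stab Q.
Proof. by apply/setP => g; rewrite !inE mulmxN mulNmx eqr_opp. Qed.

Lemma stab_axis g Q : ~~ central g -> axis Q -> g \in stab Q ->
  exists2 s, s != 0 & r g = (\tr (r g) / 2)%:M + s *: Q.
Proof.
move=> cg aQ; rewrite inE => /eqP gQ; have [Q' aQ' [s s0 gE]] := axis_exists cg.
have QC : Q *m Q' = Q' *m Q.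
  move: gQ; rewrite gE mulmxDl mulmxDr mul_scalar_mx mul_mx_scalar => /addrI.
  by rewrite -scalemxAl -scalemxAr => /(scalerI s0).
have [Q'E|Q'E] := axis_commute aQ aQ' QC; first by exists s; rewrite // -Q'E.
by exists (- s); rewrite ?oppr_eq0 // scaleNr -scalerN -Q'E.
Qed.

Definition is_pole Q := axis Q && [exists g, ~~ central g && (g \in stab Q)].

Let q_of g : 'M[C]_2 := if pselect (exists2 Q, axis Q & g \in stab Q) is left e
  then s2val (cid2 e) else 0.
Let q_ofP g : ~~ central g -> axis (q_of g) /\ g \in stab (q_of g).
Proof.
move=> cg; rewrite /q_of; case: pselect => [e|[]]; first by case: cid2.
have [Q aQ [s _ gE]] := axis_exists cg; exists Q; rewrite // inE gE.
by rewrite mulmxDl mulmxDr mul_scalar_mx mul_mx_scalar -scalemxAl -scalemxAr.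
Qed.

(** Finite by construction: one chosen axis for each noncentral element, and its opposite. By
    [axis_same] nothing is missed. *)
Definition poles : {fset 'M[C]_2} :=
  ([fset q_of g | g in [pred g | ~~ central g]] `|`
   [fset - q_of g | g in [pred g | ~~ central g]])%fset.

Lemma axis_same g Q Q' : ~~ central g -> axis Q -> axis Q' -> g \in stab Q -> g \in stab Q' ->
  Q' = Q \/ Q' = - Q.
Proof.
move=> cg aQ aQ' gQ; rewrite inE => /eqP gQ'; apply: axis_commute => //.
have [s s0 gE] := stab_axis cg aQ gQ; move: gQ'.
rewrite gE mulmxDl mulmxDr mul_scalar_mx mul_mx_scalar => /addrI.
by rewrite -scalemxAl -scalemxAr => /(scalerI s0).
Qed.

Lemma polesP Q : (Q \in poles) = is_pole Q.
Proof.
apply/idP/idP => [/fsetUP[]/imfsetP[g /= cg ->]|/andP[aQ /existsP[g /andP[cg gQ]]]].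
- have [aq gq] := q_ofP cg; rewrite /is_pole aq; apply/existsP; exists g.
  by rewrite gq andbT.
- have [aq gq] := q_ofP cg; rewrite /is_pole axis_opp aq stab_opp; apply/existsP; exists g.
  by rewrite gq andbT.
have [aq gq] := q_ofP cg; apply/fsetUP.
by have [->|->] := axis_same cg aq aQ gq gQ; [left|right]; apply/imfsetP; exists g.
Qed.

(** A right action, matching [g ^ x]. *)
Definition conjm x Q := r x^-1%g *m Q *m r x.

Lemma conjmM x y Q : conjm (x * y) Q = conjm y (conjm x Q).
Proof. by rewrite /conjm invMg !(repM rP) !mulmxA. Qed.

Lemma conjm1 Q : conjm 1 Q = Q.
Proof. by rewrite /conjm invg1 rep1 mul1mx mulmx1. Qed.

Lemma conjm_mul x A B : conjm x A *m conjm x B = conjm x (A *m B).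
Proof.
by rewrite /conjm !mulmxA -[_ *m r x *m _]mulmxA -(repM rP) mulgV rep1 mulmx1.
Qed.

Lemma repJ g x : r (g ^ x)%g = conjm x (r g).
Proof. by rewrite conjgE !(repM rP) mulmxA. Qed.

Lemma conjm_stab x g Q : g \in stab Q -> (g ^ x)%g \in stab (conjm x Q).
Proof. by rewrite !inE repJ !conjm_mul => /eqP->. Qed.

Lemma conjm_axis x Q : axis Q -> axis (conjm x Q).
Proof.
move=> /andP[/eqP tQ /eqP QQ]; apply/andP; split.
  by rewrite /conjm mxtrace_mulC mulmxA -(repM rP) mulgV rep1 mul1mx tQ.
by rewrite conjm_mul QQ /conjm mulmx1 -(repM rP) mulVg rep1.
Qed.

Lemma centralJ g x : central g -> central (g ^ x)%g.
Proof.
have Vx : r x^-1%g *m r x = 1%:M by rewrite -(repM rP) mulVg rep1.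
rewrite /central !repJ /conjm => /orP[]/eqP->; first by rewrite mulmx1 Vx eqxx.
by rewrite mulmxN mulmx1 mulNmx Vx eqxx orbT.
Qed.

Lemma conjm_pole x Q : is_pole Q -> is_pole (conjm x Q).
Proof.
move=> /andP[aQ /existsP[g /andP[cg gQ]]]; rewrite /is_pole conjm_axis //.
apply/existsP; exists (g ^ x)%g; rewrite conjm_stab // andbT.
by apply: contra cg => /centralJ-/(_ x^-1%g); rewrite conjgK.
Qed.

Lemma conjm_poles x (Q : poles) : conjm x (val Q) \in poles.
Proof. by rewrite polesP conjm_pole // -polesP (valP Q). Qed.
Definition to_pole (Q : poles) x : poles := [` conjm_poles x Q]%fset.

Lemma to_pole1 (Q : poles) : to_pole Q 1%g = Q.
Proof. by apply: val_inj; rewrite /= conjm1. Qed.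
Lemma to_poleM (Q : poles) x y : to_pole Q (x * y)%g = to_pole (to_pole Q x) y.
Proof. by apply: val_inj; rewrite /= conjmM. Qed.
Definition pole_action := TotalAction to_pole1 to_poleM.

Lemma fix_pole x (Q : poles) : (to_pole Q x == Q) = (x \in stab (val Q)).
Proof.
rewrite -val_eqE /= inE /conjm; have xV : r x *m r x^-1%g = 1%:M.
  by rewrite -(repM rP) mulgV rep1.
have Vx : r x^-1%g *m r x = 1%:M by rewrite -(repM rP) mulVg rep1.
apply/eqP/eqP => [E|E]; first by rewrite -{1}E !mulmxA xV mul1mx.
by rewrite -mulmxA -E mulmxA Vx mul1mx.
Qed.

Lemma stab_astab (Q : poles) : 'C[Q | pole_action]%g = stab (val Q).
Proof. by apply/setP => x; rewrite -fix_pole; apply/astab1P/eqP. Qed.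

Definition center_set := [set x | central x].

Lemma center_stab Q : center_set \subset stab Q.
Proof.
apply/subsetP => x; rewrite !inE => /orP[]/eqP->; first by rewrite mul1mx mulmx1.
by rewrite mulNmx mulmxN mul1mx mulmx1.
Qed.

Lemma center_group_set : group_set center_set.
Proof.
apply/group_setP; split=> [|x y]; rewrite !inE /central ?rep1 ?eqxx // (repM rP).
by move=> /orP[]/eqP-> /orP[]/eqP->; rewrite ?(mulNmx, mulmxN, mul1mx, opprK) eqxx ?orbT.
Qed.

Lemma card_fix x : x \notin center_set -> #|'Fix_pole_action[x]%g| = 2%N.
Proof.
rewrite inE => cx; have [aq xq] := q_ofP cx.
have q0 : q_of x != - q_of x.
  apply/eqP => qN; have /andP[_ /eqP] := aq; have /eqP: q_of x + q_of x = 0.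
    by rewrite {1}qN addNr.
  rewrite -mulr2n -scaler_nat scaler_eq0 pnatr_eq0 /= => /eqP->.
  by move=> /matrixP/(_ 0 0)/eqP; rewrite mul0mx !mxE eq_sym oner_eq0.
have i1 : q_of x \in poles.
  by rewrite polesP /is_pole aq; apply/existsP; exists x; rewrite xq cx.
have i2 : - q_of x \in poles.
  by rewrite polesP /is_pole axis_opp aq; apply/existsP; exists x; rewrite stab_opp xq cx.
have -> : 'Fix_pole_action[x]%g = [set [` i1]%fset; [` i2]%fset].
  apply/setP => Q; apply/afix1P/set2P => [/eqP|].
    rewrite fix_pole => xQ; have := valP Q; rewrite polesP => /andP[aQ _].
    have [E|E] := axis_same cx aq aQ xq xQ; [left|right]; exact: val_inj.
  by case=> ->; apply/eqP; rewrite fix_pole /= ?stab_opp.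
by rewrite cards2 -val_eqE /= q0.
Qed.

Lemma card_fix_center x : x \in center_set -> #|'Fix_pole_action[x]%g| = #|{: poles}|.
Proof.
move=> xZ; rewrite -cardsT; congr #|pred_of_set _|; apply/setP => Q; rewrite [RHS]in_setT.
apply/afix1P/eqP; rewrite fix_pole.
exact: (subsetP (center_stab _)).
Qed.

Definition pole_orbits := [set orbit pole_action [set: gT] Q | Q in [set: poles]]%g.

(** Count fixed points: two for each noncentral element, all poles for each central one. *)
Lemma pole_orbit_equation :
  (2 * (#|gT| - #|center_set|) + #|center_set| * #|{: poles}| = #|pole_orbits| * #|gT|)%N.
Proof.
have := @Frobenius_Cauchy _ _ _ pole_action [set: gT]%G [set: poles].
have -> : [acts [set: gT]%G, on [set: poles] | pole_action]%g.
  by apply/actsP => x _ Q; rewrite !inE.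
move=> /(_ isT); rewrite cardsT => <-.
rewrite (bigID (mem center_set)) /= addnC; congr (_ + _)%N.
  rewrite (eq_bigr (fun=> #|{: poles}|)) => [|x /andP[_ xZ]]; last first.
    by rewrite setTI card_fix_center.
  rewrite sum_nat_const; congr (_ * _)%N; apply: eq_card => x; by rewrite [RHS]unfold_in in_setT.
rewrite (eq_bigr (fun=> 2%N)) => [|x /andP[_ xZ]]; last by rewrite setTI card_fix.
rewrite sum_nat_const mulnC; congr (_ * _)%N.
rewrite -(cardC (mem center_set)) addKn; apply: eq_card => x; by rewrite [RHS]unfold_in in_setT.
Qed.

Lemma pole_orbitsP X : X \in pole_orbits ->
  exists2 Q, axis Q & (#|X| * #|stab Q| = #|gT|)%N /\
   exists2 g, ~~ central g & g \in stab Q.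
Proof.
case/imsetP => Q _ ->; have := valP Q; rewrite polesP => /andP[aQ /existsP[g /andP[cg gQ]]].
exists (val Q) => //; split; last by exists g.
have := card_orbit_stab pole_action [set: gT]%G Q.
by rewrite cardsT setTI stab_astab.
Qed.

Lemma noncentral_stab g : ~~ central g ->
  exists2 X, X \in pole_orbits &
    exists2 Q, axis Q & g \in stab Q /\ (#|X| * #|stab Q| = #|gT|)%N.
Proof.
move=> cg; have [aq gq] := q_ofP cg.
have i1 : q_of g \in poles.
  by rewrite polesP /is_pole aq; apply/existsP; exists g; rewrite gq cg.
exists (orbit pole_action [set: gT] [` i1]%fset)%g; first exact: imset_f.
exists (q_of g) => //; split=> //.
have := card_orbit_stab pole_action [set: gT]%G [` i1]%fset.
by rewrite cardsT setTI stab_astab.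
Qed.

Lemma sum_pole_orbits : (\sum_(X in pole_orbits) #|X| = #|{: poles}|)%N.
Proof.
have := @acts_sum_card_orbit _ _ _ pole_action [set: gT]%G [set: poles].
have -> : [acts [set: gT]%G, on [set: poles] | pole_action]%g.
  by apply/actsP => x _ Q; rewrite !inE.
by move=> /(_ isT); rewrite cardsT.
Qed.
End Rep.

(** * Counting the orbits of poles *)

Section Arith.
Local Open Scope nat_scope.

(** [M] is the order of the group; 4, 2 e2 and 2 e3 are the orders of the stabilisers. The four
    cases are binary dihedral, tetrahedral, octahedral and icosahedral. *)
Definition polyhedral_type (e2 e3 M : nat) :=
  [\/ e2 = 2 /\ 1 < e3 /\ M = 4 * e3, [/\ e2 = 3, e3 = 3 & M = 24],
     [/\ e2 = 3, e3 = 4 & M = 48] | [/\ e2 = 3, e3 = 5 & M = 120]].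

(** As k_i = m / e_i, the last hypothesis reads 1/e1 + 1/e2 + 1/e3 = 1 + 2/m, the classical
    inequality of spherical triangles. *)
Lemma three_orbits m k1 k2 k3 e1 e2 e3 :
  k1 * e1 = m -> k2 * e2 = m -> k3 * e3 = m -> 1 < e1 -> 1 < e2 -> 1 < e3 ->
  k2 <= k1 -> k3 <= k2 -> k1 + (k2 + k3) = m + 2 -> e1 = 2 /\ polyhedral_type e2 e3 (2 * m).
Proof.
move=> m1 m2 m3 g1 g2 g3 k21 k32 sum.
have e1E : e1 = 2.
  suff : e1 < 3 by lia.
  by rewrite ltnNge; apply/negP => e1_3; have := leq_mul (leqnn k1) e1_3; lia.
split=> //; subst e1.
have : e2 < 4.
  by rewrite ltnNge; apply/negP => e2_4; have := leq_mul (leqnn k2) e2_4; lia.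
have : e2 = 3 -> e3 < 6.
  move=> E; subst e2; rewrite ltnNge; apply/negP => e3_6.
  by have := leq_mul (leqnn k3) e3_6; lia.
move=> e3_6; case: e2 g2 m2 e3_6 => [|[|[|[|//]]]] // _ m2 e3_6 _.
  have k3E : k3 = 2 by lia.
  by subst k3; constructor 1; lia.
move: (e3_6 erefl); case: e3 g3 m3 {e3_6} => [|[|[|[|[|[|//]]]]]] // _ m3 _.
- lia.
- by constructor 2; split=> //; lia.
- by constructor 3; split=> //; lia.
- by constructor 4; split=> //; lia.
Qed.

End Arith.

Section Classes.
Variables (C : numClosedFieldType) (gT : finGroupType) (r : gT -> 'M[C]_2).
Hypothesis rP : sl2_rep r.
Implicit Types (x y g : gT) (Q : 'M[C]_2).

Definition center_group := Group (center_group_set rP).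

Lemma card_center_le2 : (#|center_set r| <= 2)%N.
Proof.
case: (pickP [pred z | r z == - 1%:M]) => [z /eqP rz|none].
  apply: leq_trans (_ : #|[set 1%g; z]| <= 2)%N; last by rewrite cards2; case: eqP.
  apply/subset_leq_card/subsetP => x; rewrite !inE -!(inj_eq (rep_inj rP)) (rep1 rP) rz.
  by [].
apply: leq_trans (_ : #|[set 1%g : gT]| <= 2)%N; last by rewrite cards1.
apply/subset_leq_card/subsetP => x; rewrite !inE -!(inj_eq (rep_inj rP)) (rep1 rP) /central.
by have /= -> := none x; rewrite orbF.
Qed.

(** An element of order 2 in SL_2 is -1: Cayley-Hamilton turns z^2 = 1 into tr(z) z = 2, so z is
    scalar. *)
Lemma card_center_even : (2 %| #|gT|)%N -> #|center_set r| = 2%N.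
Proof.
move=> N2; have [z zG z2] := @Cauchy _ 2 [set: gT]%G isT (etrans (congr1 _ (cardsT _)) N2).
have cz : z \in center_set r /\ r z != 1%:M.
  have zz : r z *m r z = 1%:M.
    have /eqP : (z ^+ 2 == 1)%g by rewrite -order_dvdn z2.
    by rewrite -(repM rP) expgS expg1 => ->; exact: rep1.
  have z1 : r z != 1%:M.
    by rewrite -(rep1 rP) (inj_eq (rep_inj rP)) -order_eq1 z2.
  split=> //; rewrite inE /central.
  have := cayley_hamilton2 (r z); rewrite zz (rep_det rP) => /eqP.
  rewrite eq_sym subr_eq => /eqP E.
  have t0 : \tr (r z) != 0.
    apply/eqP => t0; move: E; rewrite t0 scale0r => /matrixP/(_ 0 0)/eqP.
    by rewrite !mxE -mulr2n eq_sym pnatr_eq0.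
  have rz : r z = (2 / \tr (r z))%:M.
    apply: (scalerI t0); rewrite E scale_scalar_mx mulrC mulfVK //.
    by rewrite -raddfD.
  move: rz zz; move: (2 / _) => y ->.
  rewrite mul_scalar_mx scale_scalar_mx => /matrixP/(_ 0 0).
  rewrite !mxE /= -expr2 => /eqP; rewrite sqrf_eq1 => /orP[]/eqP->.
    by rewrite eqxx.
  by rewrite raddfN eqxx orbT.
have [cz1 /negPf z1] := cz.
rewrite (_ : center_set r = [set 1%g; z]); first by rewrite cards2 -(inj_eq (rep_inj rP)) (rep1 rP) eq_sym z1.
apply/setP => x; rewrite !inE /central -!(inj_eq (rep_inj rP)) (rep1 rP).
by move: cz1; rewrite inE /central z1 /= => /eqP->.
Qed.

Lemma pole_orbit_stab X : X \in pole_orbits rP -> exists2 e,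
  (1 < e)%N & exists2 Q, axis Q & (#|X| * #|stab r Q| = #|gT|)%N /\ (#|stab r Q| = #|center_set r| * e)%N.
Proof.
case/pole_orbitsP => Q aQ [cardX [g cg gQ]].
have sZ : center_group \subset stab_group rP Q := center_stab _ _.
exists #|stab_group rP Q : center_group|%g.
  rewrite indexg_gt1; apply/subsetPn; exists g => //; by rewrite inE.
by exists Q => //; split=> //; rewrite -[LHS](Lagrange sZ).
Qed.

Lemma sl2_rep_type :
  (exists2 Q, axis Q & stab r Q = [set: gT]) \/
  #|center_set r| = 2%N /\ exists e2 e3, [/\ polyhedral_type e2 e3 #|gT|,
    forall e : nat, e \in [:: 2%N; e2; e3] -> exists2 Q, axis Q & #|stab r Q| = (2 * e)%N
  & forall g, ~~ central r g -> exists2 e : nat, e \in [:: 2%N; e2; e3] &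
    exists2 Q, axis Q & g \in stab r Q /\ #|stab r Q| = (2 * e)%N].
Proof.
set c := #|center_set r|.
have c0 : (0 < c)%N := cardG_gt0 center_group.
pose m := #|[set: gT] : center_group|%g.
have NE : #|gT| = (c * m)%N by rewrite -cardsT -(Lagrange (subsetT center_group)).
have m0 : (0 < m)%N by apply: indexg_gt0.
pose s := sort (fun X Y : {set poles r} => #|Y| <= #|X|)%N (enum (pole_orbits rP)).
have ms X : (X \in s) = (X \in pole_orbits rP) by rewrite mem_sort mem_enum.
have sP X : X \in s -> exists2 e, (1 < e)%N & (#|X| * e = m)%N /\
    exists2 Q, axis Q & (#|stab r Q| = c * e)%N.
  rewrite ms => /pole_orbit_stab[e e1 [Q aQ [XQ Qe]]]; exists e => //; split; last by exists Q.
  by apply/eqP; rewrite -(eqn_pmul2l c0) mulnCA -Qe XQ NE.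
(* The orbit equation divided by the number of central elements. *)
have eqn : (2 * (m - 1) + \sum_(X <- s) #|X| = size s * m)%N.
  have sumE : (\sum_(X <- s) #|X| = \sum_(X in pole_orbits rP) #|X|)%N.
    by rewrite -[RHS]big_enum; apply: perm_big; exact: (permEl (perm_sort _ _)).
  have := pole_orbit_equation rP; rewrite -sum_pole_orbits -sumE -/c NE.
  rewrite size_sort -cardE => E.
  apply/eqP; rewrite -(eqn_pmul2l c0); apply/eqP.
  by rewrite mulnDr mulnCA mulnBr muln1 E mulnCA.
have srt : sorted (fun X Y : {set poles r} => #|Y| <= #|X|)%N s.
  by apply: sort_sorted => X Y; apply: leq_total.
have small X : X \in s -> (0 < #|X| /\ 2 * #|X| <= m)%N.
  case/sP => e e1 [XE _]; split; first by rewrite lt0n; apply: contraTneq m0 => X0; rewrite -XE X0.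
  by rewrite -XE mulnC leq_mul2l e1 orbT.
(* Every orbit has at most m / 2 poles. A single orbit would have 2 - m poles, which is impossible;
   n >= 4 orbits would need (n - 2) m + 2 poles, more than n m / 2. *)
have done0 : (size s = 0 \/ size s = 2 \/ size s = 3)%N.
  case: s eqn small {ms sP srt} => [|X1 [|X2 [|X3 s]]]; [by left|rewrite !big_cons !big_nil| by right; left|].
    by move=> /= E /(_ _ (mem_head _ _)); lia.
  case: s => [|X4 s]; first by right; right.
  move=> E S; suff : (2 * \sum_(X <- [:: X1, X2, X3, X4 & s]) #|X| <= size [:: X1, X2, X3, X4 & s] * m)%N.
    rewrite /= in E *; have : (4 * m <= (size s).+4 * m)%N by rewrite leq_mul2r orbT.
    by move: E m0; move: ((size s).+4 * m)%N (\sum_(_ <- _) _)%N => u z; lia.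
  rewrite big_distrr /= big_seq_cond -[leqRHS]/(size [:: X1, X2, X3, X4 & s] * m)%N -sum1_size big_distrl /= [leqRHS]big_seq_cond.
  by apply: leq_sum => X; rewrite andbT mul1n => /S[].
case: done0 => [|[|]].
- move/size0nil => s0; left.
  have Z g : central r g.
    apply/negPn/negP => cg; have [X] := noncentral_stab rP cg.
    by rewrite -ms s0.
  (* Without poles every element is 1 or -1, and any axis is stabilised. *)
  exists (dmx 1 (-1)).
    rewrite /axis mxtrace2 dmx_mul !mxE /= subrr eqxx mulrNN !mulr1 /=.
    by apply/eqP; apply: mx2P; rewrite !mxE.
  by apply/setP => g; rewrite [RHS]inE; apply: (subsetP (center_stab r _)); rewrite inE.
(* Two orbits contain two poles in all, so each is a single pole, fixed by the whole group. *)
- case: s eqn small {srt} sP ms => [|X1 [|X2 [|//]]] //; rewrite !big_cons big_nil /=.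
  move=> E S sP ms _; left; have [X1P] := S X1 (mem_head _ _).
  have [X2P _ _] : (0 < #|X2| /\ 2 * #|X2| <= m)%N by apply: S; rewrite !inE eqxx orbT.
  have X1E : #|X1| = 1%N.
    by move: #|X1| #|X2| (m) m0 E X1P X2P => n1 n2 n; clear; lia.
  have /pole_orbitsP[Q aQ [XQ _]] : X1 \in pole_orbits rP by rewrite -ms mem_head.
  exists Q => //; apply/eqP; rewrite eqEcard subsetT cardsT -XQ X1E mul1n leqnn //.
- case: s eqn small srt sP ms => [|X1 [|X2 [|X3 [|//]]]] //; rewrite !big_cons big_nil /=.
  move=> E S /and3P[X21 X32 _] sP ms _; right.
  have [e1 g1 [m1 Q1]] := sP X1 ltac:(by rewrite !inE eqxx).
  have [e2 g2 [m2 Q2]] := sP X2 ltac:(by rewrite !inE eqxx orbT).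
  have [e3 g3 [m3 Q3]] := sP X3 ltac:(by rewrite !inE eqxx !orbT).
  have sumE : (#|X1| + (#|X2| + #|X3|) = m + 2)%N.
    by move: #|X1| #|X2| #|X3| (m) m0 E => n1 n2 n3 n; clear; lia.
  have [e1E typ] := three_orbits m1 m2 m3 g1 g2 g3 X21 X32 sumE.
  have c2 : c = 2%N.
    by apply: card_center_even; rewrite NE -m1 e1E !dvdn_mull.
  rewrite c2; split=> //; rewrite c2 e1E in NE Q1 Q2 Q3 *.
  exists e2, e3; rewrite NE; split=> //.
    by move=> e; rewrite !inE => /or3P[]/eqP->.
  move=> g /(noncentral_stab rP)[X XO [Q aQ [gQ XQ]]].
  have eX e : (#|X| * e = m -> 0 < #|X| -> #|stab r Q| = 2 * e)%N.
    by move=> Xe X0; apply/eqP; rewrite -(eqn_pmul2l X0) mulnCA Xe XQ NE.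
  rewrite e1E in m1; have [X1P _] := S X1 ltac:(by rewrite !inE eqxx).
  have [X2P _] := S X2 ltac:(by rewrite !inE eqxx orbT).
  have [X3P _] := S X3 ltac:(by rewrite !inE eqxx !orbT).
  move: XO; rewrite -ms !inE => /or3P[]/eqP XE; subst X.
  - by exists 2%N; rewrite ?inE //; exists Q => //; split=> //; apply: eX.
  - by exists e2; rewrite ?inE ?eqxx ?orbT //; exists Q => //; split=> //; apply: eX.
  - by exists e3; rewrite ?inE ?eqxx ?orbT //; exists Q => //; split=> //; apply: eX.
Qed.
End Classes.

(** * Conjugation to diagonal and dihedral normal forms *)

Definition conj_rep (C : numClosedFieldType) (gT : Type) (r r' : gT -> 'M[C]_2) :=
  exists2 P : 'M[C]_2, \det P = 1 & forall g, r' g = P *m r g *m invmx P.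

Lemma conj_rep_refl (C : numClosedFieldType) (gT : Type) (r : gT -> 'M[C]_2) : conj_rep r r.
Proof. by exists 1%:M => [|g]; rewrite ?det1 // invmx1 mul1mx mulmx1. Qed.

Lemma conj_rep_trans (C : numClosedFieldType) (gT : Type) (r r' r'' : gT -> 'M[C]_2) :
  conj_rep r r' -> conj_rep r' r'' -> conj_rep r r''.
Proof.
move=> [P dP Pr] [P' dP' Pr']; exists (P' *m P); rewrite ?det_mulmx ?dP ?dP' ?mulr1 // => g.
have uP : P \in unitmx by rewrite unitmxE dP unitr1.
have uP' : P' \in unitmx by rewrite unitmxE dP' unitr1.
have -> : invmx (P' *m P) = invmx P *m invmx P' := invrM uP' uP.
by rewrite Pr' Pr !mulmxA.
Qed.

Lemma dmx_exp (C : numClosedFieldType) (w : C) n : dmx w w^-1 ^+ n = dmx (w ^+ n) (w ^+ n)^-1.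
Proof.
elim: n => [|n IH]; first by rewrite !expr0 invr1; apply: mx2P; rewrite !mxE.
by rewrite exprS IH -[_ * _]/(_ *m _) dmx_mul -invfM -exprS.
Qed.

Section ConjRep.
Variables (C : numClosedFieldType) (gT : finGroupType) (r : gT -> 'M[C]_2).
Hypothesis rP : sl2_rep r.
Implicit Types (x y g : gT) (Q : 'M[C]_2).

Lemma conj_rep_sl2 r' : conj_rep r r' -> sl2_rep r'.
Proof.
move=> [P dP Pr]; have uP : P \in unitmx by rewrite unitmxE dP unitr1.
split=> [x y|x y|x].
- by rewrite !Pr (repM rP) !mulmxA -(mulmxA _ (invmx P) P) mulVmx // mulmx1.
- rewrite !Pr => /(can_inj (mulmxK (etrans (unitmx_inv P) uP)))/(can_inj (mulKmx uP)).
  exact: (rep_inj rP).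
- by rewrite Pr !det_mulmx (rep_det rP) mulr1 -det_mulmx mulmxV // det1.
Qed.

Lemma conj_rep_trace r' g : conj_rep r r' -> \tr (r' g) = \tr (r g).
Proof.
move=> [P dP ->]; have uP : P \in unitmx by rewrite unitmxE dP unitr1.
by rewrite mxtrace_mulC mulmxA mulVmx // mul1mx.
Qed.

Lemma conj_diag Q : axis Q -> exists2 r', conj_rep r r' & stab r' (dmx 1 (-1)) = stab r Q.
Proof.
move=> /diagonalize_axis[P dP PQ]; exists (fun g => P *m r g *m invmx P); first by exists P.
have uP : P \in unitmx by rewrite unitmxE dP unitr1.
apply/setP => g; rewrite !inE.
have -> : dmx 1 (-1) = P *m Q *m invmx P :> 'M[C]_2 by rewrite PQ mulmxK.
rewrite !mulmxA -(mulmxA _ (invmx P) P) mulVmx // mulmx1.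
rewrite -(mulmxA _ (invmx P) P) mulVmx // mulmx1 (inj_eq (can_inj (mulmxK _))) ?unitmx_inv //.
by rewrite -!mulmxA (inj_eq (can_inj (mulKmx uP))).
Qed.

Lemma stab_dmxP g : g \in stab r (dmx 1 (-1)) -> r g = dmx (r g 0 0) (r g 0 0)^-1.
Proof.
rewrite inE => /eqP/commute_dmx E; have := rep_det rP g; rewrite E det_dmx => d1.
rewrite {1}E !mxE /=; congr dmx; apply: (@mulfI _ (r g 0 0)).
  by apply: contra_eq_neq d1 => ->; rewrite mul0r eq_sym oner_neq0.
by rewrite d1 divff //; apply: contra_eq_neq d1 => ->; rewrite mul0r eq_sym oner_neq0.
Qed.

(** The upper left entry embeds the stabiliser in the multiplicative group of the field, where
    finite subgroups are cyclic. *)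
Lemma stab_dmx_cyclic : exists g z, [/\ stab r (dmx 1 (-1)) = <[g]>%g,
  r g = dmx z z^-1 & #|stab r (dmx 1 (-1))|.-primitive_root z].
Proof.
set D := dmx 1 (-1); pose f g := r g 0 0.
have f1 : f 1%g = 1 by rewrite /f (rep1 rP) mxE.
have fM : {in stab_group rP D &, {morph f : x y / (x * y)%g >-> x * y}}.
  by move=> x y /stab_dmxP xE /stab_dmxP yE; rewrite /f (repM rP) xE yE dmx_mul !mxE.
have finj : {in stab_group rP D, forall x, f x = 1 <-> x = 1%g}.
  move=> x /stab_dmxP xE; split=> [fx|->//]; apply: (rep_inj rP).
  by rewrite xE -/(f x) fx (rep1 rP) invr1; apply: mx2P; rewrite !mxE.
have /cyclicP[g gE] : cyclic (stab_group rP D) := field_mul_group_cyclic fM finj.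
rewrite /= in gE; exists g, (f g); split=> //.
  by apply: stab_dmxP; rewrite gE cycle_id.
have gD : g \in stab_group rP D by rewrite /= gE cycle_id.
have fX n : f (g ^+ n)%g = f g ^+ n.
  by elim: n => [|n IH]; rewrite ?expg0 // expgS fM ?groupX // IH exprS.
rewrite gE -[#|_|]/(#[g]%g).
apply/andP; split; first exact: order_gt0.
apply/forallP => i; rewrite unity_rootE -fX.
have gi : (g ^+ i.+1)%g \in stab_group rP D by rewrite groupX.
have -> : (f (g ^+ i.+1)%g == 1) = (#[g]%g %| i.+1)%N.
  by rewrite order_dvdn; apply/eqP/eqP => /(finj _ gi).
apply/eqP; apply/idP/eqP => [d|-> //].
by apply/eqP; rewrite eqn_leq (ltn_ord i) dvdn_leq.
Qed.

Lemma stab_dmx_root w : w ^+ #|stab r (dmx 1 (-1))| = 1 ->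
  exists2 g, g \in stab r (dmx 1 (-1)) & r g = dmx w w^-1.
Proof.
have [g [z [gE rg zP]]] := stab_dmx_cyclic => /(prim_rootP zP)[[i /= _] ->].
exists (g ^+ i)%g; first by rewrite gE mem_cycle.
rewrite (repX rP) rg; exact: dmx_exp.
Qed.

End ConjRep.

Section Consequences.
Variables (C : numClosedFieldType) (gT : finGroupType) (r : gT -> 'M[C]_2).
Hypothesis rP : sl2_rep r.
Implicit Types (x y g : gT) (Q : 'M[C]_2).

Lemma stab_trace g Q : axis Q -> g \in stab r Q ->
  exists2 z, z ^+ #|stab r Q| = 1 & \tr (r g) = z + z^-1.
Proof.
move=> /(conj_diag r)[r' rr' sE]; have rP' := conj_rep_sl2 rP rr'.
rewrite -sE -(conj_rep_trace g rr') => gQ; have rg := stab_dmxP rP' gQ.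
exists (r' g 0 0); last by rewrite {1}rg mxtrace2 !mxE.
have : (g ^+ #|stab_group rP' (dmx 1 (-1))| = 1)%g by apply: expg_cardG.
move/(congr1 (fun x => r' x 0 0)); rewrite (repX rP') rg (rep1 rP') [RHS]mxE /= => E; apply: etrans E.
by rewrite dmx_exp !mxE.
Qed.

Lemma trace_root Q w : axis Q -> w ^+ #|stab r Q| = 1 ->
  exists2 g, g \in stab r Q & \tr (r g) = w + w^-1.
Proof.
move=> /(conj_diag r)[r' rr' sE]; have rP' := conj_rep_sl2 rP rr'.
rewrite -sE => /(stab_dmx_root rP')[g gQ rg]; exists g => //.
by rewrite -(conj_rep_trace g rr') rg mxtrace2 !mxE.
Qed.

(* Elements outside an index 2 stabiliser reverse the axis. *)
Lemma dihedral_normal_form Q : axis Q -> #|gT| = (2 * #|stab r Q|)%N -> (2 < #|stab r Q|)%N ->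
  exists2 r', conj_rep r r' & exists g0 z g1, [/\ r' g0 = dmx z z^-1,
    r' g1 = \matrix_(i, j) (if i == j then 0 else if i == 0 then 1 else -1),
    #|stab r Q|.-primitive_root z, stab r' (dmx 1 (-1)) = <[g0]>%g
  & #|stab r' (dmx 1 (-1))| = #|stab r Q|].
Proof.
move=> aQ; have [r' rr' sE] := conj_diag r aQ; have rP' := conj_rep_sl2 rP rr'.
rewrite -sE => GE s2; set D := dmx 1 (-1) in GE s2 *; set H := stab r' D in GE s2 *.
have aD : axis D.
  rewrite /axis mxtrace2 dmx_mul !mxE /= subrr eqxx mulrNN !mulr1 /=.
  by apply/eqP; apply: mx2P; rewrite !mxE.
have [g1 g1H] : exists g1, g1 \notin H.
  apply/existsP; rewrite -negb_forall; apply: contraL s2 => /forallP allH.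
  have : #|gT| = #|H| by rewrite -cardsT; congr #|pred_of_set _|; apply/setP => x; rewrite inE allH.
  by rewrite GE; lia.
(* At most two elements are central; this is where the lower bound on the stabiliser enters. *)
have [h hH ch] : exists2 h, h \in H & ~~ central r' h.
  apply/exists_inP; rewrite -negb_forall_in; apply: contraL s2 => /forall_inP allH.
  rewrite -leqNgt; apply: leq_trans (card_center_le2 rP').
  by apply/subset_leq_card/subsetP => x xH; rewrite inE allH.
have nH : (stab_group rP' D <| [set: gT])%g.
  apply: index2_normal; first exact: subsetT.
  by apply/eqP; rewrite -(eqn_pmul2l (cardG_gt0 (stab_group rP' D))) Lagrange ?subsetT // cardsT GE mulnC.
have anti : r' g1 *m D = - (D *m r' g1).
  have hg : (h ^ g1)%g \in H.
    by rewrite -[H]/(stab_group rP' D : {set gT}) memJ_norm // (subsetP (normal_norm nH)) ?inE.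
  have cg : ~~ central r' (h ^ g1)%g.
    by apply: contra ch => /(centralJ rP')-/(_ g1^-1%g); rewrite conjgK.
  have gV : r' g1 *m r' g1^-1%g = 1%:M by rewrite -(repM rP') mulgV (rep1 rP').
  have [E|E] := axis_same rP' cg aD (conjm_axis rP' g1 aD) hg (conjm_stab rP' g1 hH).
    by case/negP: g1H; rewrite inE -{1}E /conjm !mulmxA gV mul1mx.
  by rewrite -[D in LHS]opprK -E /conjm mulmxN !mulmxA gV mul1mx.
have [r11 r22] := anticommute_dmx anti.
set w := r' g1 0 1.
have dg := rep_det rP' g1; rewrite det_mx2 r11 mul0r sub0r -/w in dg.
have w0 : w != 0 by apply: contra_eq_neq dg => ->; rewrite mul0r oppr0 eq_sym oner_neq0.
have wV : r' g1 1 0 = - w^-1 by apply: (mulfI w0); rewrite mulrN divff // -dg opprK.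
(* Conjugation by diag(c, c^-1) multiplies the upper right entry w by c^2, which normalises it to 1
   and preserves the diagonal axis. *)
pose c := sqrtC w^-1; have c2 : c ^+ 2 = w^-1 by rewrite sqrtCK.
have c0 : c != 0 by rewrite -sqrf_eq0 c2 invr_eq0.
have dc : \det (dmx c c^-1) = 1 by rewrite det_dmx divff.
have uc : dmx c c^-1 \in unitmx by rewrite unitmxE dc unitr1.
have cV : invmx (dmx c c^-1) = dmx c^-1 c.
  apply: (can_inj (mulKmx uc)); rewrite mulmxV // dmx_mul divff // mulVf //.
  by apply: mx2P; rewrite !mxE.
pose r2 g := dmx c c^-1 *m r' g *m invmx (dmx c c^-1).
have r'r2 : conj_rep r' r2 by exists (dmx c c^-1).
have rP2 := conj_rep_sl2 rP' r'r2.
have sE2 : stab r2 D = H.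
  have cD : dmx c c^-1 *m D = D *m dmx c c^-1 by rewrite !dmx_mul (mulrC c) (mulrC c^-1).
  have cD' : dmx c^-1 c *m D = D *m dmx c^-1 c by rewrite !dmx_mul (mulrC c) (mulrC c^-1).
  apply/setP => g; rewrite !inE /r2 -mulmxA cV cD' !mulmxA -cD -cV -!mulmxA.
  rewrite (inj_eq (can_inj (mulKmx uc))) !mulmxA (inj_eq (can_inj (mulmxK _))) //.
  by rewrite unitmx_inv.
have [g0 [z [gE rg zP]]] := stab_dmx_cyclic rP2.
exists r2; first exact: conj_rep_trans rr' r'r2.
exists g0, z, g1; rewrite -sE2; split=> //.
rewrite /r2 cV; apply: mx2P; rewrite !mul_mx2 !mxE /= r11 r22 wV -/w.
- by ring.
- by rewrite !(mul0r, mulr0, add0r, addr0) mulrAC -expr2 c2 mulVf.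
- by rewrite !(mul0r, mulr0, add0r, addr0) mulrN mulNr mulrAC -expr2 exprVn c2 invrK divff.
- by ring.
Qed.

End Consequences.

(** * Quaternions *)

Section Quaternions.
Variable R : realType.
Implicit Types a b c d : R.
Local Notation C := R[i].

Lemma complexP (x y : C) : complex.Re x = complex.Re y -> complex.Im x = complex.Im y -> x = y.
Proof. by case: x y => [a b] [a' b'] /= -> ->. Qed.

Lemma quat_mul a b c d a' b' c' d' :
  quat a b c d *m quat a' b' c' d' =
  quat (a * a' - b * b' - c * c' - d * d') (a * b' + b * a' + c * d' - d * c')
       (a * c' - b * d' + c * a' + d * b') (a * d' + b * c' - c * b' + d * a').
Proof. by apply: mx2P; rewrite mul_mx2 !mxE; apply: complexP => /=; ring. Qed.

Lemma quat1 : quat 1 0 0 0 = 1%:M :> 'M[C]_2.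
Proof. by apply: mx2P; rewrite !mxE; apply: complexP => /=; rewrite ?oppr0. Qed.

Lemma trace_quat a b c d : \tr (quat a b c d) = (2 * a)%:C%C.
Proof. by rewrite mxtrace2 !mxE; apply: complexP => /=; ring. Qed.

Lemma det_quat a b c d : \det (quat a b c d) = (a ^+ 2 + b ^+ 2 + c ^+ 2 + d ^+ 2)%:C%C.
Proof. by rewrite det_mx2 !mxE; apply: complexP => /=; ring. Qed.

Lemma invmx_quat a b c d : a ^+ 2 + b ^+ 2 + c ^+ 2 + d ^+ 2 = 1 ->
  invmx (quat a b c d) = quat a (- b) (- c) (- d).
Proof.
move=> n1; have u : quat a b c d \in unitmx by rewrite unitmxE det_quat n1 unitr1.
apply: (can_inj (mulKmx u)); rewrite mulmxV // quat_mul -quat1 -n1.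
by congr quat; ring.
Qed.

Lemma quat_inj a b c d a' b' c' d' : quat a b c d = quat a' b' c' d' ->
  [/\ a = a', b = b', c = c' & d = d'].
Proof.
move=> E; have := congr1 (fun A : 'M[C]_2 => A 0 0) E.
have := congr1 (fun A : 'M[C]_2 => A 0 1) E.
by rewrite !mxE => -[-> ->] [-> ->].
Qed.

(** [A] is an arbitrary complex matrix. Pairing with 1, i, j, k under the trace gives coordinates on
    all 2 x 2 complex matrices, so four real traces already force a quaternion. *)
Lemma quat_of_traces A a b c d :
  \tr A = (2 * a)%:C%C -> \tr (A *m quat 0 1 0 0) = (- 2 * b)%:C%C ->
  \tr (A *m quat 0 0 1 0) = (- 2 * c)%:C%C -> \tr (A *m quat 0 0 0 1) = (- 2 * d)%:C%C ->
  A = quat a b c d.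
Proof.
move=> trA trI trJ trK; suff [e1 e2 e3 e4] : [/\ A 0 0 = Complex a b, A 0 1 = Complex c d,
    A 1 0 = Complex (- c) d & A 1 1 = Complex a (- b)] by apply: mx2P; rewrite !mxE.
move: trA trI trJ trK; rewrite !mxtrace2 !mul_mx2 !mxE /=.
move: (A 0 0) (A 0 1) (A 1 0) (A 1 1) => [x1 x2] [y1 y2] [z1 z2] [w1 w2] /=.
move=> [e1 e2] [e3 e4] [e5 e6] [e7 e8].
by split; apply: complexP => /=; lra.
Qed.

Lemma diagSL2E (z : C) : diagSL2 z = dmx z z^-1.
Proof. by apply: mx2P; rewrite !mxE. Qed.

Lemma quat_dmx a b : dmx (Complex a b) (Complex a (- b)) = quat a b 0 0.
Proof. by apply: mx2P; rewrite !mxE //=; apply: complexP; rewrite /= ?oppr0. Qed.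

Lemma quat_j : quat 0 0 1 0 = \matrix_(i, j) (if i == j then 0 else if i == 0 then 1 else -1) :> 'M[C]_2.
Proof. by apply: mx2P; rewrite !mxE //=; apply: complexP; rewrite /= ?oppr0. Qed.

End Quaternions.

(** * Orders and generation in finite groups *)

Section Orders.
Variable gT : finGroupType.
Implicit Types (g h : gT) (H : {group gT}).
Local Open Scope group_scope.

Lemma order_pexp p k g : prime p -> g ^+ (p ^ k.+1) = 1 -> g ^+ (p ^ k) != 1 -> #[g] = (p ^ k.+1)%N.
Proof.
move=> pr /eqP d; have [m mk gE] := dvdn_pfactor _ _ pr (etrans (order_dvdn _ _) d).
rewrite -order_dvdn gE dvdn_Pexp2l ?prime_gt1 // -ltnNge => km.
by congr (_ ^ _)%N; apply/eqP; rewrite eqn_leq mk.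
Qed.

Lemma prime_dvd_order p n g : prime p -> g ^+ (p * n) = 1 -> g ^+ n != 1 -> (p %| #[g])%N.
Proof.
move=> pr /eqP d; apply: contraR; move: d; rewrite -!order_dvdn => d.
rewrite -prime_coprime // coprime_sym => co.
by rewrite -(Gauss_dvdr _ co).
Qed.

(** The cyclic group of h normalises that of g and meets it in order 1 or 2, so the product has
    order 4 or 2 times that of g. *)
Lemma card_gen_double g h : #[h] = 4%N -> h \notin <[g]> -> g ^ h \in <[g]> ->
  (2 * #[g] %| #|<<[set g; h]>>|)%N.
Proof.
move=> h4 hg gh.
have nH : <[h]> \subset 'N(<[g]>) by rewrite cycle_subG; apply/normP; rewrite -cycleJ;
  apply/eqP; rewrite eqEcard cycle_subG gh -[#|<[g ^ h]>|]/(#[g ^ h]) orderJ leqnn.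
have KE : <<[set g; h]>> = <[g]> * <[h]>.
  by rewrite -norm_joinEr // joing_idl joing_idr.
have := mul_cardG <[g]> <[h]>; rewrite -KE -[#|<[h]>|]/#[h] h4 -[#|<[g]>|]/#[g].
set c := #|_ :&: _| => E.
have c4 : (c %| 4)%N by rewrite -h4; apply: cardSg; apply: subsetIr.
have cN4 : c != 4%N.
  apply: contra hg => /eqP c4E; rewrite -cycle_subG.
  suff /eqP <- : <[g]> :&: <[h]> == <[h]> by apply: subsetIl.
  by rewrite eqEcard subsetIr -/c c4E -[#|_|]/#[h] h4.
have := @dvdn_leq c 4 isT c4; case: (c) c4 cN4 E => [|[|[|[|[|//]]]]] // _ _ E _; apply/dvdnP.
  by exists 2%N; lia.
by exists 1%N; lia.
Qed.

Lemma card_full H a b : coprime a b -> (a %| #|H|)%N -> (b %| #|H|)%N -> #|gT| = (a * b)%N ->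
  H :=: [set: gT].
Proof.
move=> co aH bH gE; apply/eqP; rewrite eqEcard subsetT cardsT gE.
by apply: dvdn_leq; rewrite ?cardG_gt0 // Gauss_dvd // aH.
Qed.

End Orders.

Lemma generated_mul (K : fieldType) (S : seq 'M[K]_2) A B :
  Defs.generated S A -> Defs.generated S B -> Defs.generated S (A *m B).
Proof.
move=> gA gB; elim: gA => [|X Y XS _ IH|X Y XS _ IH]; first by rewrite mul1mx.
  by rewrite -mulmxA; apply: GeneratedM.
by rewrite -mulmxA; apply: GeneratedV.
Qed.

Lemma rep_generated (C : numClosedFieldType) (gT : finGroupType) (r : gT -> 'M[C]_2)
    (gs : seq gT) : sl2_rep r -> <<[set g in gs]>>%g = [set: gT] ->
  forall A, (exists g, r g = A) <-> Defs.generated (map r gs) A.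
Proof.
move=> rP full A; split=> [[g <-]|]; last first.
  elim=> [|X Y /mapP[g _ ->] _ [h <-]|X Y /mapP[g _ ->] _ [h <-]].
  - by exists 1%g; exact: rep1.
  - by exists (g * h)%g; exact: (repM rP).
  - by exists (g^-1 * h)%g; rewrite (repM rP) (repV rP).
have gK : group_set [set g | `[< Defs.generated (map r gs) (r g) >]].
  apply/group_setP; split=> [|x y]; rewrite !inE.
    by apply/asboolP; rewrite (rep1 rP); exact: Generated1.
  by move=> /asboolP gx /asboolP gy; apply/asboolP; rewrite (repM rP); exact: generated_mul.
have : (<<[set g in gs]>> \subset Group gK)%g.
  rewrite gen_subG; apply/subsetP => x; rewrite !inE => xs; apply/asboolP.
  by rewrite -[r x]mulmx1; apply: GeneratedM; [exact: map_f|exact: Generated1].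
by rewrite full => /subsetP/(_ g (in_setT _)); rewrite inE => /asboolP.
Qed.

(** * Dihedral subgroups *)

Section Sylow.
Variables (C : numClosedFieldType) (gT : finGroupType) (r : gT -> 'M[C]_2).
Hypothesis rP : sl2_rep r.

(** The classification is applied to H: without an element of full order it is not cyclic, and its
    order excludes the polyhedral cases. The matrix that normalises H conjugates the whole group. *)
Lemma subgroup_dihedral (H : {group gT}) e : (1 < e)%N -> #|H| = (4 * e)%N ->
  (4 * e)%N \notin [:: 24; 48; 120] -> (forall g : gT, #[g]%g <> (4 * e)%N) ->
  exists2 r', conj_rep r r' & (exists g, r' g = \matrix_(i, j) (if i == j then 0 else if i == 0 then 1 else -1))
   /\ forall w, w ^+ (2 * e) = 1 -> exists g, r' g = dmx w w^-1.
Proof.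
move=> e1 He N3 ord; pose rH (x : subg_of H) := r (sgval x).
have cH : #|subg_of H| = (4 * e)%N by rewrite card_sub -He; apply: eq_card => x; rewrite !inE.
have rHP : sl2_rep rH.
  split=> [x y|x y /(rep_inj rP)/val_inj//|x]; last exact: (rep_det rP).
  exact: (repM rP).
have [[Q aQ QT]|[_ [e2 [e3 [typ ex _]]]]] := sl2_rep_type rHP.
  have [r' rr' sE] := conj_diag rH aQ; have rP' := conj_rep_sl2 rHP rr'.
  have [g [z [gE _ _]]] := stab_dmx_cyclic rP'.
  have := ord (sgval g); case; rewrite -cH -cardsT -QT -sE gE.
  by apply: (order_injm (injm_sgval H)); rewrite inE.
have eE : e3 = e.
  by case: typ N3 => [[_ [_]]|[_ _]|[_ _]|[_ _]]; rewrite cH => E; rewrite ?E //; lia.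
have [Q aQ QE] : exists2 Q, axis Q & #|stab rH Q| = (2 * e)%N.
  by apply: ex; rewrite eE !inE eqxx !orbT.
have [||r'' [P dP rr''] [g0 [z [g1 [_ rg1 zP sE cE]]]]] := dihedral_normal_form rHP aQ.
- by rewrite cH QE mulnA.
- by rewrite QE; lia.
have rP'' : sl2_rep r'' by apply: (conj_rep_sl2 rHP); exists P.
exists (fun g => P *m r g *m invmx P); first by exists P.
split; first by exists (sgval g1); rewrite -rg1 rr''.
move=> w; rewrite -QE -cE => /(stab_dmx_root rP'')[g _ <-].
by exists (sgval g); rewrite rr''.
Qed.

End Sylow.

(** * Traces of roots of unity *)

Section RootTraces.
Variable F : fieldType.
Implicit Types z w : F.

Lemma unit_root_neq0 z n : z ^+ n.+1 = 1 -> z != 0.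
Proof. by apply: contra_eq_neq => ->; rewrite expr0n eq_sym oner_neq0. Qed.

Lemma trace_root4 z : z ^+ 4 = 1 -> [\/ z + z^-1 = 2, z + z^-1 = - 2 | z + z^-1 = 0].
Proof.
move=> z4; have z0 := unit_root_neq0 z4.
have /eqP : (z - 1) * (z + 1) * (z ^+ 2 + 1) = 0 by apply: etrans (_ : z ^+ 4 - 1 = _); [ring|rewrite z4 subrr].
rewrite !mulf_eq0 subr_eq0 addr_eq0 => /orP[/orP[]|] /eqP zE.
- by constructor 1; rewrite zE invr1.
- by constructor 2; rewrite zE invrN1; ring.
constructor 3; apply: (mulfI z0); rewrite mulrDr divff // mulr0 -expr2 //.
Qed.

Lemma trace_root6 z : z ^+ 6 = 1 ->
  [\/ z + z^-1 = 2, z + z^-1 = - 2, z + z^-1 = 1 | z + z^-1 = - 1].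
Proof.
move=> z6; have z0 := unit_root_neq0 z6.
have /eqP : (z - 1) * (z + 1) * (z ^+ 2 - z + 1) * (z ^+ 2 + z + 1) = 0.
  by apply: etrans (_ : z ^+ 6 - 1 = _); [ring|rewrite z6 subrr].
rewrite !mulf_eq0 subr_eq0 addr_eq0 => /orP[/orP[/orP[]|]|] /eqP zE.
- by constructor 1; rewrite zE invr1.
- by constructor 2; rewrite zE invrN1; ring.
- constructor 3; apply: (mulfI z0); rewrite mulrDr divff //; apply/eqP; rewrite -subr_eq0 -zE; apply/eqP; ring.
- constructor 4; apply: (mulfI z0); rewrite mulrDr divff //; apply/eqP; rewrite -subr_eq0 -zE; apply/eqP; ring.
Qed.

Lemma trace_root8 z : z ^+ 8 = 1 ->
  [\/ z + z^-1 = 2, z + z^-1 = - 2, z + z^-1 = 0 | (z + z^-1) ^+ 2 = 2].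
Proof.
move=> z8; have z0 := unit_root_neq0 z8.
have /eqP : (z ^+ 4 - 1) * (z ^+ 4 + 1) = 0 by apply: etrans (_ : z ^+ 8 - 1 = _); [ring|rewrite z8 subrr].
rewrite mulf_eq0 subr_eq0 => /orP[/eqP/trace_root4[]|/eqP zE].
- by constructor 1. - by constructor 2. - by constructor 3.
constructor 4; apply: (mulfI (expf_neq0 2 z0)).
rewrite -exprMn mulrDr divff //; apply/eqP; rewrite -subr_eq0 -zE; apply/eqP; ring.
Qed.

(** The two quartic factors are the cyclotomic polynomials of index 10 and 5; divided by z^2 they
    become the quadratic equations of the golden ratio and of its negative. *)
Lemma trace_root10 z : z ^+ 10 = 1 ->
  [\/ z + z^-1 = 2, z + z^-1 = - 2, (z + z^-1) ^+ 2 = z + z^-1 + 1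
    | (z + z^-1) ^+ 2 = 1 - (z + z^-1)].
Proof.
move=> z10; have z0 := unit_root_neq0 z10.
have /eqP : (z - 1) * (z + 1) * (z ^+ 4 - z ^+ 3 + z ^+ 2 - z + 1)
    * (z ^+ 4 + z ^+ 3 + z ^+ 2 + z + 1) = 0 by apply: etrans (_ : z ^+ 10 - 1 = _); [ring|rewrite z10 subrr].
rewrite !mulf_eq0 subr_eq0 addr_eq0 => /orP[/orP[/orP[]|]|] /eqP zE.
- by constructor 1; rewrite zE invr1.
- by constructor 2; rewrite zE invrN1; ring.
- constructor 3; apply: (mulfI (expf_neq0 2 z0)); apply/eqP; rewrite -subr_eq0 -zE.
  by apply/eqP; field.
- constructor 4; apply: (mulfI (expf_neq0 2 z0)); apply/eqP; rewrite -subr_eq0 -zE.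
  by apply/eqP; field.
Qed.
End RootTraces.

Lemma root_of_trace (C : numClosedFieldType) (t : C) : exists2 z, z != 0 & z + z^-1 = t.
Proof.
pose s := sqrtC (t ^+ 2 - 4); have s2 : s ^+ 2 = t ^+ 2 - 4 by rewrite sqrtCK.
pose z := (t + s) / 2; have zz : z * (t - z) = 1.
  have -> : z * (t - z) = (t ^+ 2 - s ^+ 2) / 4 by rewrite /z; field.
  by rewrite s2; field.
have z0 : z != 0 by apply: contra_eq_neq zz => ->; rewrite mul0r eq_sym oner_neq0.
by exists z => //; apply: (mulfI z0); rewrite mulrDr divff // -zz; ring.
Qed.

Section Traces.
Variables (R : realType) (gT : finGroupType) (r : gT -> 'M[R[i]]_2).
Hypothesis rP : sl2_rep r.

Definition traces_in (T : seq R) := forall g, exists2 x, x \in T & \tr (r g) = x%:C%C.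

Lemma quat_in_rep T gi gj : traces_in T -> (forall x, x \in T -> - x \in T) ->
  r gi = quat 0 1 0 0 -> r gj = quat 0 0 1 0 ->
  forall g, exists a b c d, [/\ r g = quat a b c d, 2 * a \in T, 2 * b \in T & 2 * c \in T /\ 2 * d \in T].
Proof.
move=> trT oppT ri rj g; have half (x : R) : 2 * (x / 2) = x by field.
have rk : r (gi * gj)%g = quat 0 0 0 1 by rewrite (repM rP) ri rj quat_mul; congr quat; ring.
have [x xT xE] := trT g; have [y yT yE] := trT (g * gi)%g.
have [z zT zE] := trT (g * gj)%g; have [w wT wE] := trT (g * (gi * gj))%g.
exists (x / 2), (- y / 2), (- z / 2), (- w / 2); rewrite !half; split; rewrite ?oppT //.
apply: quat_of_traces; rewrite -?ri -?rj -?rk -?(repM rP) ?xE ?yE ?zE ?wE;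
  by congr (_%:C)%C; field.
Qed.

End Traces.

Section Golden.
Variable R : realType.

Lemma golden_sqr : golden R ^+ 2 = golden R + 1.
Proof.
have s5 : Num.sqrt 5 ^+ 2 = 5 :> R by rewrite sqr_sqrtr.
by rewrite /golden; move: (Num.sqrt 5) s5 => s s5; lra.
Qed.

Lemma golden_bounds : 8 / 5 < golden R < 17 / 10.
Proof.
have s5 : Num.sqrt 5 ^+ 2 = 5 :> R by rewrite sqr_sqrtr.
have s0 : 0 <= Num.sqrt 5 :> R by apply: sqrtr_ge0.
by rewrite /golden; move: (Num.sqrt 5) s5 s0 => s s5 s0; apply/andP; split; nra.
Qed.

Lemma goldenV : (golden R)^-1 = golden R - 1.
Proof.
have /andP[g0 _] := golden_bounds; have gN0 : golden R != 0 by rewrite gt_eqF //; lra.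
apply: (mulfI gN0); rewrite divff // mulrBr -expr2 golden_sqr; ring.
Qed.
End Golden.

(** * Orders of unit quaternions *)

Section Image.
Variables (R : realType) (gT : finGroupType) (r : gT -> 'M[R[i]]_2).
Hypothesis rP : sl2_rep r.
Implicit Types (g h : gT) (H : {group gT}).

Lemma rep_quatV g a b c d : r g = quat a b c d -> r g^-1%g = quat a (- b) (- c) (- d).
Proof.
move=> gE; rewrite (repV rP) gE invmx_quat //.
by have := rep_det rP g; rewrite gE det_quat => -[].
Qed.

Lemma quat_norm g a b c d : r g = quat a b c d -> a ^+ 2 + b ^+ 2 + c ^+ 2 + d ^+ 2 = 1.
Proof. by move=> gE; have := rep_det rP g; rewrite gE det_quat => -[]. Qed.

Lemma rep_pow2 g a b c d : r g = quat a b c d ->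
  r (g ^+ 2)%g = quat (2 * a ^+ 2 - 1) (2 * a * b) (2 * a * c) (2 * a * d).
Proof.
move=> gE; have n1 := quat_norm gE; rewrite expgS expg1 (repM rP) gE quat_mul.
by congr quat; [lra|ring..].
Qed.

Lemma rep_eq1 g : (g == 1%g) = (r g == quat 1 0 0 0).
Proof. by rewrite quat1 -(rep1 rP) (inj_eq (rep_inj rP)). Qed.

Lemma rep_neq1 g a b c d : r g = quat a b c d -> a != 1 -> g != 1%g.
Proof. by move=> gE; apply: contra; rewrite rep_eq1 gE => /eqP/quat_inj[->]. Qed.

Lemma rep_is1 g a b c d : r g = quat a b c d -> a = 1 -> g = 1%g.
Proof.
move=> gE a1; apply/eqP; rewrite rep_eq1 gE a1; apply/eqP.
have /eqP : b ^+ 2 + (c ^+ 2 + d ^+ 2) = 0 by have := quat_norm gE; rewrite a1; lra.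
rewrite !paddr_eq0 ?addr_ge0 ?sqr_ge0 // !sqrf_eq0 => /andP[/eqP-> /andP[/eqP-> /eqP->]].
by [].
Qed.

Lemma order_imaginary g b c d : r g = quat 0 b c d -> #[g]%g = 4%N.
Proof.
move=> gE; have g2 := rep_pow2 gE; apply: (@order_pexp _ 2 1) => //.
  by rewrite (expgM g 2 2); apply: rep_is1 (rep_pow2 g2) _; ring.
by apply: rep_neq1 g2 _; rewrite lt_eqF //; lra.
Qed.

(** Conjugation by j inverts a + b i, and j does not commute with it as b is not 0;
    [card_gen_double] applies. *)
Lemma order_double_dvd H g gj a b : r g = quat a b 0 0 -> b != 0 -> r gj = quat 0 0 1 0 ->
  g \in H -> gj \in H -> (2 * #[g]%g %| #|H|)%N.
Proof.
move=> rg b0 rj gH jH; have rgV := rep_quatV rg; have rjV := rep_quatV rj.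
apply: dvdn_trans (card_gen_double (order_imaginary rj) _ _) _.
- apply/negP => /cycleP[n jE]; have : (g * gj = gj * g)%g by rewrite jE -expgS -expgSr.
  move/(congr1 r); rewrite !(repM rP) rg rj !quat_mul => /quat_inj[_ _ _] /eqP.
  rewrite !(mul0r, mulr0, mul1r, mulr1, addr0, add0r, subr0, sub0r) -addr_eq0 -mulr2n mulrn_eq0 /=.
  exact/negP.
- suff -> : (g ^ gj)%g = g^-1%g by rewrite groupV cycle_id.
  apply: (rep_inj rP); rewrite conjgE !(repM rP) rjV rg rj rgV !quat_mul.
  by congr quat; ring.
- by apply: cardSg; rewrite gen_subG; apply/subsetP => x /set2P[]->.
Qed.

Lemma order_quat3 g b c d : r g = quat 2^-1 b c d -> (3 %| #[g]%g)%N.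
Proof.
move=> gE; have g2 := rep_pow2 gE; have g4 := rep_pow2 g2.
apply: (@prime_dvd_order _ _ 2) => //; last by apply: rep_neq1 g2 _; rewrite lt_eqF //; lra.
have g3 : r (g ^+ 3)%g = quat (-1) 0 0 0.
  rewrite expgS (repM rP) g2 gE quat_mul; have := quat_norm gE => n1.
  by congr quat; nra.
rewrite (expgM g 3 2); apply: rep_is1 (rep_pow2 g3) _; ring.
Qed.

(** The real part is cos(pi / 5), so the fifth power is -1. *)
Lemma order_quat5 g b c d : r g = quat (golden R / 2) b c d -> (5 %| #[g]%g)%N.
Proof.
have phi2 := golden_sqr R; have /andP[phi1 phi17] := golden_bounds R.
move: (golden R) phi2 phi1 phi17 => phi phi2 phi1 phi17 gE; have n1 := quat_norm gE.
have g2 : r (g ^+ 2)%g = quat ((phi - 1) / 2) (phi * b) (phi * c) (phi * d).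
  by rewrite (rep_pow2 gE); congr quat; lra.
have phiM x : 2 * ((phi - 1) / 2) * (phi * x) = x.
  by apply: etrans (_ : (phi ^+ 2 - phi) * x = x); [field|rewrite phi2; ring].
have g4 : r (g ^+ 4)%g = quat (- phi / 2) b c d.
  have -> : (g ^+ 4 = (g ^+ 2) ^+ 2)%g by exact: (expgM g 2 2).
  by rewrite (rep_pow2 g2) !phiM; congr quat; lra.
apply: (@prime_dvd_order _ _ 2) => //; last by apply: rep_neq1 g2 _; rewrite lt_eqF //; lra.
have g5 : r (g ^+ 5)%g = quat (-1) 0 0 0.
  have -> : (g ^+ 5 = g ^+ 4 * g)%g by exact: (expgSr g 4).
  rewrite (repM rP) g4 gE quat_mul; by congr quat; [lra|ring..].
have -> : (g ^+ (5 * 2) = (g ^+ 5) ^+ 2)%g by exact: (expgM g 5 2).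
apply: rep_is1 (rep_pow2 g5) _; ring.
Qed.
End Image.

(** * Normal forms of the polyhedral groups *)

Section NormalForms.
Variables (R : realType) (gT : finGroupType).
Implicit Types (r : gT -> 'M[R[i]]_2) (a b c d : R).

Definition attained r a b c d := exists g, r g = quat a b c d.

Lemma attained_mul r a b c d a' b' c' d' : sl2_rep r ->
  attained r a b c d -> attained r a' b' c' d' ->
  attained r (a * a' - b * b' - c * c' - d * d') (a * b' + b * a' + c * d' - d * c')
       (a * c' - b * d' + c * a' + d * b') (a * d' + b * c' - c * b' + d * a').
Proof. by move=> rP [g gE] [h hE]; exists (g * h)%g; rewrite (repM rP) gE hE quat_mul. Qed.

Lemma attained_inv r a b c d : sl2_rep r -> attained r a b c d -> attained r a (- b) (- c) (- d).
Proof. by move=> rP [g gE]; exists g^-1%g; exact: rep_quatV. Qed.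

Lemma attained_eq r a b c d a' b' c' d' : attained r a b c d ->
  a = a' -> b = b' -> c = c' -> d = d' -> attained r a' b' c' d'.
Proof. by move=> + <- <- <- <-. Qed.

Definition quaternion_units r := attained r 0 1 0 0 /\ attained r 0 0 1 0.

Lemma attained_flip_i r a b c d : sl2_rep r -> quaternion_units r ->
  attained r a b c d -> attained r a b (- c) (- d).
Proof.
move=> rP [ri _] rg; have riV := attained_inv rP ri.
by apply: attained_eq (attained_mul rP (attained_mul rP ri rg) riV) _ _ _ _; ring.
Qed.

Lemma attained_flip_j r a b c d : sl2_rep r -> quaternion_units r ->
  attained r a b c d -> attained r a (- b) c (- d).
Proof.
move=> rP [_ rj] rg; have rjV := attained_inv rP rj.
by apply: attained_eq (attained_mul rP (attained_mul rP rj rg) rjV) _ _ _ _; ring.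
Qed.

(** Conjugation by i or j changes two of the three signs, inversion all of them; together they give
    every choice of signs. *)
Lemma attained_signs r a b c d b' c' d' : sl2_rep r -> quaternion_units r ->
  b' ^+ 2 = b ^+ 2 -> c' ^+ 2 = c ^+ 2 -> d' ^+ 2 = d ^+ 2 ->
  attained r a b c d -> attained r a b' c' d'.
Proof.
move=> rP Q /eqP; rewrite eqf_sqr => b2 /eqP; rewrite eqf_sqr => c2 /eqP; rewrite eqf_sqr => d2 rg.
have F1 x y z w : attained r x y z w -> attained r x (- y) z w.
  by move=> /(attained_inv rP)/(attained_flip_i rP Q); rewrite !opprK.
have F2 x y z w : attained r x y z w -> attained r x y (- z) w.
  by move=> /(attained_inv rP)/(attained_flip_j rP Q); rewrite !opprK.
have F3 x y z w : attained r x y z w -> attained r x y z (- w).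
  by move=> /F2/(attained_flip_i rP Q); rewrite opprK.
have {}rg : attained r a b' c d by case/orP: b2 => /eqP->; [|apply: F1].
have {}rg : attained r a b' c' d by case/orP: c2 => /eqP->; [|apply: F2].
by case/orP: d2 => /eqP->; [|apply: F3].
Qed.

(** The conjugate Y of X is specified by P X = Y P, which spares the inverse in later
    computations. *)
Lemma conj_attained r (p0 p1 p2 p3 : R) : sl2_rep r -> p0 ^+ 2 + p1 ^+ 2 + p2 ^+ 2 + p3 ^+ 2 = 1 ->
  exists2 r', conj_rep r r' & forall a b c d a' b' c' d', attained r a b c d ->
   quat p0 p1 p2 p3 *m quat a b c d = quat a' b' c' d' *m quat p0 p1 p2 p3 ->
   attained r' a' b' c' d'.
Proof.
move=> rP n1; set P := quat p0 p1 p2 p3; have dP : \det P = 1 by rewrite det_quat n1.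
have uP : P \in unitmx by rewrite unitmxE dP unitr1.
exists (fun g => P *m r g *m invmx P); first by exists P.
by move=> a b c d a' b' c' d' [g gE] E; exists g; rewrite gE E mulmxK.
Qed.

Lemma attained_trace r T t : sl2_rep r -> quaternion_units r -> traces_in r T ->
  (forall x, x \in T -> - x \in T) -> (exists g, \tr (r g) = t%:C%C) ->
  exists b c d, [/\ attained r (t / 2) b c d, (2 * b) \in T, (2 * c) \in T & (2 * d) \in T].
Proof.
move=> rP [[gi ri] [gj rj]] trT oppT [g tg].
have [a [b [c [d [gE _ bT [cT dT]]]]]] := quat_in_rep rP trT oppT ri rj g.
exists b, c, d; split=> //; exists g; rewrite gE; congr quat.
by move: tg; rewrite gE trace_quat => -[<-]; field.
Qed.

Lemma attained_norm r a b c d : sl2_rep r -> attained r a b c d -> a ^+ 2 + b ^+ 2 + c ^+ 2 + d ^+ 2 = 1.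
Proof. by move=> rP [g /(quat_norm rP)]. Qed.

Definition tetrahedral_traces : seq R := [:: 0; 1; -1; 2; -2].
Definition octahedral_traces : seq R := tetrahedral_traces ++ [:: Num.sqrt 2; - Num.sqrt 2].
Definition icosahedral_traces : seq R :=
  tetrahedral_traces ++ [:: golden R; - golden R; golden R - 1; 1 - golden R].

Let half_sqr x : (2 * x) ^+ 2 = 1 -> 2^-1 ^+ 2 = x ^+ 2 :> R.
Proof. by rewrite exprMn => x1; lra. Qed.

(** For an element of trace 1, the squares of 2b, 2c, 2d lie in 0, 1, 4 and add up to 3, so all are
    1. *)
Lemma tetrahedral_form r : sl2_rep r -> quaternion_units r -> traces_in r tetrahedral_traces ->
  (exists g, \tr (r g) = 1%:C%C) -> attained r 2^-1 2^-1 2^-1 2^-1.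
Proof.
move=> rP Q trT g1; have oppT x : x \in tetrahedral_traces -> - x \in tetrahedral_traces.
  by rewrite !inE => /or4P[|||/orP[]] /eqP->; rewrite ?oppr0 ?opprK eqxx ?orbT.
have sqrT x : x \in tetrahedral_traces -> [\/ x ^+ 2 = 0, x ^+ 2 = 1 | x ^+ 2 = 4].
  rewrite !inE => /or4P[|||/orP[]] /eqP->; rewrite ?sqrrN.
  - by constructor 1; ring.
  - by constructor 2; ring.
  - by constructor 2; ring.
  - by constructor 3; ring.
  - by constructor 3; ring.
have [b [c [d [rg /sqrT bT /sqrT cT /sqrT dT]]]] := attained_trace rP Q trT oppT g1.
have := attained_norm rP rg => n1.
have [b1 c1 d1] : [/\ (2 * b) ^+ 2 = 1, (2 * c) ^+ 2 = 1 & (2 * d) ^+ 2 = 1].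
  by case: bT => eb; case: cT => ec; case: dT => ed; first [by split|exfalso; lra].
apply: (attained_signs rP Q (half_sqr b1) (half_sqr c1) (half_sqr d1)).
by apply: attained_eq rg _ _ _ _ => //; field.
Qed.

Lemma attained_real r T a b c d : traces_in r T -> attained r a b c d -> 2 * a \in T.
Proof. by move=> trT [g gE]; have [x xT] := trT g; rewrite gE trace_quat => -[->]. Qed.

Lemma sqrt2_sqr : Num.sqrt 2 ^+ 2 = 2 :> R.
Proof. by rewrite sqr_sqrtr. Qed.

Lemma sqrt2_bounds : 7 / 5 < (Num.sqrt 2 : R) < 3 / 2.
Proof.
have s0 : 0 <= Num.sqrt 2 :> R by apply: sqrtr_ge0.
by move: (Num.sqrt 2) sqrt2_sqr s0 => s s2 s0; apply/andP; split; nra.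
Qed.

Lemma sqrt2V : (Num.sqrt 2)^-1 = Num.sqrt 2 / 2 :> R.
Proof.
have /andP[s0 _] := sqrt2_bounds; have sN0 : Num.sqrt 2 != 0 :> R by rewrite gt_eqF //; lra.
by apply: (mulfI sN0); rewrite divff // mulrA -expr2 sqrt2_sqr divff // pnatr_eq0.
Qed.

Lemma conj_rotation r p0 p1 : sl2_rep r -> p0 ^+ 2 + p1 ^+ 2 = 1 ->
  exists2 r', conj_rep r r' & forall a b c d, attained r a b c d ->
  attained r' a b ((p0 ^+ 2 - p1 ^+ 2) * c - 2 * p0 * p1 * d)
    ((p0 ^+ 2 - p1 ^+ 2) * d + 2 * p0 * p1 * c).
Proof.
move=> rP n1; have [|r' rr' E] := @conj_attained r p0 p1 0 0 rP; first by rewrite expr0n !addr0.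
exists r' => // a b c d /E; apply; rewrite !quat_mul.
have p2 : p1 ^+ 2 = 1 - p0 ^+ 2 by rewrite -n1 addrAC subrr add0r.
have p3 : p0 ^+ 3 = p0 - p0 * p1 ^+ 2 by rewrite p2; ring.
have p4 : p1 ^+ 3 = p1 - p1 * p0 ^+ 2.
  by apply: etrans (_ : p1 * p1 ^+ 2 = _); [ring|rewrite p2; ring].
have e1 x : p0 * x = (p0 ^+ 3 + p0 * p1 ^+ 2) * x by rewrite p3 subrK.
have e2 x : p1 * x = (p1 ^+ 3 + p1 * p0 ^+ 2) * x by rewrite p4 subrK.
by congr quat; rewrite ?(e1 c) ?(e1 d) ?(e2 c) ?(e2 d); ring.
Qed.

(** For an element of trace 1, the squares of 2b, 2c, 2d lie in 0, 1, 2, 4 and add up to 3: they are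
    1, 1, 1 or a permutation of 0, 1, 2. The latter is brought to the former by a rotation about
    i. *)
Lemma octahedral_form r : sl2_rep r -> attained r (Num.sqrt 2)^-1 (Num.sqrt 2)^-1 0 0 ->
  attained r 0 0 1 0 -> traces_in r octahedral_traces -> (exists g, \tr (r g) = 1%:C%C) ->
  exists2 r', conj_rep r r' & [/\ attained r' (Num.sqrt 2)^-1 (Num.sqrt 2)^-1 0 0,
    attained r' 0 0 1 0 & attained r' 2^-1 2^-1 2^-1 2^-1].
Proof.
rewrite /octahedral_traces /tetrahedral_traces /= sqrt2V; have := sqrt2_sqr; have /andP[] := sqrt2_bounds.
move: (Num.sqrt 2) => s s1 s15 s2 rP rt rj; set T := (T in traces_in r T) => trT g1.
have oppT x : x \in T -> - x \in T.
  by rewrite /T !inE => /or4P[|||/or4P[]] /eqP->; rewrite ?oppr0 ?opprK eqxx ?orbT.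
have sqrT x : x \in T -> [\/ x ^+ 2 = 0, x ^+ 2 = 1, x ^+ 2 = 2 | x ^+ 2 = 4].
  rewrite /T !inE => /or4P[|||/or4P[]] /eqP->; rewrite ?sqrrN.
  - by constructor 1; ring.
  - by constructor 2; ring.
  - by constructor 2; ring.
  - by constructor 4; ring.
  - by constructor 4; ring.
  - by constructor 3.
  - by constructor 3.
have ri : attained r 0 1 0 0 by apply: attained_eq (attained_mul rP rt rt) _ _ _ _; lra.
have Q : quaternion_units r by [].
have [b [c [d [rg bT /sqrT cT /sqrT dT]]]] := attained_trace rP Q trT oppT g1.
have := attained_norm rP rg => n1.
have /sqrT yT := attained_real trT (attained_mul rP rt rg).
(* The product with (1 + i) / sqrt 2 must have its trace in the list too; this trace is (1 - 2b) /
   sqrt 2, which leaves only b = 1/2 or -1/2. *)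
have b1 : (2 * b) ^+ 2 = 1.
  have {}n1 : (2 * b) ^+ 2 + (2 * c) ^+ 2 + (2 * d) ^+ 2 = 3 by lra.
  have {}yT : [\/ (1 - 2 * b) ^+ 2 = 0, (1 - 2 * b) ^+ 2 = 2, (1 - 2 * b) ^+ 2 = 4 | (1 - 2 * b) ^+ 2 = 8].
    have E : (1 - 2 * b) ^+ 2 = 2 * (2 * (s / 2 * (1 / 2) - s / 2 * b - 0 * c - 0 * d)) ^+ 2.
      by rewrite -[LHS]mul1r -[X in X * _](_ : s ^+ 2 / 2 = 1); [field|rewrite s2; field].
    by case: yT => y2; [constructor 1|constructor 2|constructor 3|constructor 4]; rewrite E y2; ring.
  have c0 := sqr_ge0 (2 * c); have d0 := sqr_ge0 (2 * d).
  move: (2 * b) (2 * c) (2 * d) bT {cT dT} yT n1 c0 d0 => x y z.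
  rewrite /T !inE => /or4P[|||/or4P[]] /eqP-> yT n1 c0 d0; first by case: yT; lra.
  - by ring.
  - by ring.
  - by lra.
  - by lra.
  - by case: yT; lra.
  - by case: yT; lra.
have Hcd : [\/ (2 * c) ^+ 2 = 1 /\ (2 * d) ^+ 2 = 1, c ^+ 2 = 0 /\ (2 * d) ^+ 2 = 2
     | (2 * c) ^+ 2 = 2 /\ d ^+ 2 = 0].
  have d0 := sqr_ge0 (2 * d); case: cT => ec.
  - by constructor 2; split; lra.
  - by constructor 1; split; lra.
  - by constructor 3; split; lra.
  - by exfalso; lra.
have {}Hcd : (2 * c) ^+ 2 = 1 /\ (2 * d) ^+ 2 = 1 \/
    2^-1 ^+ 2 = (s / 2 * (c - d)) ^+ 2 /\ 2^-1 ^+ 2 = (s / 2 * (c + d)) ^+ 2.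
  have E x : (s / 2 * x) ^+ 2 = x ^+ 2 / 2 by rewrite exprMn expr_div_n s2; field.
  rewrite !E; case: Hcd => [|[/eqP + d2]|[c2 /eqP]]; first by left.
    by rewrite sqrf_eq0 => /eqP->; right; split; lra.
  by rewrite sqrf_eq0 => /eqP->; right; split; lra.
case: Hcd => [[c1 d1]|[c1 d1]].
  exists r; first exact: conj_rep_refl.
  rewrite -?sqrt2V; split=> //; apply: (attained_signs rP Q (half_sqr b1) (half_sqr c1) (half_sqr d1)).
  by apply: attained_eq rg _ _ _ _ => //; field.
(* Here p0 = cos(pi / 8) and p1 = sin(pi / 8): conjugation by p0 + p1 i turns the plane of j and k
   by pi / 4 and makes both remaining coordinates 1/2 up to sign. *)
pose p0 : R := Num.sqrt ((2 + s) / 4); have p02 : p0 ^+ 2 = (2 + s) / 4.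
  by rewrite sqr_sqrtr //; lra.
have p0N : p0 != 0 by rewrite -sqrf_eq0 p02 gt_eqF //; lra.
pose p1 := s / 4 / p0; have p12 : p1 ^+ 2 = (2 - s) / 4.
  rewrite /p1 !expr_div_n s2 p02 -[(2 - s) / 4](mulfK (_ : (2 + s) / 4 != 0)); last first.
    by rewrite gt_eqF //; lra.
  congr (_ / _); lra.
have p01 : 2 * p0 * p1 = s / 2 by rewrite /p1; field.
have [|r' rr' E] := conj_rotation (p0 := p0) (p1 := p1) rP; first by rewrite p02 p12; lra.
have {}E x y z w : attained r x y z w -> attained r' x y (s / 2 * (z - w)) (s / 2 * (z + w)).
  by move=> /E/attained_eq; apply; rewrite ?p01 ?p02 ?p12; lra.
exists r' => //; have rP' := conj_rep_sl2 rP rr'.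
have rt' : attained r' (s / 2) (s / 2) 0 0 by apply: attained_eq (E _ _ _ _ rt) _ _ _ _; ring.
have ri' : attained r' 0 1 0 0 by apply: attained_eq (attained_mul rP' rt' rt') _ _ _ _; lra.
(* The rotation has carried j to (j + k) / sqrt 2. Multiplying by (1 + i) / sqrt 2 gives k, and then
   k i = j. *)
have rk' : attained r' 0 0 0 1.
  by apply: attained_eq (attained_mul rP' rt' (E _ _ _ _ rj)) _ _ _ _; lra.
have rj' : attained r' 0 0 1 0 by apply: attained_eq (attained_mul rP' rk' ri') _ _ _ _; lra.
have Q' : quaternion_units r' by [].
split=> //; apply: (attained_signs rP' Q' (half_sqr b1) c1 d1).
by apply: attained_eq (E _ _ _ _ rg) _ _ _ _ => //; field.
Qed.

End NormalForms.

Section Icosahedral.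
Variables (R : realType) (gT : finGroupType).
Implicit Types (r : gT -> 'M[R[i]]_2) (a b c d : R).

Definition attained_conj r a b c d := exists2 r', conj_rep r r' &
  quaternion_units r' /\ attained r' a b c d.

(** Conjugation by (1 + i + j + k) / 2 permutes i, j, k cyclically. *)
Lemma attained_conj_cycle r a b c d : sl2_rep r ->
  attained_conj r a b c d -> attained_conj r a d b c.
Proof.
move=> rP [r1 rr1 [[ri rj] rg]]; have rP1 := conj_rep_sl2 rP rr1.
have rk : attained r1 0 0 0 1 by apply: attained_eq (attained_mul rP1 ri rj) _ _ _ _; ring.
have [|r2 rr2 E] := @conj_attained R gT r1 2^-1 2^-1 2^-1 2^-1 rP1; first by lra.
exists r2; first exact: conj_rep_trans rr1 rr2.
by split; [split; [apply: E rk _|apply: E ri _]|apply: E rg _]; rewrite !quat_mul; congr quat; ring.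
Qed.

(** Conjugation by (i + j) / sqrt 2 exchanges i and j and reverses k. *)
Lemma attained_conj_swap r a b c d : sl2_rep r ->
  attained_conj r a b c d -> attained_conj r a c b (- d).
Proof.
move=> rP [r1 rr1 [[ri rj] rg]]; have rP1 := conj_rep_sl2 rP rr1.
pose s : R := Num.sqrt 2 / 2; have s2 : s ^+ 2 = 1 / 2 by rewrite expr_div_n sqrt2_sqr; field.
have [|r2 rr2 E] := @conj_attained R gT r1 0 s s 0 rP1; first by rewrite s2; lra.
exists r2; first exact: conj_rep_trans rr1 rr2.
by split; [split; [apply: E rj _|apply: E ri _]|apply: E rg _]; rewrite !quat_mul; congr quat; ring.
Qed.

(** With f the golden ratio, the squares of 2b, 2c, 2d add up to 3 - f < 7/5, which leaves the
    values 0, 1 and 2 - f = (f - 1)^2. The sum forces each of them once; cyclic permutations and a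
    swap restore the order. *)
Lemma icosahedral_form r : sl2_rep r -> quaternion_units r -> traces_in r (icosahedral_traces R) ->
  (exists g, \tr (r g) = (golden R)%:C%C) ->
  attained_conj r (golden R / 2) ((golden R)^-1 / 2) 2^-1 0.
Proof.
rewrite /icosahedral_traces /tetrahedral_traces /= goldenV.
have := golden_sqr R; have /andP[] := golden_bounds R.
move: (golden R) => f f1 f17 f2 rP Q; set T := (T in traces_in r T) => trT g1.
have oppT x : x \in T -> - x \in T.
  by rewrite /T !inE => /or4P[|||/or4P[|||/or3P[]]] /eqP->; rewrite ?oppr0 ?opprB ?opprK eqxx ?orbT.
have sqrT x : x \in T -> x ^+ 2 < 7 / 5 -> [\/ x ^+ 2 = 0, x ^+ 2 = 1 | x ^+ 2 = 2 - f].
  rewrite /T !inE => /or4P[|||/or4P[|||/or3P[]]] /eqP->; rewrite ?sqrrN.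
  - by constructor 1; ring.
  - by constructor 2; ring.
  - by constructor 2; ring.
  - by lra.
  - by lra.
  - by lra.
  - by lra.
  - by constructor 3; lra.
  - by constructor 3; lra.
have [b [c [d [rg bT cT dT]]]] := attained_trace rP Q trT oppT g1.
have n1 : (2 * b) ^+ 2 + (2 * c) ^+ 2 + (2 * d) ^+ 2 = 3 - f by have := attained_norm rP rg; lra.
have [b0 c0 d0] := And3 (sqr_ge0 (2 * b)) (sqr_ge0 (2 * c)) (sqr_ge0 (2 * d)).
have {}bT := sqrT _ bT ltac:(lra); have {}cT := sqrT _ cT ltac:(lra).
have {}dT := sqrT _ dT ltac:(lra).
have {}rg : attained_conj r (f / 2) b c d by exists r => //; exact: conj_rep_refl.
have final x y z : (2 * x) ^+ 2 = 2 - f -> (2 * y) ^+ 2 = 1 -> (2 * z) ^+ 2 = 0 ->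
    attained_conj r (f / 2) x y z -> attained_conj r (f / 2) ((f - 1) / 2) 2^-1 0.
  move=> x2 y2 z2 [r' rr' [Q' rg']]; exists r' => //; split=> //.
  by apply: (attained_signs (conj_rep_sl2 rP rr') Q' _ _ _ rg'); lra.
have cyc x y z : attained_conj r (f / 2) x y z -> attained_conj r (f / 2) z x y.
  exact: attained_conj_cycle.
have swap x y z : attained_conj r (f / 2) x y z -> attained_conj r (f / 2) y x (- z).
  exact: attained_conj_swap.
case: bT => eb; case: cT => ec; case: dT => ed; try by exfalso; lra.
- by apply: final (swap _ _ _ (cyc _ _ _ (cyc _ _ _ rg))); lra.
- by apply: final (cyc _ _ _ (cyc _ _ _ rg)); lra.
- by apply: final (cyc _ _ _ rg); lra.
- by apply: final (swap _ _ _ rg); lra.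
- by apply: final (swap _ _ _ (cyc _ _ _ rg)); lra.
- by apply: final rg; lra.
Qed.

End Icosahedral.

(** * Generation and classification *)

Section Generation.
Variables (R : realType) (gT : finGroupType) (r : gT -> 'M[R[i]]_2).
Hypothesis rP : sl2_rep r.
Let C := R[i].

Lemma rep_quatM x y a b c d a' b' c' d' a2 b2 c2 d2 : r x = quat a b c d -> r y = quat a' b' c' d' ->
  a * a' - b * b' - c * c' - d * d' = a2 -> a * b' + b * a' + c * d' - d * c' = b2 ->
  a * c' - b * d' + c * a' + d * b' = c2 -> a * d' + b * c' - c * b' + d * a' = d2 ->
  r (x * y)%g = quat a2 b2 c2 d2.
Proof. by move=> rx ry <- <- <- <-; rewrite (repM rP) rx ry quat_mul. Qed.

(** The generated subgroup has order divisible by 8, from i and j, and by 3, so it is everything. *)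
Lemma binary_tetrahedral_image : #|gT| = 24%N -> quaternion_units r ->
  attained r 2^-1 2^-1 2^-1 2^-1 -> forall A, (exists g, r g = A) <-> binary_tetrahedral A.
Proof.
move=> card [[gi ri] [gj rj]] [gs rs] A; rewrite /binary_tetrahedral -ri -rj -rs.
apply: (rep_generated (gs := [:: gi; gj; gs])) => //.
have mem x : x \in [:: gi; gj; gs] -> x \in <<[set g in [:: gi; gj; gs]]>>%g.
  by move=> xs; apply: mem_gen; rewrite inE.
apply: (card_full (a := 8) (b := 3)) card => //.
  have -> : 8%N = (2 * #[gi]%g)%N by rewrite (order_imaginary rP ri).
  apply: (order_double_dvd rP ri (oner_neq0 _) rj); apply: mem; rewrite !inE eqxx ?orbT //.
apply: dvdn_trans (order_quat3 rP rs) _; apply: order_dvdG; apply: mem.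
by rewrite !inE eqxx !orbT.
Qed.

Lemma binary_octahedral_image : #|gT| = 48%N ->
  attained r (Num.sqrt 2)^-1 (Num.sqrt 2)^-1 0 0 ->
  attained r 2^-1 2^-1 2^-1 2^-1 -> forall A, (exists g, r g = A) <-> binary_octahedral A.
Proof.
move=> card [gt rt] [gs rs] A; rewrite /binary_octahedral -rs -rt.
apply: (rep_generated (gs := [:: gs; gt])) => //; set H := <<_>>%g.
have sH : gs \in H by apply: mem_gen; rewrite !inE eqxx.
have tH : gt \in H by apply: mem_gen; rewrite !inE eqxx orbT.
move: rt; rewrite sqrt2V; have := sqrt2_sqr R; have /andP[] := sqrt2_bounds R.
move: (Num.sqrt 2) => q q1 q15 q2 rt.
have ri : r (gt ^+ 2)%g = quat 0 1 0 0.
  by rewrite (rep_pow2 rP rt); congr quat; lra.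
(* Conjugation by (1 + i + j + k) / 2 carries i = [gt ^+ 2] to j. *)
have rj : r (gs * gt ^+ 2 * gs^-1)%g = quat 0 0 1 0.
  have r1 : r (gs * gt ^+ 2)%g = quat (- 1 / 2) (1 / 2) (1 / 2) (- 1 / 2).
    by apply: rep_quatM rs ri _ _ _ _; lra.
  by apply: rep_quatM r1 (rep_quatV rP rs) _ _ _ _; lra.
apply: (card_full (a := 16) (b := 3)) card => //; last first.
  by apply: dvdn_trans (order_quat3 rP rs) _; apply: order_dvdG.
have t8 : #[gt]%g = 8%N.
  have r4 : r (gt ^+ 4)%g = quat (-1) 0 0 0.
    have -> : (gt ^+ 4 = (gt ^+ 2) ^+ 2)%g by exact: (expgM gt 2 2).
    by rewrite (rep_pow2 rP ri); congr quat; lra.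
  apply: (@order_pexp _ 2 2) => //; last first.
    by apply: rep_neq1 r4 _ => //; rewrite lt_eqF //; lra.
  have -> : (gt ^+ (2 ^ 3) = (gt ^+ 4) ^+ 2)%g by exact: (expgM gt 4 2).
  by apply: rep_is1 (rep_pow2 rP r4) _ => //; lra.
have -> : 16%N = (2 * #[gt]%g)%N by rewrite t8.
apply: (order_double_dvd rP rt _ rj) => //; first by rewrite gt_eqF //; lra.
by rewrite groupM ?groupV ?groupM ?groupX.
Qed.

Lemma binary_icosahedral_image : #|gT| = 120%N -> quaternion_units r ->
  attained r (golden R / 2) ((golden R)^-1 / 2) 2^-1 0 ->
  forall A, (exists g, r g = A) <-> binary_icosahedral A.
Proof.
move=> card [ri0 [gj rj]] [gt rt] A; rewrite /binary_icosahedral.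
have := rt; rewrite goldenV => {}rt; have phi2 := golden_sqr R.
(* A word in the icosian and j whose value is the first standard generator. *)
pose gs := (gt * gj * gt^-1 * gt^-1)%g.
have rT := rep_quatV rP rt.
pose f := golden R.
have rs : r gs = quat 2^-1 2^-1 2^-1 2^-1.
  have r1 : r (gt * gj)%g = quat (- 1 / 2) 0 (f / 2) ((f - 1) / 2) by apply: rep_quatM rt rj _ _ _ _; rewrite /f; lra.
  have r2 : r (gt * gj * gt^-1)%g = quat 0 ((f - 1) / 2) (f / 2) (1 / 2).
    by apply: rep_quatM r1 rT _ _ _ _; rewrite /f; lra.
  by apply: rep_quatM r2 rT _ _ _ _; rewrite /f; lra.
move: gs rs => gs rs.
(* Words that recover i and j from the two standard generators alone, so that 8 divides the order of
   the subgroup generated by them. *)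
have rI : r (gt * gs * gt^-1 * gs * gt^-1)%g = quat 0 1 0 0.
  have r1 : r (gt * gs)%g = quat 0 (f / 2) (1 / 2) ((f - 1) / 2) by apply: rep_quatM rt rs _ _ _ _; rewrite /f; lra.
  have r2 : r (gt * gs * gt^-1)%g = quat (1 / 2) (f / 2) ((f - 1) / 2) 0.
    by apply: rep_quatM r1 rT _ _ _ _; rewrite /f; lra.
  have r3 : r (gt * gs * gt^-1 * gs)%g = quat ((1 - f) / 2) (f / 2) 0 (1 / 2).
    by apply: rep_quatM r2 rs _ _ _ _; rewrite /f; lra.
  by apply: rep_quatM r3 rT _ _ _ _; rewrite /f; lra.
have rJ : r (gt^-1 * gs * gt * gt)%g = quat 0 0 1 0.
  have r1 : r (gt^-1 * gs)%g = quat (f / 2) 0 ((f - 1) / 2) (1 / 2) by apply: rep_quatM rT rs _ _ _ _; rewrite /f; lra.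
  have r2 : r (gt^-1 * gs * gt)%g = quat (1 / 2) 0 (f / 2) ((f - 1) / 2).
    by apply: rep_quatM r1 rt _ _ _ _; rewrite /f; lra.
  by apply: rep_quatM r2 rt _ _ _ _; rewrite /f; lra.
rewrite -rs -rt.
apply: (rep_generated (gs := [:: gs; gt])) => //; set H := <<_>>%g.
have sH : gs \in H by apply: mem_gen; rewrite !inE eqxx.
have tH : gt \in H by apply: mem_gen; rewrite !inE eqxx orbT.
apply: (card_full (a := 8) (b := 15)) card => //.
  have -> : 8%N = (2 * #[gt * gs * gt^-1 * gs * gt^-1]%g)%N by rewrite (order_imaginary rP rI).
  apply: (order_double_dvd rP rI _ rJ); rewrite ?oner_neq0 // ?(groupM, groupV) //.
rewrite -[15%N]/(3 * 5)%N Gauss_dvd //; apply/andP; split.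
  by apply: dvdn_trans (order_quat3 rP rs) _; apply: order_dvdG.
by apply: dvdn_trans (order_quat5 rP rt) _; apply: order_dvdG.
Qed.

End Generation.

(** * Conjugacy with the model groups *)

Section Classification.
Variables (R : realType) (gT : finGroupType) (r : gT -> 'M[R[i]]_2).
Hypothesis rP : sl2_rep r.
Let C := R[i].

Definition conj_image (S : 'M[C]_2 -> Prop) :=
  exists2 r', conj_rep r r' & forall A, (exists g, r' g = A) <-> S A.

Lemma conj_image_cyclic Q : axis Q -> stab r Q = [set: gT] ->
  exists2 z : C, #|gT|.-primitive_root z & conj_image (cyclic_SL2 z).
Proof.
move=> aQ QT; have [r' rr' sE] := conj_diag r aQ; have rP' := conj_rep_sl2 rP rr'.
have [g [z [gE rg zP]]] := stab_dmx_cyclic rP'.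
exists z; first by rewrite -cardsT -QT -sE.
exists r' => // A; rewrite /cyclic_SL2 diagSL2E -rg.
apply: (rep_generated (gs := [:: g])) => //; rewrite -QT -sE gE; congr <<_>>%g.
by apply/setP => x; rewrite !inE.
Qed.

Lemma conj_image_dihedral n Q : axis Q -> #|stab r Q| = (2 * n)%N -> #|gT| = (4 * n)%N ->
  (1 < n)%N -> exists2 z : C, (2 * n).-primitive_root z & conj_image (binary_dihedral z).
Proof.
move=> aQ Qn Gn n1.
have [||r' rr' [g0 [z [g1 [r0 r1 zP sE cE]]]]] := dihedral_normal_form rP aQ.
- by rewrite Qn Gn mulnA.
- by rewrite Qn; lia.
have rP' := conj_rep_sl2 rP rr'.
exists z; first by rewrite -Qn.
exists r' => // A; rewrite /binary_dihedral diagSL2E quat_j -r0 -r1.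
apply: (rep_generated (gs := [:: g0; g1])) => //; set H := <<_>>%g.
have sH : stab_group rP' (dmx 1 (-1)) \subset H.
  by rewrite /= sE cycle_subG; apply: mem_gen; rewrite !inE eqxx.
have g1H : g1 \in H by apply: mem_gen; rewrite !inE eqxx orbT.
have g1s : g1 \notin stab r' (dmx 1 (-1)).
  apply/negP => /(stab_dmxP rP')/matrixP/(_ 0 1)/eqP.
  by rewrite r1 !mxE /= oner_eq0.
have : (1 < #|<<[set g in [:: g0; g1]]>>%G : stab_group rP' (dmx 1 (-1))|%g)%N.
  by rewrite indexg_gt1; apply/subsetPn; exists g1.
have := Lagrange sH; rewrite /= cE Qn => E i1.
apply/eqP; rewrite eqEcard subsetT cardsT Gn -/H -E.
by rewrite (_ : 4 * n = 2 * n * 2)%N ?leq_mul2l ?i1 ?orbT //; lia.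
Qed.

Section Polyhedral.
Variables e2 e3 : nat.
Hypothesis pole_order : forall e : nat, e \in [:: 2%N; e2; e3] ->
  exists2 Q, axis Q & #|stab r Q| = (2 * e)%N.
Hypothesis elt_pole : forall g, ~~ central r g -> exists2 e : nat, e \in [:: 2%N; e2; e3] &
    exists2 Q, axis Q & g \in stab r Q /\ #|stab r Q| = (2 * e)%N.

Lemma polyhedral_traces (T : seq R) : 2 \in T -> -2 \in T ->
  (forall (e : nat) (z : C), e \in [:: 2%N; e2; e3] -> z ^+ (2 * e) = 1 ->
    exists2 x, x \in T & z + z^-1 = x%:C%C) -> traces_in r T.
Proof.
move=> T2 TN2 Tz g; case: (boolP (central r g)) => [/orP[]/eqP->|cg].
- by exists 2 => //; rewrite -quat1 trace_quat mulr1.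
- by exists (- 2) => //; rewrite raddfN /= -quat1 trace_quat mulr1 rmorphN.
have [e eL [Q aQ [gQ QE]]] := elt_pole cg.
by have [z ze ->] := stab_trace rP aQ gQ; apply: Tz eL _; rewrite -QE.
Qed.

(** Serves to exclude elements of order 8 or 16, so that the Sylow 2-subgroups are not cyclic. *)
Lemma polyhedral_order (g : gT) : exists2 e : nat, e \in [:: 2%N; e2; e3] & (#[g]%g %| 2 * e)%N.
Proof.
case: (boolP (central r g)) => [cg|/elt_pole[e eL [Q aQ [gQ QE]]]]; last first.
  by exists e => //; rewrite -QE; exact: (@order_dvdG _ (stab_group rP Q) g).
exists 2%N; rewrite ?inE // order_dvdn; apply/eqP/(rep_inj rP).
have g2 : r g ^+ 2 = 1.
  by rewrite expr2 -[_ * _]/(_ *m _); case/orP: cg => /eqP->; rewrite ?mulNmx ?mulmxN ?mul1mx ?opprK.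
by rewrite (repX rP) (rep1 rP) (exprM _ 2 2) g2 expr1n.
Qed.

(** Every root of unity of order dividing 2e is an eigenvalue in the stabiliser of order 2e; the
    last hypothesis puts the eigenvalues belonging to the trace t among them. *)
Lemma polyhedral_trace_exists e (t : R) : e \in [:: 2%N; e2; e3] ->
  (forall w : C, w ^+ 2 = t%:C%C * w - 1 -> w ^+ (2 * e) = 1) ->
  exists g, \tr (r g) = t%:C%C.
Proof.
move=> /pole_order[Q aQ QE] tw; have [w w0 wE] := root_of_trace (t%:C%C : C).
have w2 : w ^+ 2 = t%:C%C * w - 1 by rewrite -wE mulrDl mulVf // addrK.
have := tw w w2; rewrite -QE => /(trace_root rP aQ)[g _ gE].
by exists g; rewrite gE wE.
Qed.

End Polyhedral.

Lemma tetrahedral_root_traces (e : nat) (z : C) : e \in [:: 2; 3; 3]%N -> z ^+ (2 * e) = 1 ->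
  exists2 x, x \in tetrahedral_traces R & z + z^-1 = x%:C%C.
Proof.
rewrite !inE orbb => /orP[]/eqP-> /=.
  case/trace_root4 => ->; [exists 2|exists (-2)|exists 0]; rewrite ?inE ?eqxx ?orbT //;
    rewrite ?rmorphN ?rmorph_nat ?rmorph0 //.
by case/trace_root6 => ->; [exists 2|exists (-2)|exists 1|exists (-1)];
  rewrite ?inE ?eqxx ?orbT ?rmorphN ?rmorph_nat ?rmorph1 //.
Qed.

Lemma octahedral_root_traces (e : nat) (z : C) : e \in [:: 2; 3; 4]%N -> z ^+ (2 * e) = 1 ->
  exists2 x, x \in octahedral_traces R & z + z^-1 = x%:C%C.
Proof.
move=> eL zE; have [e4|e4] := eqVneq e 4%N; last first.
  have [|x xT ->] := tetrahedral_root_traces _ zE; last by exists x; rewrite // mem_cat xT.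
  by move: eL; rewrite !inE (negPf e4) orbb orbF.
move: zE; rewrite e4 => /trace_root8[->|->|->|].
- by exists 2; rewrite ?mem_cat ?inE ?eqxx ?orbT // rmorph_nat.
- by exists (-2); rewrite ?mem_cat ?inE ?eqxx ?orbT // rmorphN rmorph_nat.
- by exists 0; rewrite ?mem_cat ?inE ?eqxx ?orbT // rmorph0.
have -> : 2 = (Num.sqrt 2)%:C%C ^+ 2 :> C by rewrite -rmorphXn /= sqrt2_sqr rmorph_nat.
move=> /eqP; rewrite eqf_sqr => /orP[]/eqP->; [exists (Num.sqrt 2)|exists (- Num.sqrt 2)] => //.
- by rewrite !mem_cat !inE !eqxx ?orbT.
- by rewrite !mem_cat !inE !eqxx ?orbT.
- by rewrite rmorphN.
Qed.

Lemma icosahedral_root_traces (e : nat) (z : C) : e \in [:: 2; 3; 5]%N -> z ^+ (2 * e) = 1 ->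
  exists2 x, x \in icosahedral_traces R & z + z^-1 = x%:C%C.
Proof.
move=> eL zE; have [e5|e5] := eqVneq e 5%N; last first.
  have [|x xT ->] := tetrahedral_root_traces _ zE; last by exists x; rewrite // mem_cat xT.
  by move: eL; rewrite !inE (negPf e5) orbb orbF.
have fE : (golden R)%:C%C ^+ 2 = (golden R)%:C%C + 1 :> C.
  by rewrite -rmorphXn /= golden_sqr rmorphD rmorph1.
move: zE; rewrite e5 => /trace_root10[->|->||].
- by exists 2; rewrite ?mem_cat ?inE ?eqxx ?orbT // rmorph_nat.
- by exists (-2); rewrite ?mem_cat ?inE ?eqxx ?orbT // rmorphN rmorph_nat.
- move: (z + _) => w wE; have /eqP : (w - (golden R)%:C%C) * (w - (1 - (golden R)%:C%C)) = 0.
    apply: etrans (_ : w ^+ 2 - w - ((golden R)%:C%C ^+ 2 - (golden R)%:C%C) = 0); first by ring.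
    by rewrite wE fE; ring.
  rewrite mulf_eq0 !subr_eq0 => /orP[]/eqP->; [exists (golden R)|exists (1 - golden R)] => //.
  + by rewrite !mem_cat !inE !eqxx ?orbT.
  + by rewrite !mem_cat !inE !eqxx ?orbT.
  + by rewrite rmorphB rmorph1.
- move: (z + _) => w wE; have /eqP : (w + (golden R)%:C%C) * (w - ((golden R)%:C%C - 1)) = 0.
    apply: etrans (_ : w ^+ 2 + w - ((golden R)%:C%C ^+ 2 - (golden R)%:C%C) = 0); first by ring.
    by rewrite wE fE; ring.
  rewrite mulf_eq0 addr_eq0 subr_eq0 => /orP[]/eqP->; [exists (- golden R)|exists (golden R - 1)] => //.
  + by rewrite !mem_cat !inE !eqxx ?orbT.
  + by rewrite rmorphN.
  + by rewrite !mem_cat !inE !eqxx ?orbT.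
  + by rewrite rmorphB rmorph1.
Qed.

End Classification.

(** * Sylow 2-subgroups and the case distinction *)

Section FiniteRep.
Variables (R : realType) (gT : finGroupType) (r : gT -> 'M[R[i]]_2).
Hypothesis rP : sl2_rep r.
Let C := R[i].

Lemma conj_traces_in r' T : conj_rep r r' -> traces_in r T -> traces_in r' T.
Proof. by move=> rr' trT g; rewrite (conj_rep_trace g rr'). Qed.

Lemma conj_trace_exists r' (t : C) : conj_rep r r' -> (exists g, \tr (r g) = t) -> exists g, \tr (r' g) = t.
Proof. by move=> rr' [g gt]; exists g; rewrite (conj_rep_trace g rr'). Qed.

Lemma conj_image_trans r' (S : 'M[C]_2 -> Prop) : conj_rep r r' -> conj_image r' S -> conj_image r S.
Proof. by move=> rr' [r2 r'r2 rS]; exists r2 => //; exact: conj_rep_trans rr' r'r2. Qed.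

Lemma quaternion_subgroup (H : {group gT}) : #|H| = 8%N -> (forall g : gT, #[g]%g <> 8%N) ->
  exists2 r', conj_rep r r' & quaternion_units r'.
Proof.
move=> H8 N8; have [//|r' rr' [[g gE] ex]] := subgroup_dihedral rP (e := 2) isT H8 _ N8.
exists r' => //; split; last by exists g; rewrite gE quat_j.
have iV : (Complex 0 1)^-1 = Complex 0 (- 1) :> C.
  by apply: complexP; rewrite /= ?oppr0 ?expr0n /= ?expr1n add0r ?mul0r ?divr1 ?invr1 ?mulr1.
have [|h hE] := ex (Complex 0 1).
  have i2 : Complex 0 1 ^+ 2 = -1 :> C by apply: complexP => /=; ring.
  by rewrite (exprM _ 2 2) i2 sqrrN expr1n.
by exists h; rewrite hE iV quat_dmx.
Qed.

Lemma quaternion16_subgroup (H : {group gT}) : #|H| = 16%N -> (forall g : gT, #[g]%g <> 16%N) ->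
  exists2 r', conj_rep r r' & attained r' (Num.sqrt 2)^-1 (Num.sqrt 2)^-1 0 0 /\ attained r' 0 0 1 0.
Proof.
move=> H16 N16; have [//|r' rr' [[g gE] ex]] := subgroup_dihedral rP (e := 4) isT H16 _ N16.
exists r' => //; split; last by exists g; rewrite gE quat_j.
rewrite sqrt2V; have := sqrt2_sqr R; move: (Num.sqrt 2) => s s2.
have zz : Complex (s / 2) (s / 2) * Complex (s / 2) (- (s / 2)) = 1 :> C.
  by apply: complexP => /=; lra.
have zV : (Complex (s / 2) (s / 2))^-1 = Complex (s / 2) (- (s / 2)) :> C.
  have z0 : Complex (s / 2) (s / 2) != 0 :> C.
    by apply: contra_eq_neq zz => ->; rewrite mul0r eq_sym oner_neq0.
  by apply: (mulfI z0); rewrite divff.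
have [|h hE] := ex (Complex (s / 2) (s / 2)).
  have i2 : Complex (s / 2) (s / 2) ^+ 2 = Complex 0 1 :> C by apply: complexP => /=; lra.
  have i4 : Complex 0 1 ^+ 2 = -1 :> C by apply: complexP => /=; ring.
  by rewrite (exprM _ 2 4) i2 (exprM _ 2 2) i4 sqrrN expr1n.
by exists h; rewrite hE zV quat_dmx.
Qed.

Lemma sylow_card p k m : prime p -> ~~ (p %| m)%N -> #|gT| = (p ^ k * m)%N ->
  exists H : {group gT}, #|H| = (p ^ k)%N.
Proof.
move=> pr pm cE; have [H sylH] := Sylow_exists p [set: gT]%G; exists H.
have m0 : (0 < m)%N by rewrite lt0n; apply: contraNneq pm => ->.
rewrite (card_Hall sylH) cardsT cE p_part lognM //; last by rewrite expn_gt0 prime_gt0.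
by rewrite pfactorK // lognE (negPf pm) !andbF addn0.
Qed.

Definition sl2_classification :=
  [\/ exists2 z : C, #|gT|.-primitive_root z & conj_image r (cyclic_SL2 z),
     exists n, [/\ (0 < n)%N, #|gT| = (4 * n)%N & exists2 z : C, (2 * n).-primitive_root z &
       conj_image r (binary_dihedral z)],
     #|gT| = 24%N /\ conj_image r (@binary_tetrahedral R)
   | #|gT| = 48%N /\ conj_image r (@binary_octahedral R) \/
     #|gT| = 120%N /\ conj_image r (@binary_icosahedral R)].

Lemma finite_sl2_classification : sl2_classification.
Proof.
have [[Q aQ QT]|[_ [e2 [e3 [typ ex el]]]]] := sl2_rep_type rP.
  by constructor 1; exact: conj_image_cyclic aQ QT.
have trace1 e : e \in [:: 2%N; e2; e3] -> e = 3%N -> exists g, \tr (r g) = 1%:C%C.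
  move=> eL e3E; apply: (polyhedral_trace_exists rP ex eL) => w; rewrite rmorph1 mul1r e3E => w2.
  have w3 : w ^+ 3 = -1 by rewrite exprS w2 mulrBr mulr1 -expr2 w2 addrAC subrr sub0r.
  by rewrite mulnC (exprM _ 3 2) w3 sqrrN expr1n.
have twos T : 2 \in tetrahedral_traces R ++ T /\ -2 \in tetrahedral_traces R ++ T.
  by rewrite !mem_cat !inE !eqxx !orbT.
case: typ => [[_ [n1 cE]]|[e2E e3E cE]|[e2E e3E cE]|[e2E e3E cE]].
- have [Q aQ QE] : exists2 Q, axis Q & #|stab r Q| = (2 * e3)%N by apply: ex; rewrite !inE eqxx !orbT.
  constructor 2; exists e3; split=> //; first exact: ltnW.
  exact: conj_image_dihedral aQ QE cE n1.
- subst e2 e3; constructor 3; split=> //.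
  have [H H8] := @sylow_card 2 3 3 isT isT cE.
  have [|r' rr' Q] := quaternion_subgroup H8.
    by move=> g g8; have [e] := polyhedral_order rP el g; rewrite g8 !inE orbb => /orP[]/eqP->.
  have rP' := conj_rep_sl2 rP rr'; apply: (conj_image_trans rr').
  have trT : traces_in r (tetrahedral_traces R).
    by have [] := twos [::]; rewrite cats0 => T2 TN2; apply: (polyhedral_traces rP el T2 TN2) (@tetrahedral_root_traces R).
  have rs := tetrahedral_form rP' Q (conj_traces_in rr' trT) (conj_trace_exists rr' (trace1 3%N isT erefl)).
  by exists r'; [exact: conj_rep_refl|exact: binary_tetrahedral_image].
- subst e2 e3; constructor 4; left; split=> //.
  have [H H16] := @sylow_card 2 4 3 isT isT cE.
  have [|r' rr' [rt rj]] := quaternion16_subgroup H16.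
    by move=> g g8; have [e] := polyhedral_order rP el g; rewrite g8 !inE => /or3P[]/eqP->.
  have rP' := conj_rep_sl2 rP rr'; apply: (conj_image_trans rr').
  have trT : traces_in r (octahedral_traces R).
    by have [T2 TN2] := twos [:: Num.sqrt 2; - Num.sqrt 2]; apply: (polyhedral_traces rP el T2 TN2) (@octahedral_root_traces R).
  have [r2 r'r2 [rt2 rj2 rs2]] := octahedral_form rP' rt rj (conj_traces_in rr' trT)
    (conj_trace_exists rr' (trace1 3%N isT erefl)).
  by exists r2 => //; exact: (binary_octahedral_image (conj_rep_sl2 rP' r'r2) cE rt2 rs2).
- subst e2 e3; constructor 4; right; split=> //.
  have [H H8] := @sylow_card 2 3 15 isT isT cE.
  have [|r' rr' Q] := quaternion_subgroup H8.
    by move=> g g8; have [e] := polyhedral_order rP el g; rewrite g8 !inE => /or3P[]/eqP->.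
  have rP' := conj_rep_sl2 rP rr'; apply: (conj_image_trans rr').
  have trT : traces_in r (icosahedral_traces R).
    have [T2 TN2] := twos [:: golden R; - golden R; golden R - 1; 1 - golden R].
    by apply: (polyhedral_traces rP el T2 TN2) (@icosahedral_root_traces R).
  have tf : exists g, \tr (r g) = (golden R)%:C%C.
    apply: (@polyhedral_trace_exists _ _ _ rP _ _ ex 5) => // w w2.
    have fE : (golden R)%:C%C ^+ 2 = (golden R)%:C%C + 1 :> C.
      by rewrite -rmorphXn /= golden_sqr rmorphD rmorph1.
    move: (golden R)%:C%C fE w2 => f f2 w2.
    (* Reduction modulo w^2 = f w - 1 and f^2 = f + 1; multiplying once more by w gives w^5 = -1. *)
    have w4 : w ^+ 4 = w - f.
      rewrite (exprM w 2 2) w2; apply: etrans (_ : f ^+ 2 * w ^+ 2 - 2 * f * w + 1 = _); first by ring.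
      rewrite f2 w2; apply: etrans (_ : f ^+ 2 * w - f - f * w = _); first by ring.
      by rewrite f2; ring.
    have w5 : w ^+ 5 = -1 by rewrite exprS w4 mulrBr -expr2 w2; ring.
    by rewrite mulnC (exprM _ 5 2) w5 sqrrN expr1n.
  have [r2 r'r2 [Q2 rt2]] := icosahedral_form rP' Q (conj_traces_in rr' trT) (conj_trace_exists rr' tf).
  by exists r2 => //; exact: (binary_icosahedral_image (conj_rep_sl2 rP' r'r2) cE Q2 rt2).
Qed.

End FiniteRep.

(** * Back to finite subgroups of SL_2 *)

Section FinSL2.
Variables (R : realType) (G : finSL2 R[i]).

Lemma finSL2_rep : @sl2_rep R[i] (finSL2_elt G) val.
Proof. by split=> [//|x y /val_inj//|x]; apply: (finSL2_det (valP x)). Qed.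

Lemma conj_image_conjugate (S : 'M[R[i]]_2 -> Prop) :
  conj_image (val : finSL2_elt G -> 'M[R[i]]_2) S -> conjugate_SL2 G S.
Proof.
move=> [r' [P dP rE] rS]; exists P => // A.
have uP : P \in unitmx by rewrite unitmxE dP unitr1.
split=> [AG|/rS[g]]; first by apply/rS; exists [` AG]%fset; rewrite rE.
rewrite rE => /(can_inj (mulmxK (etrans (unitmx_inv P) uP)))/(can_inj (mulKmx uP)) <-.
exact: valP.
Qed.

Lemma card_finSL2 : #|finSL2_elt G| = #|` finSL2_set G|.
Proof. by rewrite cardfE. Qed.

Lemma finSL2_classification :
  [\/ exists2 n : nat, (0 < n)%N & is_cyclic_SL2 n G,
      exists2 n : nat, (0 < n)%N & is_binary_dihedral n G,
      is_binary_tetrahedral G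
    | is_binary_octahedral G \/ is_binary_icosahedral G].
Proof.
have [[z zP im]|[n [n0 cE [z zP im]]]|[cE im]|[[cE im]|[cE im]]] := finite_sl2_classification finSL2_rep;
  have {}im := conj_image_conjugate im.
- constructor 1; exists #|finSL2_elt G|; last by exists z; rewrite -card_finSL2.
  exact: prim_order_gt0 zP.
- by constructor 2; exists n => //; exists z; rewrite -card_finSL2.
- by constructor 3; split=> //; rewrite -card_finSL2.
- by constructor 4; left; split=> //; rewrite -card_finSL2.
- by constructor 4; right; split=> //; rewrite -card_finSL2.
Qed.

End FinSL2.

Theorem corollary5p7 (R : realType) (H : hopfAlgType R[i])
    (act : H -> weyl R[i] -> weyl R[i])
    (act_modalg : module_algebra act)
    (act_filt : preserves_std_filtration act)
    (act_faithful : inner_faithful act) :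
  exists G : finSL2 R[i],
    hopf_isomorphic H (grpalg R[i] (finSL2_elt G)) /\
    [\/ exists2 n : nat, (0 < n)%N & is_cyclic_SL2 n G,
        exists2 n : nat, (0 < n)%N & is_binary_dihedral n G,
        is_binary_tetrahedral G
      | is_binary_octahedral G \/ is_binary_icosahedral G].
Proof.
have [G HG] := weyl_action_group act_modalg act_filt act_faithful.
by exists G; split; [exact: HG|exact: finSL2_classification].
Qed.
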